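(* Let $\boldsymbol d'$ and $w$ satisfy conditions (i)–(iii) of the context (barely subcritical configuration model $\mathrm{CM}_n(\boldsymbol d')$ with vertex weights). Then, as $n\to\infty$, $$n^{-\delta}s_2^\star\xrightarrow{\mathbb{P}}\frac{\mu_{d,w}^2}{\mu_d\lambda_0},\qquad n^{-\delta}s_{pr}^\star\xrightarrow{\mathbb{P}}\frac{\mu_{d,w}}{\lambda_0},\qquad n^{-(\alpha+\delta)}\mathscr{W}_j\xrightarrow{\mathbb{P}}\frac{\mu_{d,w}}{\mu_d\lambda_0}c_j\ \text{ for each fixed } j\ge1,$$ $$n^{-3\alpha-3\delta+1}s_3^\star\xrightarrow{\mathbb{P}}\Big(\frac{\mu_{d,w}}{\mu_d\lambda_0}\Big)^3\sum_{i=1}^\infty c_i^3,\qquad n^{-2\delta}\mathcal{D}_n^\star\xrightarrow{\mathbb{P}}\frac{\mu_{d,w}^2}{\mu_d\lambda_0^2}.$$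
   Context: Fix $\tau\in(3,4)$, $\alpha=1/(\tau-1)$, $\eta=(\tau-3)/(\tau-1)$. $\ell^p_\downarrow$ is the set of non-increasing nonnegative sequences with finite $\sum_i x_i^p$. For each $n$, $\boldsymbol d'=(d_1',\dots,d_n')$ is a non-increasing degree sequence with even sum and $w:[n]\to[0,\infty)$, $i\mapsto w_i$, is a weight function (both depend on $n$). Assumptions: (i) For each fixed $i$, $n^{-\alpha}d_i'\to c_i$ with $\boldsymbol c=(c_i)_{i\ge1}\in\ell^3_\downarrow\setminus\ell^2_\downarrow$. The degree of a uniform vertex converges in distribution to a positive integer-valued random variable $D'$, with $\frac1n\sum_i d_i'\to\mathbb{E}[D']$ and $\frac1n\sum_i d_i'^2\to\mathbb{E}[D'^2]$, and $\lim_{K\to\infty}\limsup_{n\to\infty}n^{-3\alpha}\sum_{i>K}d_i'^3=0$. Moreover $\frac1n\sum_i d_i'\to\mu_d$, $\frac1n\sum_i w_i\to\mu_w$, $\frac1n\sum_i d_i'w_i\to\mu_{d,w}$. (ii) $\max_i w_i=O(n^\alpha)$, $\sum_i w_i^2=O(n)$, and $\max\{\sum_i w_i^3,\sum_i d_i'^2w_i,\sum_i d_i'w_i^2\}=O(n^{3\alpha})$. (iii) There exist $0<\delta<\eta$ and $\lambda_0>0$ with $\nu_n':=\sum_i d_i'(d_i'-1)/\sum_i d_i'=1-\lambda_0n^{-\delta}+o(n^{-\delta})$. $\mathrm{CM}_n(\boldsymbol d')$ is the configuration model (vertex $i$ has $d_i'$ half-edges, and all half-edges are paired by a uniform perfect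 matching). $\mathscr{C}'(j)$ is the component of $\mathrm{CM}_n(\boldsymbol d')$ containing vertex $j$. $\mathscr{C}_i'=\mathscr{C}'(i)$ if $i$ is the smallest vertex label in $\mathscr{C}'(i)$, and $\mathscr{C}_i'=\varnothing$ otherwise. $\mathscr{W}_i=\sum_{k\in\mathscr{C}_i'}w_k$. Further, $s_r^\star=\frac1n\sum_{i\ge1}\mathscr{W}_i^r$ for $r\ge1$, $s_{pr}^\star=\frac1n\sum_{i\ge1}\mathscr{W}_i|\mathscr{C}_i'|$, and $\mathcal{D}_n^\star=\frac1n\sum_{i,j\in[n]}w_iw_j\,\mathrm d(i,j)\mathbf 1\{i,j\text{ are in the same component}\}$, where $\mathrm d$ is graph distance in $\mathrm{CM}_n(\boldsymbol d')$. *)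

(* Defs.v *)
From HB Require Import structures.
From mathcomp Require Export all_boot all_order all_algebra.
From mathcomp Require Export all_classical all_reals all_analysis.

Set Implicit Arguments.
Unset Strict Implicit.
Unset Printing Implicit Defensive.

Export Order.TTheory GRing.Theory Num.Theory.
Export numFieldNormedType.Exports.

Local Open Scope classical_set_scope.
Local Open Scope ring_scope.

(* The vertices 1, ..., n are represented by 'I_n, and sequences (c_i)_(i >= 1)
   by functions on nat, so every label is shifted down by one. *)

Definition alpha (R : realType) (tau : R) : R := 1 / (tau - 1).
Definition eta (R : realType) (tau : R) : R := (tau - 3) / (tau - 1).

Definition ell_down (R : realType) (p : nat) : set (R^nat) :=
  [set x : R^nat | nonincreasing_seq x /\ (forall i, 0 <= x i) /\
           cvgn (series (fun i => x i ^+ p))].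

Section Degrees.
Context (R : realType) (n : nat) (d : n.-tuple nat).

Definition degree_cdf (x : R) : R :=
  #|[set i : 'I_n | (tnth d i)%:R <= x]%SET|%:R / n%:R.

Definition nu : R :=
  (\sum_i (tnth d i)%:R * ((tnth d i)%:R - 1)) / (\sum_i (tnth d i)%:R).

End Degrees.

(* Convergence in distribution of the degree of a uniform vertex to D:
   the distribution functions converge at the continuity points of the limit. *)
Definition degree_cvg_in_distribution (R : realType) (dsp : measure_display)
    (Om : measurableType dsp) (P : probability Om R)
    (d : forall n, n.-tuple nat) (D : {RV P >-> R}) : Prop :=
  forall x : R, {for x, continuous (cdf D)} ->
    (fun n => (degree_cdf (d n) x)%:E) @ \oo --> cdf D x.

Section ConfigurationModel.
Context (n : nat) (d : n.-tuple nat).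

Definition half_edge : finType := {i : 'I_n & 'I_(tnth d i)}.

(* A perfect matching of the half-edges is encoded by the fixed-point-free
   involution that maps each half-edge to its partner. *)
Definition pairings : {set {ffun half_edge -> half_edge}} :=
  [set m : {ffun half_edge -> half_edge} |
    [forall h, (m h != h) && (m (m h) == h)]]%SET.

Context (m : {ffun half_edge -> half_edge}).

Definition adjacent : rel 'I_n :=
  fun i j => [exists h : half_edge, (tag h == i) && (tag (m h) == j)].

Definition component (i : 'I_n) : {set 'I_n} :=
  [set k | connect adjacent i k]%SET.

Definition min_component (i : 'I_n) : {set 'I_n} :=
  if [forall k in component i, (i <= k)%N] then component i else finset.set0.

(* The least length of a walk from i to j; it takes the irrelevant value n when
   there is no walk, and a shortest walk has fewer than n edges. *)
Definition graph_dist (i j : 'I_n) : nat :=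
  find (fun k => [exists p : k.-tuple 'I_n, path adjacent i p && (last i p == j)])
       (iota 0 n).

Context (R : realType) (w : 'I_n -> R).

Definition comp_weight (i : 'I_n) : R := \sum_(k in min_component i) w k.

(* The weight of the component labelled by a fixed j : nat, which makes sense
   only for n > j (it is 0 otherwise). *)
Definition comp_weight_nat (j : nat) : R := oapp comp_weight 0 (insub j).

Definition s_star (r : nat) : R := n%:R^-1 * \sum_i comp_weight i ^+ r.

Definition spr_star : R :=
  n%:R^-1 * \sum_i comp_weight i * #|min_component i|%:R.

Definition D_star : R :=
  n%:R^-1 * \sum_i \sum_(j | j \in component i)
              w i * w j * (graph_dist i j)%:R.

End ConfigurationModel.

Section Probability.
Context (R : realType).

(* The probability of an event under the uniform law on pairings. *)
Definition CM_prob (n : nat) (d : n.-tuple nat)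
    (A : pred {ffun half_edge d -> half_edge d}) : R :=
  #|[set m in pairings d | A m]%SET|%:R / #|pairings d|%:R.

Definition CM_cvg_in_prob (d : forall n, n.-tuple nat)
    (X : forall n, {ffun half_edge (d n) -> half_edge (d n)} -> R) (l : R) : Prop :=
  forall eps : R, 0 < eps ->
    (fun n => CM_prob (fun m => eps < `|X n m - l|)) @ \oo --> (0 : R).

End Probability.

(* Main.v *)
Require Import Defs.
From mathcomp Require Import ring lra zify.


(** A component is explored by pairing, one after the other, the free half-edges
    attached to the set X of vertices already visited. Let a be their number. The
    partner of the next one is uniform among all other free half-edges: an
    unvisited vertex x is met with a probability proportional to its degree d_x
    and changes a by d_x - 2, while a partner over X changes a by -2. Let
    theta(X) be the sum of d_x (2 - d_x) over the x outside X, so that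
    theta(set0) = (1 - nu) (sum of the degrees), of order n^(1 - delta). Up to the
    partners over X the drift of a is proportional to - theta(X). As
    (d - 1) (d - 2) >= 0 for every integer d, the difference theta(X) - a never
    decreases ([theta_inv_new]). So one constant q, namely theta(set0) - 4,
    bounds theta(X) from below at all times, whatever has been explored, and
    nothing has to be known about the shape of the explored part.

    Moments then follow from potentials: if G(a, X) has a nonpositive drift and
    dominates Phi(X) when a = 0, the mean of Phi at the component of j is at most
    G(d_j, {j}) ([Ex_potential]). Write V for the sum of d_x w_x, kappa = V / q and
    M = w(X) + kappa a. The potentials M, M^2 + K a and M^3 + 3 K a M + K3 a bound
    the first three moments of the weight W(j) of the component of j, and M minus
    a quadratic correction bounds its mean from below ([Ex_mass_ge]). All
    corrections are smaller by a power of n because delta < eta = 1 - 2 alpha.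

    For a fixed vertex j the bounds on the mean and on the second moment of W(j)
    agree to first order, which gives its limit; and j is the least label of its
    component with high probability, since i and j are connected with probability
    at most d_i d_j / q. For the sum of the w_i W(i) the second moment involves two
    roots. If they lie in different components, delete the first component: the
    bound q survives, so the contribution is at most the product of the bounds on
    the means ([Ex_two_roots]). If they lie in the same component, the contribution
    is the sum of the w_i E[W(i)^3], which is negligible. The sum with one weight
    equal to 1 follows by polarization between the weights w, 1 and w + 1. The
    sum of the cubes has a mean bounded by the limit ([Ex_weighted_cubes]), and the
    components of the first N vertices already carry nearly all of it.

    For distances, revealing the edges of a path one at a time bounds the mean
    weight N_l of the ends of the simple paths of length l from a root of degree d
    by d (V / Z) (S / Z)^(l - 1), with S the sum of d_x (d_x - 1) and Z the number
    of free half-edges, up to O(l) ([Ex_path_weight]). The weight at distance l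
    is at most N_l, so the sum of the l N_l bounds the weighted distances from
    above. It also bounds them from below, because min(dist, t) counts the l < t
    with l < dist and the weight within distance l is at most
    N_0 + ... + N_l. The cut-off t is a little larger than n^delta: then no
    distance exceeds t with high probability, while the errors still vanish. *)


Set Implicit Arguments.
Unset Strict Implicit.
Unset Printing Implicit Defensive.

(** * Uniform matchings *)

Section Matchings.
Import mathcomp.boot.fintype mathcomp.boot.finset.
Local Open Scope set_scope.
Local Open Scope ring_scope.

Variable T : finType.
Implicit Types (U : {set T}) (m : {ffun T -> T}) (h : T).

(** A matching of U is encoded by the involution of the whole type that fixes
    exactly the points outside U. Thus the matchings that remain after some pairs
    have been removed still live in the same type. *)
Definition matchings U : {set {ffun T -> T}} :=
  [set m : {ffun T -> T} | [forall h,
     if h \in U then [&& m h \in U, m h != h & m (m h) == h] else m h == h]].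

Lemma matchingsP U m :
  reflect ((forall h, h \in U -> [/\ m h \in U, m h != h & m (m h) = h]) /\
           (forall h, h \notin U -> m h = h)) (m \in matchings U).
Proof.
rewrite inE; apply: (iffP forallP) => [H|[H1 H2] h].
  split=> h; move: (H h); case: (h \in U) => //.
    by case/and3P=> ? ? /eqP.
  by move/eqP.
case: (boolP (h \in U)) => [/H1[-> -> /eqP] //|/H2 ->] //.
Qed.

Definition join h h' m : {ffun T -> T} :=
  [ffun k => if k == h then h' else if k == h' then h else m k].

Definition cut h m : {ffun T -> T} :=
  [ffun k => if (k == h) || (k == m h) then k else m k].

Lemma cut_matching U h m : h \in U -> m \in matchings U ->
  cut h m \in matchings (U :\: [set h; m h]).
Proof.
move=> hU /matchingsP [H1 H2]; have [mhU mhh mmh] := H1 _ hU.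
apply/matchingsP; split=> k; rewrite !inE !ffunE.
  case/andP=> /norP[kh kmh] kU; rewrite (negbTE kh) (negbTE kmh) /=.
  have [mkU mkk mmk] := H1 _ kU.
  have e1 : (m k == h) = false.
    by apply: contraNF kmh => /eqP <-; rewrite mmk.
  have e2 : (m k == m h) = false.
    by apply: contraNF kh => /eqP e; rewrite -mmk e mmh.
  by rewrite e1 e2 mkU mkk mmk.
by case: ifP => //= _ kU; apply: H2.
Qed.

Lemma join_matching U h h' m : h \in U -> h' \in U :\ h ->
  m \in matchings (U :\: [set h; h']) -> join h h' m \in matchings U.
Proof.
move=> hU /setD1P[h'h h'U] /matchingsP [H1 H2].
have hh' : (h == h') = false by rewrite eq_sym (negbTE h'h).
apply/matchingsP; split=> k; rewrite !ffunE.
  case: (altP (k =P h)) => [-> _|kh].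
    by rewrite (negbTE h'h) eqxx; split; rewrite ?h'U ?h'h.
  case: (altP (k =P h')) => [-> _|kh' kU].
    by rewrite eqxx hU hh'; split.
  have : k \in U :\: [set h; h'] by rewrite !inE negb_or kh kh'.
  case/H1; rewrite !inE negb_or => /andP[/andP[mkh mkh'] mkU] mkk mmk.
  by rewrite (negbTE mkh) (negbTE mkh') mkU mkk mmk.
move=> kU; case: eqP => [e|_]; first by rewrite e hU in kU.
case: eqP => [e|_]; first by rewrite e h'U in kU.
by apply: H2; rewrite !inE (negbTE kU) andbF.
Qed.

Lemma join_cut U h m : h \in U -> m \in matchings U -> join h (m h) (cut h m) = m.
Proof.
move=> hU /matchingsP [H1 _]; have [_ _ mmh] := H1 _ hU.
apply/ffunP=> k; rewrite !ffunE.
case: (altP (k =P h)) => [->//|kh]; case: (altP (k =P m h)) => [->|] //=.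
Qed.

Lemma cut_join U h h' m : h' != h ->
  m \in matchings (U :\: [set h; h']) -> cut h (join h h' m) = m.
Proof.
move=> h'h /matchingsP [_ H2]; apply/ffunP=> k; rewrite !ffunE eqxx.
case: (altP (k =P h)) => [->|kh] /=; first by rewrite H2 // !inE eqxx.
case: (altP (k =P h')) => [->|kh'] //=; first by rewrite H2 // !inE eqxx orbT.
Qed.

(** The matchings of U split according to the partner h' of h, and removing the
    pair is a bijection onto the matchings of the other points. This is the only
    source of randomness: it makes the partner uniform and leaves a uniform
    matching of the rest. *)
Lemma big_matchings (W : Type) (idx : W) (op : Monoid.com_law idx) U h
    (f : {ffun T -> T} -> W) : h \in U ->
  \big[op/idx]_(m in matchings U) f m =
  \big[op/idx]_(h' in U :\ h)
     \big[op/idx]_(m in matchings (U :\: [set h; h'])) f (join h h' m).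
Proof.
move=> hU.
rewrite (partition_big (fun m : {ffun T -> T} => m h) (fun h' => h' \in U :\ h)) /=; last first.
  move=> m /matchingsP [H1 _]; have [? ? _] := H1 _ hU.
  by rewrite !inE; apply/andP; split.
apply: eq_bigr => h' h'U.
have h'h : h' != h by move: h'U; rewrite !inE => /andP[].
rewrite (reindex_onto (join h h') (cut h)) /=; last first.
  by move=> m /andP[mU /eqP <-]; apply: join_cut mU.
apply: eq_bigl => m; apply/idP/idP => [|mU].
  case/andP=> /andP[jm _] /eqP <-.
  have : cut h (join h h' m) \in matchings (U :\: [set h; join h h' m h]).
    exact: cut_matching.
  by rewrite ffunE eqxx.
rewrite join_matching // (cut_join h'h mU) eqxx ffunE eqxx eqxx //.
Qed.

Fixpoint double_fact (k : nat) : nat :=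
  match k with 0 => 1 | 1 => 0 | k'.+2 => (k'.+1 * double_fact k')%N end.

Lemma card_setD2 U h h' : h \in U -> h' \in U :\ h ->
  #|U| = #|U :\: [set h; h']|.+2.
Proof.
rewrite (cardsD1 h) => ->; rewrite (cardsD1 h' (U :\ h)) => ->.
by rewrite setDDl.
Qed.

Lemma card_matchings U : #|matchings U| = double_fact #|U|.
Proof.
have [k] := ubnP #|U|; elim: k U => // k IH U; rewrite ltnS => leUk.
have [->|[h hU]] := set_0Vmem U.
  rewrite cards0 /=; apply/eqP/cards1P; exists [ffun k => k].
  apply/setP=> m; rewrite [RHS]inE; apply/matchingsP/eqP => [[_ H]|->].
    by apply/ffunP=> x; rewrite H ?ffunE // inE.
  by split=> x; rewrite ?inE ?ffunE.
rewrite -sum1_card (big_matchings _ _ hU).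
under eq_bigr => h' h'U.
  rewrite sum1_card IH; last by apply: leq_trans leUk; rewrite [leqRHS](card_setD2 hU h'U).
  over.
have e h' (h'U : h' \in U :\ h) : double_fact #|U :\: [set h; h']| = double_fact #|U|.-2.
  by rewrite (card_setD2 hU h'U).
rewrite (eq_bigr (fun=> double_fact #|U|.-2)) => [|h' /e //].
rewrite sum_nat_const; have := cardsD1 h U; rewrite hU add1n => ->.
by case: #|U :\ h|.
Qed.

Lemma double_fact_gt0 k : ~~ odd k -> (0 < double_fact k)%N.
Proof.
have [j] := ubnP k; elim: j k => // j IH [|[|k]] //= /ltnSE lk; rewrite negbK => ok.
by rewrite muln_gt0 IH // (leq_trans _ lk).
Qed.

Variable R : realType.
Implicit Types f g : {ffun T -> T} -> R.

Definition Ex U f : R := (\sum_(m in matchings U) f m) / #|matchings U|%:R.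

Lemma Ex_reveal U h f : ~~ odd #|U| -> h \in U ->
  Ex U f = (#|U|%:R - 1)^-1 *
           \sum_(h' in U :\ h) Ex (U :\: [set h; h']) (fun m => f (join h h' m)).
Proof.
move=> eU hU; rewrite /Ex (big_matchings _ _ hU) mulr_suml mulr_sumr.
apply: eq_bigr => h' h'U; rewrite !card_matchings (card_setD2 hU h'U) /=.
set n := #|_|; have -> : n.+2%:R - 1 = n.+1%:R :> R by rewrite -addn1 natrD addrK.
by rewrite natrM invfM mulrCA.
Qed.

Lemma card_matchings_gt0 U : ~~ odd #|U| -> (0 : R) < #|matchings U|%:R.
Proof. by move=> eU; rewrite ltr0n card_matchings double_fact_gt0. Qed.

Lemma Ex_le U f g : (forall m, m \in matchings U -> f m <= g m) -> Ex U f <= Ex U g.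
Proof. by move=> H; rewrite ler_wpM2r ?invr_ge0 // ler_sum. Qed.

Lemma Ex_eq U f g : (forall m, m \in matchings U -> f m = g m) -> Ex U f = Ex U g.
Proof. by move=> H; congr (_ / _); apply: eq_bigr. Qed.

Lemma Ex_cst U (r : R) : ~~ odd #|U| -> Ex U (fun=> r) = r.
Proof.
move=> /card_matchings_gt0 c0.
by rewrite /Ex sumr_const -[X in X / _]mulr_natr mulfK // gt_eqF.
Qed.

Lemma Ex_ge0 U f : (forall m, m \in matchings U -> 0 <= f m) -> 0 <= Ex U f.
Proof. by move=> H; rewrite mulr_ge0 ?invr_ge0 // sumr_ge0. Qed.

Lemma ExD U f g : Ex U (fun m => f m + g m) = Ex U f + Ex U g.
Proof. by rewrite /Ex big_split mulrDl. Qed.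

Lemma ExZl U (r : R) f : Ex U (fun m => r * f m) = r * Ex U f.
Proof. by rewrite /Ex -mulr_sumr mulrA. Qed.

Lemma ExZr U (r : R) f : Ex U (fun m => f m * r) = Ex U f * r.
Proof. by rewrite /Ex -mulr_suml mulrAC. Qed.

Lemma ExN U f : Ex U (fun m => - f m) = - Ex U f.
Proof. by rewrite /Ex sumrN mulNr. Qed.

Lemma Ex_sum U (J : Type) (s : seq J) (Q : pred J) (F : J -> {ffun T -> T} -> R) :
  Ex U (fun m => \sum_(i <- s | Q i) F i m) = \sum_(i <- s | Q i) Ex U (F i).
Proof. by rewrite /Ex exchange_big mulr_suml. Qed.

End Matchings.

(** * Exploration of a component *)

Section Exploration.
Import mathcomp.boot.fintype mathcomp.boot.finset.
Local Open Scope set_scope.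
Local Open Scope ring_scope.

Variables (T I : finType) (vtx : T -> I).
Implicit Types (U : {set T}) (m : {ffun T -> T}) (h : T) (X : {set I}).

Definition adj m : rel I :=
  fun i j => [exists h, (vtx h == i) && (vtx (m h) == j)].

Definition comp m i : {set I} := [set k | connect (adj m) i k].

Definition reach m X : {set I} := [set k | [exists i in X, connect (adj m) i k]].

Lemma reachP m X k :
  reflect (exists2 i, i \in X & connect (adj m) i k) (k \in reach m X).
Proof. by rewrite inE; apply: exists_inP. Qed.

Lemma reach1 m i : reach m [set i] = comp m i.
Proof.
apply/setP=> k; rewrite [RHS]inE; apply/reachP/idP => [[x /set1P->]//|H].
by exists i; rewrite ?set11.
Qed.

Lemma sub_reach m X : X \subset reach m X.
Proof. by apply/subsetP=> x xX; apply/reachP; exists x. Qed.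

Lemma reachU1 m X j : reach m (j |: X) = reach m X :|: comp m j.
Proof.
apply/setP=> k; rewrite in_setU [k \in comp m j]inE; apply/reachP/orP.
  case=> i /setU1P[->|iX] c; first by right.
  by left; apply/reachP; exists i.
case=> [/reachP[i iX c]|c]; first by exists i; rewrite // setU1r.
by exists j; rewrite ?setU11.
Qed.

Lemma connect_closed (e : rel I) (Z : {set I}) x y :
  (forall u v, u \in Z -> e u v -> v \in Z) -> x \in Z -> connect e x y -> y \in Z.
Proof.
move=> cl + /connectP[p]; elim: p x => [|v p IH] x /= xZ; first by move=> _ ->.
by case/andP=> /(cl _ _ xZ) vZ; apply: IH.
Qed.

Lemma adj_sym U m : m \in matchings U -> symmetric (adj m).
Proof.
case/matchingsP=> H1 H2; have mK h : m (m h) = h.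
  case: (boolP (h \in U)) => [/H1[]//|hU]; by rewrite !H2.
by move=> i j; apply/existsP/existsP => -[h /andP[/eqP e1 /eqP e2]];
  exists (m h); rewrite mK e1 e2 !eqxx.
Qed.

Section Join.
Variables (U : {set T}) (h h' : T) (m : {ffun T -> T}).
Hypothesis mU : m \in matchings (U :\: [set h; h']).

Let fixh : m h = h.
Proof. by case/matchingsP: mU => _ -> //; rewrite !inE eqxx. Qed.

Let fixh' : m h' = h'.
Proof. by case/matchingsP: mU => _ -> //; rewrite !inE eqxx orbT. Qed.

Lemma adj_join_new : adj (join h h' m) (vtx h) (vtx h').
Proof. by apply/existsP; exists h; rewrite ffunE !eqxx. Qed.

Lemma adj_join_old i j : adj m i j -> connect (adj (join h h' m)) i j.
Proof.
case/existsP=> k /andP[/eqP<- /eqP<-].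
case: (eqVneq k h) => [->|kh]; first by rewrite fixh connect0.
case: (eqVneq k h') => [->|kh']; first by rewrite fixh' connect0.
by apply/connect1/existsP; exists k; rewrite ffunE (negbTE kh) (negbTE kh') !eqxx.
Qed.

Lemma adj_join i j : adj (join h h' m) i j ->
  [\/ adj m i j, i = vtx h /\ j = vtx h' | i = vtx h' /\ j = vtx h].
Proof.
case/existsP=> k /andP[/eqP<- /eqP<-]; rewrite ffunE.
case: (eqVneq k h) => [->|kh]; first by constructor 2.
case: (eqVneq k h') => [->|kh']; first by constructor 3.
by constructor 1; apply/existsP; exists k; rewrite !eqxx.
Qed.

(** Once h over X has been paired with h', the rest of the component is what
    can be reached without this pair from X and the vertex of h'. *)
Lemma reach_join X : vtx h \in X ->
  reach (join h h' m) X = reach m (vtx h' |: X).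
Proof.
move=> hX; apply/setP=> k; apply/idP/idP.
  case/reachP=> i iX; apply: connect_closed; last first.
    by apply: (subsetP (sub_reach _ _)); rewrite setU1r.
  have hin : vtx h \in reach m (vtx h' |: X).
    by apply: (subsetP (sub_reach _ _)); rewrite setU1r.
  have h'in : vtx h' \in reach m (vtx h' |: X).
    by apply: (subsetP (sub_reach _ _)); rewrite setU11.
  move=> u v uZ /adj_join[uv|[_ ->]//|[_ ->]//].
  case/reachP: uZ => x xX xu; apply/reachP; exists x => //.
  exact: connect_trans xu (connect1 uv).
case/reachP=> i iX ik; have {}ik : connect (adj (join h h' m)) i k.
  by apply: connect_sub ik; apply: adj_join_old.
apply/reachP; case/setU1P: iX => [ei|iX]; last by exists i.
exists (vtx h) => //; apply: connect_trans ik.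
by rewrite ei; apply: connect1; apply: adj_join_new.
Qed.

End Join.

Lemma reach_inactive m X : (forall h, vtx h \in X -> m h = h) -> reach m X = X.
Proof.
move=> H; apply/eqP; rewrite eqEsubset sub_reach andbT; apply/subsetP=> k /reachP[i iX].
apply: connect_closed iX => u v uX /existsP[h /andP[/eqP e /eqP<-]].
by rewrite H e.
Qed.

Definition dg (x : I) : nat := #|[set h | vtx h == x]|.

(** The state of an exploration consists of the set U of free half-edges and the
    set X of visited vertices. Half-edges over unvisited vertices have not been
    touched ([full]), so that U enters the estimates only through the number of
    its elements over X ([active]). *)

Definition active U X : nat := #|[set h in U | vtx h \in X]|.

Definition full U X := forall h, vtx h \notin X -> h \in U.

Lemma big_vtx (W : Type) (idx : W) (op : Monoid.com_law idx) X (f : T -> W) :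
  \big[op/idx]_(h | vtx h \notin X) f h =
  \big[op/idx]_(x | x \notin X) \big[op/idx]_(h | vtx h == x) f h.
Proof.
rewrite (partition_big vtx (fun x => x \notin X)) //=.
apply: eq_bigr => x xX; apply: eq_bigl => h.
by case: eqP => [->|]; rewrite ?xX ?andbF.
Qed.

Lemma card_full U X : full U X -> #|U| = (active U X + \sum_(x | x \notin X) dg x)%N.
Proof.
move=> fU; rewrite -(cardsID [set h | vtx h \in X] U); congr (_ + _)%N.
  by apply: eq_card => h; rewrite !inE andbC.
rewrite -sum1_card (eq_bigl (fun h => vtx h \notin X)); last first.
  by move=> h; rewrite !inE; case: (boolP (vtx h \notin X)) => // /fU.
rewrite big_vtx; apply: eq_bigr => x _; rewrite /dg -sum1_card.
by apply: eq_bigl => h; rewrite inE.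
Qed.

Section Reveal.
Variables (U : {set T}) (X : {set I}) (h h' : T).
Hypotheses (fU : full U X) (hU : h \in U) (hX : vtx h \in X) (h'U : h' \in U :\ h).

Lemma full_reveal : full (U :\: [set h; h']) (vtx h' |: X).
Proof.
move=> k; rewrite !inE negb_or => /andP[kh' kX]; rewrite (fU kX) andbT negb_or.
by apply/andP; split; [apply: contraNneq kX => -> | apply: contraNneq kh' => ->].
Qed.

Lemma active_loop : vtx h' \in X ->
  active U X = (active (U :\: [set h; h']) (vtx h' |: X)).+2.
Proof.
move=> h'X; have -> : vtx h' |: X = X by apply/setUidPr; rewrite sub1set.
rewrite /active (@card_setD2 _ _ h h'); last 2 first.
- by rewrite inE hU.
- by move: h'U; rewrite !inE h'X => /andP[-> ->].
by congr _.+2; apply: eq_card => k; rewrite !inE andbA.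
Qed.

Lemma active_new : vtx h' \notin X ->
  (active U X + dg (vtx h') = (active (U :\: [set h; h']) (vtx h' |: X)).+2)%N.
Proof.
move=> h'X; have [h'h h'U'] := setD1P h'U.
have -> : (active U X + dg (vtx h'))%N = #|[set k in U | vtx k \in vtx h' |: X]|.
  rewrite /active /dg -cardsUI; set Z := _ :&: _; have -> : Z = set0.
    by apply/setP=> k; rewrite !inE; case: eqP => [->|]; rewrite ?andbF // (negbTE h'X) andbF.
  rewrite cards0 addn0.
  apply: eq_card => k; rewrite !inE; case: (eqVneq (vtx k) (vtx h')) => [e|_] /=; last by rewrite orbF.
  by rewrite orbT andbT; apply/esym/fU; rewrite e.
rewrite /active (@card_setD2 _ _ h h'); last 2 first.
- by rewrite inE hU !inE hX orbT.
- by rewrite !inE h'h h'U' eqxx.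
by congr _.+2; apply: eq_card => k; rewrite !inE andbA.
Qed.

Lemma even_reveal : ~~ odd #|U| -> ~~ odd #|U :\: [set h; h']|.
Proof. by rewrite (card_setD2 hU h'U) /= negbK. Qed.

End Reveal.

Lemma active_gt0 U X : (0 < active U X)%N -> exists2 h, h \in U & vtx h \in X.
Proof. by case/card_gt0P=> h; rewrite inE => /andP[hU hX]; exists h. Qed.

Lemma active_eq0 U X h : active U X = 0 -> vtx h \in X -> h \notin U.
Proof.
move=> a0 hX; apply: contra_eqN a0 => hU; rewrite -lt0n; apply/card_gt0P.
by exists h; rewrite inE hU.
Qed.

Variable R : realType.

Lemma sum_partners U X h (F : T -> R) : full U X -> h \in U -> vtx h \in X ->
  \sum_(h' in U :\ h) F h' =
  \sum_(h' in U :\ h | vtx h' \in X) F h' +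
  \sum_(x | x \notin X) \sum_(h' | vtx h' == x) F h'.
Proof.
move=> fU hU hX; rewrite (bigID (fun h' => vtx h' \in X)) /=; congr (_ + _).
rewrite -big_vtx; apply: eq_bigl => k; case: (boolP (vtx k \notin X)) => kX; last by rewrite andbF.
by rewrite andbT !inE fU // andbT; apply: contraNneq kX => ->.
Qed.

Section Supersolution.
Variables (Inv : nat -> {set I} -> Prop).
Hypothesis Inv_loop : forall a X, Inv a.+2 X -> Inv a X.
Hypothesis Inv_new : forall a X x, Inv a.+1 X -> x \notin X -> (0 < dg x)%N ->
  Inv (a + dg x).-1 (x |: X).

Lemma Inv_reveal U X h h' : full U X -> h \in U -> vtx h \in X -> h' \in U :\ h ->
  Inv (active U X) X -> Inv (active (U :\: [set h; h']) (vtx h' |: X)) (vtx h' |: X).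
Proof.
move=> fU hU hX h'U; case: (boolP (vtx h' \in X)) => h'X.
  rewrite (active_loop hU hX h'U h'X) => /Inv_loop.
  by have -> : vtx h' |: X = X by apply/setUidPr; rewrite sub1set.
have := active_new fU hU hX h'U h'X.
have d0 : (0 < dg (vtx h'))%N by apply/card_gt0P; exists h'; rewrite inE.
have : (0 < active U X)%N by apply/card_gt0P; exists h; rewrite inE hU.
case: (active U X) => // a _ e iX; have := Inv_new iX h'X d0.
set b := active (U :\: _) _ in e *.
by have -> : (a + dg (vtx h')).-1 = b by move: e; rewrite addSn => -[->].
Qed.

(** Optional stopping for a potential with nonpositive drift, by induction on the
    number of free half-edges. [Inv] collects what is known of the states that
    can occur; it only has to be preserved by the two kinds of steps. Here
    [a.+1] half-edges are active before the step: one of them is being paired, and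
    [a] is the number of partners over X. *)
Lemma Ex_explore_le (Phi : {set I} -> R) (G : nat -> {set I} -> R) :
  (forall X, Inv 0 X -> Phi X <= G 0 X) ->
  (forall a X, Inv a.+1 X ->
     a%:R * (G a.-1 X - G a.+1 X) +
     \sum_(x | x \notin X) (dg x)%:R * (G (a + dg x).-1 (x |: X) - G a.+1 X) <= 0) ->
  forall U X, full U X -> ~~ odd #|U| -> Inv (active U X) X ->
  Ex U (fun m => Phi (reach m X)) <= G (active U X) X.
Proof.
move=> G0 Gd U; have [k] := ubnP #|U|; elim: k U => // k IH U /ltnSE leUk X fU eU iX.
case: (posnP (active U X)) => [a0|/[dup] agt0 /active_gt0[h hU hX]].
  rewrite a0; rewrite (Ex_eq (g := fun=> Phi X)) ?Ex_cst //; first by apply: G0; rewrite -a0.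
  move=> m /matchingsP[_ fx]; rewrite reach_inactive // => h hX.
  by apply: fx; apply: active_eq0 hX.
case ea: (active U X) agt0 => [//|a] _.
have U0 : 0 < #|U|%:R - 1 :> R.
  rewrite subr_gt0 ltr1n; case: #|U| (card_full fU) eU => [|[|n]] //; first by rewrite ea.
rewrite (Ex_reveal _ eU hU) ler_pdivrMl //.
pose H h' := G (active (U :\: [set h; h']) (vtx h' |: X)) (vtx h' |: X).
apply: (@le_trans _ _ (\sum_(h' in U :\ h) H h')).
  apply: ler_sum => h' h'U.
  rewrite (Ex_eq (g := fun m => Phi (reach m (vtx h' |: X)))); last first.
    by move=> m mU; rewrite (reach_join mU).
  apply: IH.
  - by apply: leq_trans leUk; rewrite [leqRHS](card_setD2 hU h'U).
  - exact: full_reveal.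
  - exact: even_reveal h'U eU.
  - exact: Inv_reveal.
rewrite (sum_partners _ fU hU hX).
have -> : \sum_(h' in U :\ h | vtx h' \in X) H h' = a%:R * G a.-1 X.
  rewrite (eq_bigr (fun=> G a.-1 X)); last first.
    move=> h' /andP[h'U h'X]; rewrite /H; have := active_loop hU hX h'U h'X.
    have -> : vtx h' |: X = X by apply/setUidPr; rewrite sub1set.
    by rewrite ea => -[->].
  rewrite sumr_const -[LHS]mulr_natl; congr (_ * _); congr (_%:R).
  have := ea; rewrite /active (cardsD1 h) inE hU hX /= add1n => -[<-].
  by apply: eq_card => h'; rewrite [LHS]unfold_in !inE andbA.
rewrite [X in _ + X](_ : _ = \sum_(x | x \notin X) (dg x)%:R * G (a + dg x).-1 (x |: X)); last first.
  apply: eq_bigr => x xX; rewrite (eq_bigr (fun=> G (a + dg x).-1 (x |: X))).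
    by rewrite sumr_const -[LHS]mulr_natl; congr (_ * _); congr (_%:R); apply: eq_card => h'; rewrite [LHS]unfold_in !inE.
  move=> h' /eqP e; rewrite /H e; congr (G _ _); rewrite -e.
  have h'U : h' \in U :\ h.
    by rewrite !inE fU ?e // andbT; apply: contraNneq xX => e1; rewrite -e e1.
  have := active_new fU hU hX h'U; rewrite e => /(_ xX); rewrite ea; lia.
have := Gd a X; rewrite -ea => /(_ iX).
under eq_bigr => x _ do rewrite mulrBr.
rewrite sumrB -mulr_suml -natr_sum (card_full fU) ea natrD -addn1 natrD.
set s := (\sum_(i | _) dg i)%:R; set G1 := G a.-1 X; set G2 := G _ X.
by lra.
Qed.

End Supersolution.

End Exploration.

(** * Decoupling of components *)

Section Local.
Import mathcomp.boot.fintype mathcomp.boot.finset.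
Local Open Scope set_scope.
Local Open Scope ring_scope.

Variables (T I : finType) (vtx : T -> I) (R : realType).
Implicit Types (U : {set T}) (m : {ffun T -> T}) (h : T) (X : {set I}).

Local Notation adj := (adj vtx).
Local Notation comp := (comp vtx).
Local Notation reach := (reach vtx).
Local Notation dg := (dg vtx).
Local Notation active := (active vtx).
Local Notation full := (full vtx).

Definition agree_on_comp i m1 m2 := forall h, vtx h \in comp m1 i -> m1 h = m2 h.

(** A local functional at i can be evaluated by looking at the half-edges over the
    component of i only. *)
Definition local_at (i : I) (F : {ffun T -> T} -> R) :=
  forall m1 m2, agree_on_comp i m1 m2 -> F m1 = F m2.

Lemma path_local i m1 m2 p : agree_on_comp i m1 m2 ->
  path (adj m1) i p = path (adj m2) i p.
Proof.
move=> H; have : i \in comp m1 i by rewrite inE connect0.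
elim: p {1 3 4}i => //= y p IH x xi.
have e : adj m1 x y = adj m2 x y.
  by apply: eq_existsb => h; case: eqP => //= ex; rewrite H // ex.
rewrite -e; case: (boolP (adj m1 x y)) => //= xy; apply: IH.
by move: xi; rewrite !inE => xi; apply: connect_trans xi (connect1 xy).
Qed.

Lemma comp_local i m1 m2 : agree_on_comp i m1 m2 -> comp m1 i = comp m2 i.
Proof.
move=> H; apply/setP=> k; rewrite !inE; apply/connectP/connectP => -[p pp lp];
  exists p => //; by rewrite ?(path_local _ H) // -(path_local _ H).
Qed.

Lemma dg_mul x (r : R) : (dg x)%:R * r = \sum_(h | vtx h == x) r.
Proof.
rewrite sumr_const -[RHS]mulr_natl; congr (_ * _); congr (_%:R).
by apply: eq_card => h; rewrite inE.
Qed.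

Section Decoupling.
Variables (Inv : nat -> {set I} -> Prop).
Hypothesis Inv_loop : forall a X, Inv a.+2 X -> Inv a X.
Hypothesis Inv_new : forall a X x, Inv a.+1 X -> x \notin X -> (0 < dg x)%N ->
  Inv (a + dg x).-1 (x |: X).
Variables (j : I) (G : {ffun T -> T} -> R) (B : R).
Hypothesis G_local : local_at j G.
Hypothesis G_le : forall U X, full U X -> ~~ odd #|U| -> active U X = 0 ->
  Inv 0 X -> j \notin X -> Ex U G <= B.
Hypothesis B_ge0 : 0 <= B.

(** The half-edges of the component of X are revealed first. They determine g, and
    what is left is a uniform matching over the other vertices, to which the bound
    on G applies. The statement is for an arbitrary state and an arbitrary g
    because each revealed pair is absorbed into g. *)
Lemma Ex_decouple_from U X g : full U X -> ~~ odd #|U| -> Inv (active U X) X ->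
  (forall m, m \in matchings U -> 0 <= g m) ->
  (forall m1 m2, m1 \in matchings U -> m2 \in matchings U ->
     (forall h, vtx h \in reach m1 X -> m1 h = m2 h) -> g m1 = g m2) ->
  Ex U (fun m => g m * (j \notin reach m X)%:R * G m) <= Ex U g * B.
Proof.
have [k] := ubnP #|U|; elim: k U X g => // k IH U X g /ltnSE leUk fU eU iX g0 gl.
case: (posnP (active U X)) => [a0|/active_gt0[h hU hX]].
  have fx m h : m \in matchings U -> vtx h \in X -> m h = h.
    by case/matchingsP=> _ fx hX; apply: fx; apply: active_eq0 hX.
  have rX m : m \in matchings U -> reach m X = X.
    by move=> mU; apply: reach_inactive => h /(fx _ _ mU).
  have [m0 m0U] : exists m0, m0 \in matchings U.
    by apply/card_gt0P; rewrite -(ltr0n R) card_matchings_gt0.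
  have gc m : m \in matchings U -> g m = g m0.
    move=> mU; apply: gl => // h; rewrite rX // => hX; by rewrite !fx.
  rewrite (Ex_eq (g := fun m => g m0 * (j \notin X)%:R * G m)); last first.
    by move=> m mU; rewrite rX // gc.
  rewrite ExZl (Ex_eq (f := g) (g := fun=> g m0)) // Ex_cst // -mulrA ler_wpM2l ?g0 //.
  case: (boolP (j \in X)) => jX; first by rewrite mul0r.
  by rewrite mul1r (G_le fU eU a0) // -a0.
have U0 : 0 < #|U|%:R - 1 :> R.
  rewrite subr_gt0 ltr1n; case: #|U| (cardsD1 h U) eU => [|[|n]] //; by rewrite hU.
rewrite (Ex_reveal _ eU hU) (Ex_reveal g eU hU) -mulrA; apply: ler_wpM2l; first by rewrite invr_ge0 ltW.
rewrite mulr_suml; apply: ler_sum => h' h'U.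
set U' := U :\: [set h; h'].
have jm m : m \in matchings U' -> join h h' m \in matchings U by apply: join_matching.
pose g' m := g (join h h' m).
rewrite (Ex_eq (g := fun m => g' m * (j \notin reach m (vtx h' |: X))%:R * G m)).
  apply: IH => //.
  - by apply: leq_trans leUk; rewrite [leqRHS](card_setD2 hU h'U).
  - exact: full_reveal.
  - exact: even_reveal h'U eU.
  - by apply: Inv_reveal.
  - by move=> m mU; apply: g0; apply: jm.
  - move=> m1 m2 m1U m2U H; apply: gl; rewrite ?jm // => y.
    by rewrite (reach_join m1U) // !ffunE => /H ->.
move=> m mU; rewrite (reach_join mU) //.
case: (boolP (j \in reach m (vtx h' |: X))) => jr; first by rewrite !mulr0 !mul0r.
congr (_ * _); apply/esym/G_local => y; rewrite ffunE.
have sy := sym_connect_sym (adj_sym vtx mU).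
have notin x : x \in vtx h' |: X -> x \notin comp m j.
  move=> xX; apply: contraNN jr; rewrite inE sy => c; apply/reachP; by exists x.
case: (eqVneq y h) => [->|_]; first by rewrite (negbTE (notin _ _)) // setU1r.
by case: (eqVneq y h') => [->|_] //; rewrite (negbTE (notin _ _)) // setU11.
Qed.

Lemma Ex_decouple i F : ~~ odd #|T| -> Inv (dg i) [set i] ->
  (forall m, 0 <= F m) -> local_at i F ->
  Ex [set: T] (fun m => F m * (j \notin comp m i)%:R * G m) <= Ex [set: T] F * B.
Proof.
move=> eT ii F0 Fl.
rewrite (Ex_eq (g := fun m => F m * (j \notin reach m [set i])%:R * G m)); last first.
  by move=> m _; rewrite reach1.
apply: Ex_decouple_from => //.
- by rewrite cardsT.
- suff -> : active [set: T] [set i] = dg i by [].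
  by apply: eq_card => h; rewrite !inE.
- by move=> m1 m2 _ _; rewrite reach1 => /Fl.
Qed.

End Decoupling.

(** * Simple paths *)

Section Paths.
Variable w : I -> R.
Hypothesis w_ge0 : forall x, 0 <= w x.

(** The sum, over the paths of length l that start at j, have distinct vertices
    and avoid X, of the weight of the last vertex. Multiple edges are counted
    separately. *)
Fixpoint path_weight m l j X : R :=
  if l is l'.+1 then
    \sum_(h | vtx h == j)
      if vtx (m h) \in X then 0 else path_weight m l' (vtx (m h)) (vtx (m h) |: X)
  else w j.

Lemma path_weightS m l j X : path_weight m l.+1 j X =
  \sum_(h | vtx h == j)
    if vtx (m h) \in X then 0 else path_weight m l (vtx (m h)) (vtx (m h) |: X).
Proof. by []. Qed.

(** A pair over visited vertices is never used by a path that avoids them. *)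
Lemma path_weight_join U h h' m l j X : m \in matchings (U :\: [set h; h']) ->
  vtx h \in X -> vtx h' \in X ->
  path_weight (join h h' m) l j X = path_weight m l j X.
Proof.
move=> mU; elim: l j X => //= l IH j X hX h'X; apply: eq_bigr => k _; rewrite ffunE.
have [_ fx] := matchingsP _ _ mU.
case: (eqVneq k h) => [->|_]; first by rewrite h'X fx ?hX // !inE eqxx.
case: (eqVneq k h') => [->|_]; first by rewrite hX fx ?h'X // !inE eqxx orbT.
by case: ifP => // _; apply: IH; rewrite setU1r.
Qed.

(** Each step of the path reveals one pair. Its end x has d_x free half-edges and
    d_x - 1 of them can continue the path, which brings a factor S / Z; the last
    step brings V / Z. The l.+1 steps reduce the number of free half-edges by two
    each time, and Z bounds it from below throughout. *)
Lemma Ex_path_weight (V S Z : R) l U j X : 0 < Z ->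
  full U X -> ~~ odd #|U| -> j \in X -> Z + (2 * l)%:R + 1 <= #|U|%:R ->
  \sum_(x | x \notin X) (dg x)%:R * w x <= V ->
  \sum_(x | x \notin X) (dg x)%:R * ((dg x)%:R - 1) <= S ->
  Ex U (fun m => path_weight m l.+1 j X) <=
    #|[set h in U | vtx h == j]|%:R * (V / Z * (S / Z) ^+ l).
Proof.
move=> Z0; elim: l U j X => [|l IH] U j X fU eU jX leZ leV leS; rewrite Ex_sum.
all: rewrite (bigID (fun h => h \in U)) /= [X in _ + X]big1 ?addr0; last first.
1,3: by move=> h /andP[/eqP ej hU]; rewrite (Ex_eq (g := fun=> 0)) ?Ex_cst // =>
  m /matchingsP[_ fx]; rewrite fx // ej jX.
all: rewrite -sum1_card natr_sum mulr_suml.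
all: rewrite (eq_bigl (fun h => h \in [set h in U | vtx h == j])); last by move=> h; rewrite inE andbC.
all: apply: ler_sum => h; rewrite inE => /andP[hU /eqP ej]; rewrite mul1r.
all: have hX : vtx h \in X by rewrite ej.
all: have ZU : Z <= #|U|%:R - 1 by (apply: le_trans (_ : _ <= Z + (2 * _)%:R) _; [rewrite lerDl|rewrite lerBrDr; exact: leZ]).
all: have U0 := lt_le_trans Z0 ZU.
all: rewrite (Ex_reveal _ eU hU) (sum_partners _ fU hU hX).
all: rewrite big1 ?add0r; last first.
1,3: by move=> h' /andP[h'U h'X]; rewrite (Ex_eq (g := fun=> 0)) ?Ex_cst ?(even_reveal hU h'U) // => m mU;
     rewrite ffunE eqxx h'X.
- apply: (@le_trans _ _ ((#|U|%:R - 1)^-1 * V)).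
    apply: ler_wpM2l; first (by rewrite invr_ge0 ltW); apply: le_trans leV; apply: ler_sum => x xX.
    rewrite dg_mul; apply: ler_sum => h' /eqP ex.
    have h'U : h' \in U :\ h by rewrite !inE fU ?ex // andbT; apply: contraNneq xX => e; rewrite -ex e.
    rewrite (Ex_eq (g := fun=> w x)) ?Ex_cst ?(even_reveal hU h'U) // => m mU.
    by rewrite ffunE eqxx ex (negbTE xX).
  rewrite expr0 mulr1 mulrC ler_wpM2l ?lef_pV2 //.
  by apply: le_trans leV; apply: sumr_ge0 => x _; rewrite mulr_ge0.
have V0 : 0 <= V by apply: le_trans leV; apply: sumr_ge0 => x _; rewrite mulr_ge0.
have dd0 x : 0 <= (dg x)%:R * ((dg x)%:R - 1) :> R.
  by case: (dg x) => [|n]; rewrite ?mul0r // mulr_ge0 // subr_ge0 ler1n.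
have S0 : 0 <= S by apply: le_trans leS; apply: sumr_ge0 => x _.
set c := V / Z * (S / Z) ^+ l.
have c0 : 0 <= c by rewrite mulr_ge0 ?exprn_ge0 // divr_ge0 // ltW.
apply: (@le_trans _ _ ((#|U|%:R - 1)^-1 * (S * c))); last first.
  have -> : V / Z * (S / Z) ^+ l.+1 = Z^-1 * S * c by rewrite /c exprS; ring.
  by rewrite mulrA ler_wpM2r // ler_wpM2r // lef_pV2.
apply: ler_wpM2l; first by rewrite invr_ge0 ltW.
apply: le_trans (_ : _ <= (\sum_(x | x \notin X) (dg x)%:R * ((dg x)%:R - 1)) * c) _; last by rewrite ler_wpM2r.
rewrite mulr_suml; apply: ler_sum => x xX.
rewrite -mulrA dg_mul; apply: ler_sum => h' /eqP ex.
have h'U : h' \in U :\ h by rewrite !inE fU ?ex // andbT; apply: contraNneq xX => e; rewrite -ex e.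
have h'X : vtx h' \notin X by rewrite ex.
rewrite (Ex_eq (g := fun m => path_weight m l.+1 x (x |: X))); last first.
  move=> m mU; rewrite ffunE eqxx ex (negbTE xX).
  transitivity (path_weight (join h h' m) l.+1 x (x |: X)); first by [].
  by apply: (path_weight_join _ _ mU); rewrite ?ex ?hX ?setU11 ?setU1r.
have sub (f : I -> R) : (forall x, 0 <= f x) ->
    \sum_(y | y \notin x |: X) f y <= \sum_(y | y \notin X) f y.
  move=> f0; rewrite [leRHS](bigD1 x) //= (eq_bigl (fun y => (y \notin X) && (y != x))).
    by rewrite lerDr.
  by move=> y; rewrite !inE negb_or andbC.
apply: le_trans (IH (U :\: [set h; h']) x (x |: X) _ _ _ _ _ _) _.
- by rewrite -ex; apply: full_reveal.
- exact: even_reveal h'U eU.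
- exact: setU11.
- move: leZ; rewrite (card_setD2 hU h'U) => leZ.
  have e1 n : n.+2%:R = n%:R + 2 :> R by rewrite -addn2 natrD.
  move: leZ; rewrite e1 mulnS addnC natrD; lra.
- by apply: le_trans leV; apply: sub => y; rewrite mulr_ge0.
- by apply: le_trans leS; apply: sub.
rewrite -/c ler_wpM2r // lerBrDr -[X in _ + X]/(1%:R) -natrD ler_nat addn1.
rewrite [leqRHS](cardsD1 h') inE ex eqxx add1n ltnS; apply: subset_leq_card.
by apply/subsetP=> k; rewrite !inE negb_or => /andP[/andP[/andP[_ ->] _] ->].
Qed.

Definition path_avoiding m l j X k : bool :=
  [exists p : l.-tuple I,
     [&& path (adj m) j p, uniq p, all (fun x => x \notin X) p & last j p == k]].

Lemma path_weight_ge m l j X :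
  \sum_k w k * (path_avoiding m l j X k)%:R <= path_weight m l j X.
Proof.
elim: l j X => [|l IH] j X /=.
  rewrite (bigD1 j) //= big1 ?addr0 => [|k kj].
    by rewrite -[leRHS]mulr1 ler_wpM2l //; case: (path_avoiding _ _ _ _ _).
  suff -> : path_avoiding m 0 j X k = false by rewrite mulr0.
  apply/existsP => -[p]; rewrite tuple0 /= => /eqP e; by rewrite e eqxx in kj.
apply: (@le_trans _ _ (\sum_(h | vtx h == j) if vtx (m h) \in X then 0 else
    \sum_k w k * (path_avoiding m l (vtx (m h)) (vtx (m h) |: X) k)%:R)); last first.
  by apply: ler_sum => h _; case: ifP.
rewrite (eq_bigr (fun h => \sum_k w k *
   ((vtx (m h) \notin X) && path_avoiding m l (vtx (m h)) (vtx (m h) |: X) k)%:R)); last first.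
  by move=> h _; case: ifP => //= _; rewrite big1 // => k _; rewrite mulr0.
rewrite exchange_big /=; apply: ler_sum => k _; rewrite -mulr_sumr ler_wpM2l //.
rewrite -natr_sum ler_nat; case: (boolP (path_avoiding m l.+1 j X k)) => // /existsP[p].
case: p => -[|x p] //= sp; case/and4P => /andP[/existsP[h /andP[ej /eqP ex]] pp].
case/andP=> xp up /andP[xX aX] lk.
rewrite (bigD1 h) //= ex xX /=.
suff -> : path_avoiding m l x (x |: X) k by [].
apply/existsP; exists (Tuple (sp : size p == l)); rewrite /= pp up lk andbT /=.
apply/allP=> y yp; rewrite !inE negb_or (allP aX) // andbT.
by apply: contraNneq xp => <-.
Qed.

End Paths.
End Local.
Arguments path_weight : simpl never.

(** * Potentials bounding the moments of a component *)

Section Moments.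
Import mathcomp.boot.fintype mathcomp.boot.finset.
Local Open Scope set_scope.
Local Open Scope ring_scope.

Variables (T I : finType) (vtx : T -> I) (R : realType).
Implicit Types (U : {set T}) (m : {ffun T -> T}) (h : T) (X : {set I}).

Local Notation comp := (comp vtx).
Local Notation reach := (reach vtx).
Local Notation active := (active vtx).
Local Notation full := (full vtx).

Definition deg (x : I) : R := (dg vtx x)%:R.

(** The drift of the number of active half-edges is - theta, divided by the number
    of possible partners and up to the effect of the partners over X. *)
Definition theta X : R := \sum_(x | x \notin X) deg x * (2 - deg x).

Definition theta_inv (q : R) (a : nat) X : Prop := q + a%:R <= theta X.

Definition mass (f : I -> R) X : R := \sum_(x in X) f x.

Lemma massU1 f X x : x \notin X -> mass f (x |: X) = f x + mass f X.
Proof. by move=> xX; rewrite /mass big_setU1. Qed.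

Lemma mass_ge0 f X : (forall x, 0 <= f x) -> 0 <= mass f X.
Proof. by move=> f0; apply: sumr_ge0. Qed.

Lemma massI (f : I -> R) X : \sum_x f x = mass f X + \sum_(x | x \notin X) f x.
Proof. by rewrite (bigID (mem X)). Qed.

Lemma outside_le (f : I -> R) X : (forall x, 0 <= f x) ->
  \sum_(x | x \notin X) f x <= \sum_x f x.
Proof. by move=> f0; rewrite (massI f X) lerDr mass_ge0. Qed.

Lemma deg_ge0 x : 0 <= deg x. Proof. exact: ler0n. Qed.

Lemma deg_cases x : deg x = 0 \/ 1 <= deg x.
Proof. by rewrite /deg; case: (dg _ _) => [|n]; [left|right; rewrite ler1n]. Qed.

(** Integrality is essential: the product is negative between 1 and 2. *)
Lemma deg_quad x : 0 <= (deg x - 1) * (deg x - 2).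
Proof.
rewrite /deg; case: (dg _ _) => [|[|n]]; [lra|lra|].
rewrite -addn2 natrD; have := ler0n R n; nra.
Qed.

Lemma thetaU1 X x : x \notin X -> theta (x |: X) = theta X - deg x * (2 - deg x).
Proof.
move=> xX; rewrite /theta [in RHS](bigD1 x) //= addrAC subrr add0r.
by apply: eq_bigl => y; rewrite !inE negb_or andbC.
Qed.

Lemma theta0E X : theta set0 = mass (fun x => deg x * (2 - deg x)) X + theta X.
Proof.
rewrite /theta -massI; apply: eq_bigl => x; by rewrite inE.
Qed.

Lemma theta_inv_loop q a X : theta_inv q a.+2 X -> theta_inv q a X.
Proof. by rewrite /theta_inv; apply: le_trans; rewrite lerD2l ler_nat -addn2 leq_addr. Qed.

(** Visiting x adds d (d - 2) to theta and d - 2 to the number of active half-edges;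
    the difference is (d - 1) (d - 2) >= 0. *)
Lemma theta_inv_new q a X x : theta_inv q a.+1 X -> x \notin X -> (0 < dg vtx x)%N ->
  theta_inv q (a + dg vtx x).-1 (x |: X).
Proof.
rewrite /theta_inv => H xX; rewrite (thetaU1 xX); have := deg_quad x; rewrite /deg.
case: (dg vtx x) => // n; rewrite addnS /= natrD -addn1 natrD => dq _.
move: H; rewrite -addn1 natrD; nra.
Qed.

(** Starting at i costs at most 2, as d (d - 2) - d >= -2 for an integer d. *)
Lemma theta_inv_start q X i : i \notin X -> q + 2 <= theta X ->
  theta_inv q (dg vtx i) (i |: X).
Proof.
move=> iX H; rewrite /theta_inv (thetaU1 iX) -/(deg i); have := deg_quad i; nra.
Qed.

Lemma theta_inv_start1 q i : q + 2 <= theta set0 -> theta_inv q (dg vtx i) [set i].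
Proof. by rewrite -(setU0 [set i]); apply: theta_inv_start; rewrite inE. Qed.

Lemma theta_inv_le q a X : theta_inv q a X -> q <= theta X.
Proof. by apply: le_trans; rewrite lerDl. Qed.

Lemma sum_excess X : \sum_(x | x \notin X) deg x * (deg x - 2) = - theta X.
Proof. by rewrite /theta -sumrN; apply: eq_bigr => x _; ring. Qed.

Section Potential.
Variables (q : R) (g : R -> {set I} -> R) (Phi : {set I} -> R).
Hypothesis g0 : forall X, q <= theta X -> Phi X <= g 0 X.
(* s is the number of active half-edges before the step; s = 1 is singled out
   because there is then no partner over X, and s - 2 would be negative *)
Hypothesis g_drift : forall s X, 1 <= s -> (s = 1) \/ (2 <= s) -> q <= theta X ->
  (s - 1) * (g (s - 2) X - g s X) +
  \sum_(x | x \notin X) deg x * (g (s + (deg x - 2)) (x |: X) - g s X) <= 0.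

Lemma Ex_potential U X : full U X -> ~~ odd #|U| -> theta_inv q (active U X) X ->
  Ex U (fun m => Phi (reach m X)) <= g (active U X)%:R X.
Proof.
move=> fU eU iX; apply: (@Ex_explore_le _ _ vtx R (theta_inv q) _ _ Phi (fun a => g a%:R)) => //.
- exact: theta_inv_loop.
- exact: theta_inv_new.
- by move=> Y; rewrite /theta_inv addr0; apply: g0.
move=> a Y iY; have e : a.+1%:R = a%:R + 1 :> R by rewrite -addn1 natrD.
have s1 : 1 <= a.+1%:R :> R by rewrite ler1n.
have s2 : a.+1%:R = 1 :> R \/ 2 <= a.+1%:R :> R.
  by case: (a) => [|b]; [left|right; rewrite ler_nat].
apply: le_trans (g_drift s1 s2 (theta_inv_le iY)); rewrite e addrK lerD //.
  case: (a) => [|b]; first by rewrite !mul0r.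
  by rewrite [b.+1.-1]/= (_ : b.+1%:R + 1 - 2 = b%:R) // -addn1 natrD; ring.
apply: ler_sum => x xX; rewrite /deg; case: (dg vtx x) => [|n]; first by rewrite !mul0r.
by rewrite addnS /= natrD (_ : a%:R + 1 + (n.+1%:R - 2) = a%:R + n%:R) // -(addn1 n) natrD; ring.
Qed.

End Potential.

Section Sums.
Variables (q kappa : R) (w : I -> R).
Hypotheses (q_gt0 : 0 < q) (w_ge0 : forall x, 0 <= w x) (kappa_ge0 : 0 <= kappa).
Hypothesis kappaP : \sum_x deg x * w x <= kappa * q.

(* the increment of M = mass w X + kappa s when x is met *)
Let xi x := w x + kappa * (deg x - 2).

(** kappa is chosen so that M does not increase on average: the weight found at
    one step is worth kappa for each half-edge that is lost. *)
Lemma sum_xi_le0 X : q <= theta X -> \sum_(x | x \notin X) deg x * xi x <= 0.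
Proof.
move=> qX; rewrite (eq_bigr (fun x => deg x * w x + kappa * (deg x * (deg x - 2)))); last first.
  by move=> x _; rewrite /xi; ring.
rewrite big_split /= -mulr_sumr sum_excess mulrN subr_le0.
apply: le_trans (ler_wpM2l kappa_ge0 qX); apply: le_trans kappaP.
by apply: outside_le => x; rewrite mulr_ge0 ?deg_ge0.
Qed.

Lemma xi_abs x : deg x != 0 -> `|xi x| <= w x + kappa * deg x.
Proof.
case: (deg_cases x) => [->|d1 _]; first by rewrite eqxx.
have k1 : 0 <= kappa * (deg x - 1) by rewrite mulr_ge0 // subr_ge0.
rewrite ler_norml /xi; move: (w x) (w_ge0 x) kappa_ge0 => W W0 k0.
by apply/andP; split; lra.
Qed.

Lemma sum_xi_le (k l : nat) X :
  \sum_(x | x \notin X) deg x * (deg x - 2) ^+ k * xi x ^+ l <=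
  \sum_x deg x ^+ k.+1 * (w x + kappa * deg x) ^+ l.
Proof.
apply: le_trans (outside_le X _); last first.
  by move=> x; rewrite mulr_ge0 ?exprn_ge0 ?addr_ge0 ?mulr_ge0 ?deg_ge0.
apply: ler_sum => x _; case: (eqVneq (deg x) 0) => [->|d0].
  by rewrite exprS !mul0r.
rewrite exprS -!mulrA ler_wpM2l ?deg_ge0 //; apply: le_trans (ler_norm _) _.
rewrite normrM !normrX ler_pM ?exprn_ge0 // lerXn2r ?nnegrE ?addr_ge0 ?mulr_ge0 ?deg_ge0 ?xi_abs //.
by case: (deg_cases x) d0 => [->|d1 _]; rewrite ?eqxx // ler_norml; lra.
Qed.

(** The potential is M itself. *)
Lemma Ex_mass_le U X : full U X -> ~~ odd #|U| -> theta_inv q (active U X) X ->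
  Ex U (fun m => mass w (reach m X)) <= mass w X + kappa * (active U X)%:R.
Proof.
move=> fU eU iX; have k0 := kappa_ge0; have q0 := q_gt0.
apply: (@Ex_potential q (fun s X => mass w X + kappa * s)) => // [Y _|s Y s1 s2 qY].
  by rewrite mulr0 addr0.
rewrite (eq_bigr (fun x => deg x * xi x)); last by move=> x xY; rewrite massU1 // /xi; ring.
have := sum_xi_le0 qY; set S := \sum_(_ | _) _.
have : 0 <= kappa * (s - 1) by rewrite mulr_ge0 // subr_ge0.
lra.
Qed.

Variable K : R.
Hypothesis KP : \sum_x deg x * (w x + kappa * deg x) ^+ 2 <= K * q.

Lemma K_ge0 : 0 <= K.
Proof.
rewrite -(pmulr_lge0 _ q_gt0); apply: le_trans KP; apply: sumr_ge0 => x _.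
by rewrite mulr_ge0 ?deg_ge0 ?sqr_ge0.
Qed.

(** The potential is M^2 + K s: the drift of K s compensates the mean square of the
    increments of M. *)
Lemma Ex_mass2_le U X : full U X -> ~~ odd #|U| -> theta_inv q (active U X) X ->
  Ex U (fun m => mass w (reach m X) ^+ 2) <=
    (mass w X + kappa * (active U X)%:R) ^+ 2 + K * (active U X)%:R.
Proof.
move=> fU eU iX; have k0 := kappa_ge0; have q0 := q_gt0.
apply: (@Ex_potential q (fun s X => (mass w X + kappa * s) ^+ 2 + K * s)
  (fun X => mass w X ^+ 2)) => // [Y _|s Y s1 s2 qY].
  by rewrite !mulr0 !addr0.
set M := mass w Y + kappa * s.
rewrite (eq_bigr (fun x => 2 * M * (deg x * xi x) + deg x * (deg x - 2) ^+ 0 * xi x ^+ 2 +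
   K * (deg x * (deg x - 2)))); last by move=> x xY; rewrite massU1 // /xi /M; ring.
rewrite !big_split /= -!mulr_sumr sum_excess.
have := sum_xi_le0 qY; set S1 := \sum_(_ | _) _ => S1le.
have := @sum_xi_le 0 2 Y; set S2 := \sum_(_ | _) _.
rewrite (eq_bigr (fun x => deg x * (w x + kappa * deg x) ^+ 2)) => [S2le|x _]; last by rewrite expr1.
have K0 := K_ge0; have {S2le} S2le := le_trans S2le KP.
have Kt : K * q <= K * theta Y by rewrite ler_wpM2l.
have m0 : 0 <= mass w Y by apply: mass_ge0.
have M1 : kappa <= M by rewrite /M; nra.
have M0 : 2 * M * S1 <= 0 by rewrite mulr_ge0_le0 // mulr_ge0 //; lra.
have loop : (s - 1) * ((mass w Y + kappa * (s - 2)) ^+ 2 + K * (s - 2) - (M ^+ 2 + K * s)) <= 0.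
  apply: mulr_ge0_le0; first by lra.
  have -> : (mass w Y + kappa * (s - 2)) = M - 2 * kappa by rewrite /M; ring.
  nra.
lra.
Qed.

Variable K3 : R.
Hypothesis K3P : 3 * K * (\sum_x deg x ^+ 2 * (w x + kappa * deg x)) +
  \sum_x deg x * (w x + kappa * deg x) ^+ 3 <= K3 * q.

(** The potential is M^3 + 3 K s M + K3 s. The second term absorbs 3 M times the mean
    square increment of M, the last one the mean cube and the covariance of the
    increments of s and M. *)
Lemma Ex_mass3_le U X : full U X -> ~~ odd #|U| -> theta_inv q (active U X) X ->
  Ex U (fun m => mass w (reach m X) ^+ 3) <=
    (mass w X + kappa * (active U X)%:R) ^+ 3 +
    3 * K * (active U X)%:R * (mass w X + kappa * (active U X)%:R) + K3 * (active U X)%:R.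
Proof.
move=> fU eU iX; have k0 := kappa_ge0; have q0 := q_gt0.
apply: (@Ex_potential q (fun s X => (mass w X + kappa * s) ^+ 3 +
    3 * K * s * (mass w X + kappa * s) + K3 * s)
  (fun X => mass w X ^+ 3)) => // [Y _|s Y s1 s2 qY].
  by rewrite !mulr0 !mul0r !addr0.
set M := mass w Y + kappa * s.
rewrite (eq_bigr (fun x => (3 * M ^+ 2 + 3 * K * s) * (deg x * xi x) +
   3 * M * (deg x * (deg x - 2) ^+ 0 * xi x ^+ 2) +
   deg x * (deg x - 2) ^+ 0 * xi x ^+ 3 +
   3 * K * (deg x * (deg x - 2) ^+ 1 * xi x ^+ 1) +
   (3 * K * M + K3) * (deg x * (deg x - 2)))); last first.
  by move=> x xY; rewrite massU1 // /xi /M; ring.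
rewrite !big_split /= -!mulr_sumr sum_excess.
have := sum_xi_le0 qY; set S1 := \sum_(_ | _) _ => S1le.
have := @sum_xi_le 0 2 Y; set S2 := \sum_(_ | _) _.
rewrite (eq_bigr (fun x => deg x * (w x + kappa * deg x) ^+ 2)) => [S2le|x _]; last by rewrite expr1.
have := @sum_xi_le 0 3 Y; set S3 := \sum_(_ | _) _.
rewrite (eq_bigr (fun x => deg x * (w x + kappa * deg x) ^+ 3)) => [S3le|x _]; last by rewrite expr1.
have := @sum_xi_le 1 1 Y; set S4 := \sum_(_ | _) _.
rewrite (eq_bigr (fun x => deg x ^+ 2 * (w x + kappa * deg x))) => [S4le|x _]; last by rewrite expr1.
have K0 := K_ge0; have {S2le} S2le := le_trans S2le KP.
have m0 : 0 <= mass w Y by apply: mass_ge0.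
have M1 : kappa <= M by rewrite /M; nra.
have M0 : 0 <= M by lra.
have K30 : 0 <= K3.
  rewrite -(pmulr_lge0 _ q_gt0); apply: le_trans K3P.
  by rewrite addr_ge0 ?mulr_ge0 // sumr_ge0 // => x _; rewrite ?mulr_ge0 ?exprn_ge0 ?addr_ge0 ?mulr_ge0 ?deg_ge0.
have t1 : (3 * M ^+ 2 + 3 * K * s) * S1 <= 0.
  rewrite mulr_ge0_le0 // addr_ge0 ?mulr_ge0 ?sqr_ge0 //; lra.
have t2 : 3 * M * S2 <= 3 * M * (K * q) by rewrite ler_wpM2l // mulr_ge0.
have t4 : 3 * K * S4 <= 3 * K * \sum_x deg x ^+ 2 * (w x + kappa * deg x) by rewrite ler_wpM2l // mulr_ge0.
have t5 : (3 * K * M + K3) * q <= (3 * K * M + K3) * theta Y.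
  by rewrite ler_wpM2l // addr_ge0 ?mulr_ge0.
have loop : (s - 1) * ((mass w Y + kappa * (s - 2)) ^+ 3 + 3 * K * (s - 2) * (mass w Y + kappa * (s - 2)) + K3 * (s - 2) - (M ^+ 3 + 3 * K * s * M + K3 * s)) <= 0.
  case: s2 => [->|s2]; first by rewrite subrr mul0r.
  apply: mulr_ge0_le0; first by lra.
  have -> : (mass w Y + kappa * (s - 2)) = M - 2 * kappa by rewrite /M; ring.
  have N0 : 0 <= M - 2 * kappa by rewrite /M; nra.
  have NM : M - 2 * kappa <= M by lra.
  have c3 : (M - 2 * kappa) ^+ 3 <= M ^+ 3 by rewrite lerXn2r ?nnegrE.
  have c1 : 3 * K * (s - 2) * (M - 2 * kappa) <= 3 * K * s * M.
    by apply: ler_pM => //; rewrite ?mulr_ge0 ?ler_wpM2l ?mulr_ge0 //; lra.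
  nra.
move: loop t4 S3le K3P; set L := (s - 1) * _.
by set S5 := \sum_(_ : I) _; set S6 := \sum_(_ : I) _ => *; lra.
Qed.

End Sums.

(** The drift of M fails to vanish for three reasons: vertices already visited no
    longer bring weight, their removal changes theta, and partners over X destroy two
    active half-edges at once. The first two are controlled by the mass r of [rho]
    over X, the last one by s. The correction s (A r + B + C s) has a drift that
    dominates all of them: A s r pays for r, C s^2 for the terms in s, and B s for
    the constants produced by the other two. *)
Section Lower.
Variables (q kappa A B C : R) (w : I -> R).
Hypotheses (q_gt0 : 0 < q) (w_ge0 : forall x, 0 <= w x) (kappa_ge0 : 0 <= kappa).
Hypothesis kappaP : kappa * theta set0 <= \sum_x deg x * w x.
Let rho x := deg x * w x + kappa * deg x ^+ 2.
Hypotheses (A0 : 0 <= A) (B0 : 0 <= B) (C0 : 0 <= C) (AP : A * q = 1).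
Hypothesis CP : A * (\sum_x deg x * rho x) + 2 * kappa <= 2 * C * q.
Hypothesis BP : A * (\sum_x deg x ^+ 2 * rho x) + C * (\sum_x deg x ^+ 3) <= B * q.

Let rho_ge0 x : 0 <= rho x.
Proof. by rewrite /rho addr_ge0 ?mulr_ge0 ?sqr_ge0 ?deg_ge0. Qed.

Lemma Ex_mass_ge U X : full U X -> ~~ odd #|U| -> theta_inv q (active U X) X ->
  mass w X + kappa * (active U X)%:R -
    (active U X)%:R * (A * mass rho X + B + C * (active U X)%:R) <=
  Ex U (fun m => mass w (reach m X)).
Proof.
move=> fU eU iX; have k0 := kappa_ge0; have q0 := q_gt0; rewrite -lerN2 -ExN.
apply: (@Ex_potential q (fun s X => - (mass w X + kappa * s - s * (A * mass rho X + B + C * s)))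
  (fun X => - mass w X)) => // [Y _|s Y s1 s2 qY].
  by rewrite mulr0 mul0r addr0 subr0.
set r := mass rho Y.
rewrite (eq_bigr (fun x => - (deg x * w x) +
   (A * r - kappa + B + 2 * C * s) * (deg x * (deg x - 2)) +
   A * s * (deg x * rho x) + A * (deg x * (deg x - 2) * rho x) +
   C * (deg x * (deg x - 2) ^+ 2))); last first.
  by move=> x xY; rewrite !massU1 // -/r; ring.
rewrite !big_split /= -!mulr_sumr sum_excess sumrN.
have r0 : 0 <= r by apply: mass_ge0.
have d3 x : deg x * (deg x - 2) ^+ 2 <= deg x ^+ 3.
  case: (deg_cases x) => [->|d1]; first by rewrite mul0r expr0n.
  by rewrite [leRHS]exprS ler_wpM2l ?deg_ge0 //; move: (deg x) d1 => D d1; lra.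
have key : kappa * theta Y - \sum_(x | x \notin Y) deg x * w x <= r.
  rewrite lerBlDr; have := kappaP; rewrite (theta0E Y) (massI _ Y) mulrDr => H.
  suff : mass (fun x => deg x * w x) Y <= r + kappa * mass (fun x => deg x * (2 - deg x)) Y by lra.
  rewrite /r /mass mulr_sumr -big_split /=; apply: ler_sum => x _.
  have := deg_ge0 x; rewrite /rho; nra.
have s1' : \sum_(x | x \notin Y) deg x * rho x <= \sum_x deg x * rho x.
  by apply: outside_le => x; rewrite mulr_ge0 ?deg_ge0.
have s2' : \sum_(x | x \notin Y) deg x * (deg x - 2) * rho x <= \sum_x deg x ^+ 2 * rho x.
  apply: le_trans (outside_le Y _); last by move=> x; rewrite mulr_ge0 ?sqr_ge0.
  apply: ler_sum => x _; rewrite ler_wpM2r // expr2; have := deg_ge0 x; nra.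
have s3' : \sum_(x | x \notin Y) deg x * (deg x - 2) ^+ 2 <= \sum_x deg x ^+ 3.
  apply: le_trans (outside_le Y _); last by move=> x; rewrite exprn_ge0 ?deg_ge0.
  by apply: ler_sum.
move: s1' s2' s3' key CP BP.
set S1 := \sum_(_ | _) _; set P1 := \sum_(_ : I) _; set S2 := \sum_(_ | _) _.
set P2 := \sum_(_ : I) _; set S3 := \sum_(_ | _) _; set P3 := \sum_(_ : I) _.
set S4 := \sum_(_ | _) _ => s1' s2' s3' key cP bP.
have t1 : A * s * S1 <= s * (A * P1).
  by rewrite mulrAC [leLHS]mulrC ler_wpM2l ?ler_wpM2l //; lra.
have t2 : A * S2 <= A * P2 by rewrite ler_wpM2l.
have t3 : C * S3 <= C * P3 by rewrite ler_wpM2l.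
have t4 : (A * r + B + 2 * C * s) * q <= (A * r + B + 2 * C * s) * theta Y.
  by rewrite ler_wpM2l // !addr_ge0 ?mulr_ge0 //; lra.
have t5 : s * (A * P1 + 2 * kappa) <= s * (2 * C * q) by rewrite ler_wpM2l //; lra.
have t6 : A * r * q = r by rewrite mulrAC AP mul1r.
have loop : (s - 1) * (- (mass w Y + kappa * (s - 2) - (s - 2) * (A * r + B + C * (s - 2))) -
    - (mass w Y + kappa * s - s * (A * r + B + C * s))) <= s * (2 * kappa).
  rewrite [X in _ * X <= _](_ : _ = 2 * kappa - 2 * (A * r + B) + C * (4 - 4 * s)); last by ring.
  apply: le_trans (_ : _ <= (s - 1) * (2 * kappa)) _; last by rewrite ler_wpM2r ?mulr_ge0 //; lra.
  rewrite ler_wpM2l //; first by lra.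
  have : 0 <= A * r by rewrite mulr_ge0.
  have : 0 <= C * (s - 1) by rewrite mulr_ge0 //; lra.
  by have := B0; lra.
nra.
Qed.

End Lower.
End Moments.

(** * Components of one and of two roots *)

Section Component.
Import mathcomp.boot.fintype mathcomp.boot.finset.
Local Open Scope set_scope.
Local Open Scope ring_scope.

Variables (T I : finType) (vtx : T -> I) (R : realType).
Implicit Types (U : {set T}) (m : {ffun T -> T}) (h : T) (X : {set I}).

Local Notation comp := (comp vtx).
Local Notation reach := (reach vtx).
Local Notation active := (active vtx).
Local Notation full := (full vtx).
Local Notation deg := (deg vtx R).
Local Notation theta := (theta vtx R).

Lemma mem_comp m i : i \in comp m i. Proof. by rewrite inE connect0. Qed.

Lemma comp_sym U m i j : m \in matchings U -> (j \in comp m i) = (i \in comp m j).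
Proof. by move=> mU; rewrite !inE (sym_connect_sym (adj_sym vtx mU)). Qed.

Lemma comp_eq U m i j : m \in matchings U -> j \in comp m i -> comp m j = comp m i.
Proof.
move=> mU; rewrite inE => ij; have sy := sym_connect_sym (adj_sym vtx mU).
by apply/setP=> k; rewrite !inE (same_connect sy ij).
Qed.

Lemma active_root U X i : full U X -> active U X = 0 -> i \notin X ->
  active U (i |: X) = dg vtx i.
Proof.
move=> fU a0 iX; apply: eq_card => h; rewrite !inE.
case: (eqVneq (vtx h) i) => [e|_] /=; first by rewrite andbT fU // e.
by apply/negP=> /andP[hU hX]; have := active_eq0 a0 hX; rewrite hU.
Qed.

Lemma mass_comp (w : I -> R) U X i m : full U X -> active U X = 0 -> i \notin X ->
  m \in matchings U -> mass w (comp m i) = mass w (reach m (i |: X)) - mass w X.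
Proof.
move=> fU a0 iX mU; apply/esym/(canLR (addrK _)).
have [_ fx] := matchingsP _ _ mU.
have rX : reach m X = X.
  by apply: reach_inactive => h hX; apply: fx; apply: active_eq0 hX.
rewrite reachU1 rX /mass setUC.
rewrite (eq_bigl [predU comp m i & X]); last by move=> k; rewrite in_setU.
rewrite bigU //=.
rewrite disjoint_subset; apply/subsetP => k kc; rewrite inE; apply/negP=> kX.
have : i \in reach m X by apply/reachP; exists k => //; move: kc; rewrite (comp_sym _ _ mU) inE.
by rewrite rX (negbTE iX).
Qed.

(* The second of two roots is explored in a state where the component X of the
   first one has been completed. *)
Section Root.
Variables (U : {set T}) (X : {set I}) (i : I) (q : R).
Hypotheses (fU : full U X) (eU : ~~ odd #|U|) (a0 : active U X = 0) (iX : i \notin X).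
Hypotheses (q0 : 0 < q) (qX : q + 2 <= theta X).
Variables (kappa : R) (w : I -> R).
Hypotheses (w_ge0 : forall x, 0 <= w x) (k0 : 0 <= kappa).
Hypothesis kP : \sum_x deg x * w x <= kappa * q.

Let fU' : full U (i |: X).
Proof. by move=> h; rewrite inE negb_or => /andP[_]; apply: fU. Qed.

Let inv' : theta_inv vtx q (active U (i |: X)) (i |: X).
Proof. by rewrite active_root //; apply: theta_inv_start. Qed.

Lemma Ex_comp_le : Ex U (fun m => mass w (comp m i)) <= w i + kappa * deg i.
Proof.
rewrite (Ex_eq (g := fun m => mass w (reach m (i |: X)) + (- mass w X))); last first.
  by move=> m mU; rewrite (mass_comp w fU a0 iX mU).
rewrite ExD Ex_cst // lerBlDr.
apply: le_trans (Ex_mass_le q0 w_ge0 k0 kP fU' eU inv') _.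
by rewrite massU1 // active_root // addrAC.
Qed.

End Root.

Section Whole.
Variables (i : I) (q : R).
Hypotheses (eT : ~~ odd #|T|) (q0 : 0 < q) (qT : q + 2 <= theta set0).

Let fT X : full [set: T] X. Proof. by move=> h _; rewrite inE. Qed.

Let aT : active [set: T] [set i] = dg vtx i.
Proof. by apply: eq_card => h; rewrite !inE. Qed.

Let eT' : ~~ odd #|[set: T]|. Proof. by rewrite cardsT. Qed.

Let iT : theta_inv vtx q (active [set: T] [set i]) [set i].
Proof. by rewrite aT; apply: theta_inv_start1. Qed.

Let Ex1 (f : {set I} -> R) :
  Ex [set: T] (fun m => f (comp m i)) = Ex [set: T] (fun m => f (reach m [set i])).
Proof. by apply: Ex_eq => m _; rewrite reach1. Qed.

Lemma mass1 (f : I -> R) : mass f [set i] = f i.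
Proof. by rewrite /mass big_set1. Qed.

Variables (kappa K K3 : R) (w : I -> R).
Hypotheses (w_ge0 : forall x, 0 <= w x) (k0 : 0 <= kappa).

Lemma Ex_comp2_le :
  \sum_x deg x * w x <= kappa * q ->
  \sum_x deg x * (w x + kappa * deg x) ^+ 2 <= K * q ->
  Ex [set: T] (fun m => mass w (comp m i) ^+ 2) <= (w i + kappa * deg i) ^+ 2 + K * deg i.
Proof.
move=> kP KP; rewrite (Ex1 (fun X => mass w X ^+ 2)).
by apply: le_trans (Ex_mass2_le q0 w_ge0 k0 kP KP _ eT' iT) _; rewrite ?mass1 ?aT.
Qed.

Lemma Ex_comp3_le :
  \sum_x deg x * w x <= kappa * q ->
  \sum_x deg x * (w x + kappa * deg x) ^+ 2 <= K * q ->
  3 * K * (\sum_x deg x ^+ 2 * (w x + kappa * deg x)) +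
     \sum_x deg x * (w x + kappa * deg x) ^+ 3 <= K3 * q ->
  Ex [set: T] (fun m => mass w (comp m i) ^+ 3) <=
    (w i + kappa * deg i) ^+ 3 + 3 * K * deg i * (w i + kappa * deg i) + K3 * deg i.
Proof.
move=> kP KP K3P; rewrite (Ex1 (fun X => mass w X ^+ 3)).
by apply: le_trans (Ex_mass3_le q0 w_ge0 k0 kP KP K3P _ eT' iT) _; rewrite ?mass1 ?aT.
Qed.

Let rho x := deg x * w x + kappa * deg x ^+ 2.

Lemma Ex_comp_ge A B C :
  kappa * theta set0 <= \sum_x deg x * w x -> 0 <= A -> 0 <= B -> 0 <= C -> A * q = 1 ->
  A * (\sum_x deg x * rho x) + 2 * kappa <= 2 * C * q ->
  A * (\sum_x deg x ^+ 2 * rho x) + C * (\sum_x deg x ^+ 3) <= B * q ->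
  w i + kappa * deg i - deg i * (A * rho i + B + C * deg i) <=
  Ex [set: T] (fun m => mass w (comp m i)).
Proof.
move=> kP A0 B0 C0 AP CP BP; rewrite (Ex1 (fun X => mass w X)).
apply: le_trans (Ex_mass_ge q0 w_ge0 k0 kP A0 B0 C0 AP CP BP _ eT' iT) => //.
by rewrite !mass1 aT.
Qed.

End Whole.

Lemma mass_comp_local (w : I -> R) i : local_at vtx i (fun m => mass w (comp m i)).
Proof. by move=> m1 m2 H; rewrite (comp_local H). Qed.

Section TwoRoots.
Variables (q : R) (w : I -> R).
Hypotheses (eT : ~~ odd #|T|) (q0 : 0 < q) (qT : q + 4 <= theta set0).
Hypotheses (w_ge0 : forall x, 0 <= w x).


Lemma Ex_comp1_le kappa i : 0 <= kappa -> \sum_x deg x * w x <= kappa * q ->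
  Ex [set: T] (fun m => mass w (comp m i)) <= w i + kappa * deg i.
Proof.
move=> k0 kP; apply: (@Ex_comp_le setT set0 i q) => //; rewrite ?cardsT ?inE //.
- by apply: eq_card0 => h; rewrite !inE.
- by have := qT; have := q0; lra.
Qed.

(** Two vertices in different components behave as if independent, since
    deleting the component of the first one only helps the second one. *)
Lemma Ex_two_roots (F G : I -> {ffun T -> T} -> R) (bF bG : I -> R) :
  (forall i m, 0 <= F i m) -> (forall i, local_at vtx i (F i)) ->
  (forall i, local_at vtx i (G i)) ->
  (forall i, Ex [set: T] (F i) <= bF i) -> (forall i, 0 <= bG i) ->
  (forall U X j, full U X -> ~~ odd #|U| -> active U X = 0 ->
     q + 2 <= theta X -> j \notin X -> Ex U (G j) <= bG j) ->
  Ex [set: T] (fun m => \sum_i \sum_j w i * w j * (F i m * (j \notin comp m i)%:R * G j m))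
    <= (\sum_i w i * bF i) * (\sum_j w j * bG j).
Proof.
move=> F0 Fl Gl Fle bG0 Gle; rewrite Ex_sum mulr_suml; apply: ler_sum => i _.
rewrite Ex_sum mulr_sumr; apply: ler_sum => j _; rewrite ExZl [leRHS]mulrACA.
apply: ler_wpM2l; first by rewrite mulr_ge0.
apply: le_trans (_ : _ <= Ex [set: T] (F i) * bG j) _; last by rewrite ler_wpM2r.
apply: (@Ex_decouple _ _ vtx R (theta_inv vtx (q + 2))) => //.
- exact: theta_inv_loop.
- exact: theta_inv_new.
- by move=> U X fU eU a0; rewrite /theta_inv addr0 => ? ?; apply: (Gle U X).
- by apply: theta_inv_start1; have := qT; lra.
Qed.

Variables (kappa : R) (k0 : 0 <= kappa).
Hypothesis kP : \sum_x deg x * w x <= kappa * q.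

(** Two roots in the same component contribute the third power of its weight. *)
Lemma Ex_susceptibility2_le (b3 : I -> R) :
  (forall i, Ex [set: T] (fun m => mass w (comp m i) ^+ 3) <= b3 i) ->
  Ex [set: T] (fun m => (\sum_i w i * mass w (comp m i)) ^+ 2) <=
    (\sum_i w i * (w i + kappa * deg i)) ^+ 2 + \sum_i w i * b3 i.
Proof.
move=> b3P; pose F i m := mass w (comp m i).
rewrite (Ex_eq (g := fun m =>
    \sum_i \sum_j w i * w j * (F i m * (j \notin comp m i)%:R * F j m) +
    \sum_i w i * F i m ^+ 3)); last first.
  move=> m mU; rewrite expr2 big_distrlr /= -big_split /=; apply: eq_bigr => i _.
  have -> : w i * F i m ^+ 3 = \sum_j w i * w j * (F i m * (j \in comp m i)%:R * F j m).
    rewrite [X in _ = X](eq_bigr (fun j => if j \in comp m i then w i * F i m ^+ 2 * w j else 0)).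
      by rewrite -big_mkcond /= -mulr_sumr -/(mass w (comp m i)) -/(F i m); ring.
    move=> j _; case: ifP => jc; last by rewrite mulr0 mul0r mulr0.
    by rewrite /F (comp_eq mU jc) mulr1; ring.
  rewrite -big_split /=; apply: eq_bigr => j _; rewrite -/(F i m) -/(F j m).
  by case: (j \in comp m i) => /=; ring.
rewrite ExD lerD //; last first.
  by rewrite Ex_sum; apply: ler_sum => i _; rewrite ExZl; apply: ler_wpM2l => //; apply: b3P.
rewrite expr2; apply: Ex_two_roots => //.
- by move=> i m; apply: mass_ge0.
- by move=> i; apply: mass_comp_local.
- by move=> i; apply: mass_comp_local.
- by move=> i; apply: Ex_comp1_le.
- by move=> i; rewrite addr_ge0 // mulr_ge0 // deg_ge0.
- by move=> U X j fU eU a0 qX jX; apply: (Ex_comp_le fU eU a0 jX q0 qX).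
Qed.

End TwoRoots.

(** The bound on the mean for the weight concentrated at j. *)
Lemma Ex_connected_le (q : R) i j : ~~ odd #|T| -> 0 < q -> q + 4 <= theta set0 -> i != j ->
  Ex [set: T] (fun m => (j \in comp m i)%:R) <= deg i * deg j / q.
Proof.
move=> eT q0 qT ij; pose w k : R := (k == j)%:R.
have mw X : mass w X = (j \in X)%:R.
  rewrite /mass /w; case: (boolP (j \in X)) => jX.
    by rewrite (bigD1 j) //= eqxx big1 ?addr0 // => k /andP[_ /negbTE->].
  by rewrite big1 // => k kX; case: eqP => // e; rewrite e (negbTE jX) in kX.
rewrite (Ex_eq (g := fun m => mass w (comp m i))); last by move=> m _; rewrite mw.
apply: le_trans (@Ex_comp1_le q w eT q0 qT _ (deg j / q) i _ _) _.
- by move=> k; apply: ler0n.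
- by rewrite divr_ge0 ?deg_ge0 // ltW.
- rewrite divfK ?gt_eqF // (bigD1 j) //= /w eqxx mulr1 big1 ?addr0 // => k /negbTE->.
  by rewrite mulr0.
- by rewrite /w (negbTE ij) add0r mulrC mulrA.
Qed.

End Component.

(** * Graph distances *)

Section Geometric.
Local Open Scope ring_scope.
Variable R : realType.
Implicit Types (x : R) (t D : nat).

Lemma geometric_sum x t : (1 - x) * (\sum_(r < t) x ^+ r) = 1 - x ^+ t.
Proof.
elim: t => [|t IH]; first by rewrite big_ord0 mulr0 expr0 subrr.
by rewrite big_ord_recr /= mulrDr IH exprS; ring.
Qed.

Lemma weighted_geometric_le x t : 0 <= x -> x < 1 ->
  \sum_(l < t) l.+1%:R * x ^+ l <= ((1 - x) ^+ 2)^-1.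
Proof.
move=> x0 x1; have e : (1 - x) ^+ 2 * (\sum_(l < t) l.+1%:R * x ^+ l) =
    1 - t.+1%:R * x ^+ t + t%:R * x ^+ t.+1.
  elim: t => [|t IH]; first by rewrite big_ord0 mulr0 expr0 mul0r mul1r subrr addr0.
  rewrite big_ord_recr /= mulrDr IH !exprS -(addn1 t.+1) -(addn1 t) !natrD; ring.
have p0 : 0 < (1 - x) ^+ 2 by rewrite exprn_gt0 // subr_gt0.
rewrite -[leRHS]mul1r ler_pdivlMr // mulrC e.
have xt : 0 <= x ^+ t by rewrite exprn_ge0.
have : t%:R * x ^+ t.+1 <= t.+1%:R * x ^+ t.
  rewrite exprS mulrA; apply: ler_wpM2r => //.
  apply: le_trans (_ : _ <= t%:R) _; last by rewrite ler_nat.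
  by rewrite ler_piMr // ltW.
lra.
Qed.

Lemma double_geometric x t :
  (1 - x) ^+ 2 * (\sum_(l < t) \sum_(r < l) x ^+ r) = t%:R * (1 - x) - (1 - x ^+ t).
Proof.
elim: t => [|t IH]; first by rewrite big_ord0 mulr0 expr0 mul0r !subrr.
by rewrite big_ord_recr /= mulrDr IH expr2 -mulrA geometric_sum exprS -(addn1 t) natrD; ring.
Qed.

Lemma sum_eq_index t D :
  \sum_(l < t) l.+1%:R * (D == l.+1)%:R = (if (D <= t)%N then D else 0%N)%:R :> R.
Proof.
elim: t => [|t IH]; first by rewrite big_ord0; case: D.
rewrite big_ord_recr /= IH [in RHS]leq_eqVlt ltnS; case: eqVneq => [->|_] /=.
  by rewrite ltnn add0r mulr1.
by rewrite mulr0 addr0.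
Qed.

Lemma sum_lt_index t D : \sum_(l < t) (l < D)%:R = (minn D t)%:R :> R.
Proof.
elim: t => [|t IH]; first by rewrite big_ord0 minn0.
rewrite big_ord_recr /= IH -natrD; congr _%:R; case: (ltnP t D) => h /=; lia.
Qed.

Lemma sum_index_lt l D : (l < D)%:R = 1 - \sum_(r < l.+1) (D == r)%:R :> R.
Proof.
elim: l => [|l IH].
  by rewrite big_ord_recr big_ord0 /= add0r; case: D => [|D] /=; rewrite ?subrr ?subr0.
rewrite big_ord_recr /= opprD addrA -IH.
apply/eqP; rewrite eq_sym subr_eq -natrD eqr_nat; apply/eqP.
by case: (ltngtP D l.+1) => h; case: (ltnP l D) => h'; lia.
Qed.

End Geometric.

Section Distance.
Import mathcomp.boot.fintype mathcomp.boot.finset.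
Local Open Scope set_scope.
Local Open Scope ring_scope.

Variables (n : nat) (d : n.-tuple nat) (R : realType).
Let T := half_edge d.
Definition owner (h : half_edge d) : 'I_n := tag h.
Implicit Types (U : {set T}) (m : {ffun T -> T}) (X : {set 'I_n}) (t : nat).

Local Notation comp := (comp owner).
Local Notation full := (full owner).
Local Notation active := (active owner).
Local Notation deg := (deg owner R).
Local Notation theta := (theta owner R).
Local Notation dist m i k := (graph_dist m i k).

Lemma dist_path m i k : k \in comp m i -> exists p : seq 'I_n,
  [/\ path (adj owner m) i p, last i p = k & size p = dist m i k].
Proof.
rewrite inE => /connectP[p0 pp0 ->]; case: (shortenP pp0) => p pp up _.
set P := fun k0 => _.
have hP : has (fun s => [exists q : s.-tuple 'I_n, path (adjacent m) i q && (last i q == last i p)]) (iota 0 n).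
  apply/hasP; exists (size p).
    by rewrite mem_iota add0n /=; have := card_uniqP up; have := max_card (mem (i :: p)); rewrite card_ord /= => + <-.
  by apply/existsP; exists (in_tuple p); rewrite /= eqxx andbT.
have := nth_find 0%N hP; rewrite nth_iota; last by rewrite -[X in (_ < X)%N](size_iota 0 n) -has_find.
by rewrite add0n => /existsP[q /andP[pq /eqP lq]]; exists q; split=> //; rewrite size_tuple.
Qed.

Lemma dist_le m i p : path (adj owner m) i p -> (dist m i (last i p) <= size p)%N.
Proof.
move=> pp; rewrite leqNgt; apply/negP => lt.
have lt2 : (size p < n)%N.
  apply: leq_trans lt _; apply: leq_trans (find_size _ _) _; by rewrite size_iota.
have := before_find 0%N lt; rewrite nth_iota // add0n => /existsP; apply.
by exists (in_tuple p); rewrite /= eqxx andbT.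
Qed.

(** A shortest path is simple, and so are its initial segments. *)
Lemma dist_avoiding m i k t : k \in comp m i -> (t <= dist m i k)%N ->
  exists2 k', path_avoiding owner m t i [set i] k' & t = dist m i k -> k' = k.
Proof.
move=> kc; have [p [pp lp sp]] := dist_path kc.
move: lp sp; case: (shortenP pp) => p' pp' up' sub lp sp ltd.
have sp' : size p' = dist m i k.
  apply/eqP; rewrite eqn_leq; apply/andP; split; last by rewrite -lp dist_le.
  by rewrite -sp; apply: uniq_leq_size; [case/andP: up' | move=> x; apply: sub].
have st : size (take t p') == t by rewrite size_takel ?sp'.
exists (last i (take t p')); last first.
  by move=> e; rewrite take_oversize // sp' e.
apply/existsP; exists (Tuple st) => /=; rewrite take_path //= eqxx andbT.
case/andP: up' => ip' up'; rewrite take_uniq //=.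
apply/allP=> x /mem_take xp; rewrite inE; by apply: contraNneq ip' => <-.
Qed.

Variable w : 'I_n -> R.
Hypothesis w_ge0 : forall x, 0 <= w x.

Lemma sphere_le m i l :
  \sum_(k in comp m i) w k * (dist m i k == l)%:R <= path_weight owner w m l i [set i].
Proof.
apply: le_trans (path_weight_ge owner w_ge0 m l i [set i]).
rewrite big_mkcond /=; apply: ler_sum => k _; case: ifP => kc; last by rewrite mulr_ge0.
rewrite ler_wpM2l //; case: eqP => // e; rewrite ler1n lt0b.
have [|k' + e'] := @dist_avoiding m i k l kc; first by rewrite e.
by rewrite e'.
Qed.

(** Distances larger than t are discarded here and replaced by t in
    [min_dist_weight]: the former is bounded from above, the latter from below,
    and they agree when no distance exceeds t. *)
Definition dist_weight t m i : R :=
  \sum_(k in comp m i) w k * (if (dist m i k <= t)%N then dist m i k else 0%N)%:R.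

Definition min_dist_weight t m i : R :=
  \sum_(k in comp m i) w k * (minn (dist m i k) t)%:R.

Lemma dist_weight_ge0 t m i : 0 <= dist_weight t m i.
Proof. by apply: sumr_ge0 => k _; rewrite mulr_ge0. Qed.

Lemma dist_weight_le_mass t m i : dist_weight t m i <= t%:R * mass w (comp m i).
Proof.
rewrite /mass mulr_sumr; apply: ler_sum => k _; rewrite [leRHS]mulrC ler_wpM2l // ler_nat.
by case: ifP.
Qed.

Lemma dist_weight_local t i : local_at owner i (dist_weight t ^~ i).
Proof.
move=> m1 m2 H; rewrite /dist_weight (comp_local H); apply: eq_bigr => k _.
suff -> : dist m1 i k = dist m2 i k by [].
apply: eq_find => s; apply: eq_existsb => p; congr (_ && _).
exact: (path_local p H).
Qed.

Lemma dist_weight_le t m i :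
  dist_weight t m i <= \sum_(l < t) l.+1%:R * path_weight owner w m l.+1 i [set i].
Proof.
rewrite /dist_weight (eq_bigr (fun k => \sum_(l < t) l.+1%:R * (w k * (dist m i k == l.+1)%:R))).
  by rewrite exchange_big /=; apply: ler_sum => l _; rewrite -mulr_sumr ler_wpM2l // sphere_le.
by move=> k _; rewrite -sum_eq_index mulr_sumr; apply: eq_bigr => l _; rewrite mulrCA.
Qed.

Lemma min_dist_weight_ge t m i :
  \sum_(l < t) (mass w (comp m i) - w i -
     \sum_(r < l) path_weight owner w m r.+1 i [set i]) <= min_dist_weight t m i.
Proof.
rewrite /min_dist_weight (eq_bigr (fun k => \sum_(l < t) (w k - \sum_(r < l.+1) w k * (dist m i k == r)%:R))).
  rewrite exchange_big /=; apply: ler_sum => l _; rewrite sumrB -addrA lerD2l.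
  rewrite [in leRHS]exchange_big /= -opprD lerN2 big_ord_recl; apply: lerD; first exact: sphere_le.
  by apply: ler_sum => r _; apply: sphere_le.
move=> k _; rewrite -sum_lt_index mulr_sumr; apply: eq_bigr => l _.
by rewrite sum_index_lt mulrBr mulr1 mulr_sumr.
Qed.

Lemma path_weight_isolated U X m l j Y : m \in matchings U -> full U X ->
  active U X = 0 -> j \notin X ->
  path_weight owner w m l j Y = path_weight owner w m l j (X :|: Y).
Proof.
move=> mU fU a0; have [H1 H2] := matchingsP _ _ mU.
elim: l j Y => // l IH j Y jX; rewrite !path_weightS; apply: eq_bigr => h /eqP hj.
have mhX : owner (m h) \notin X.
  case: (boolP (h \in U)) => hU; last by rewrite H2 // hj.
  by have [mhU _ _] := H1 _ hU; apply/negP=> /(active_eq0 a0); rewrite mhU.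
by rewrite inE (negbTE mhX) /= (IH _ _ mhX) setUCA.
Qed.

Lemma card_halves U X : full U X ->
  #|U|%:R = (active U X)%:R + \sum_(x | x \notin X) deg x :> R.
Proof. by move=> fU; rewrite (card_full fU) natrD natr_sum. Qed.

Lemma thetaE X : theta X = \sum_(x | x \notin X) deg x -
  \sum_(x | x \notin X) deg x * (deg x - 1).
Proof. by rewrite -sumrB; apply: eq_bigr => x _; ring. Qed.

Lemma deg_pred_ge0 x : 0 <= deg x * (deg x - 1).
Proof.
by case: (deg_cases owner R x) => [->|d1]; rewrite ?mul0r // mulr_ge0 ?deg_ge0 // subr_ge0.
Qed.

Let V := \sum_x deg x * w x.
Let L := \sum_x deg x.

Let V_ge0 : 0 <= V.
Proof. by apply: sumr_ge0 => x _; rewrite mulr_ge0 ?deg_ge0. Qed.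

(* X is a completed component, or empty, and the root j lies outside X. *)
Section Terminal.
Variables (U : {set T}) (X : {set 'I_n}) (j : 'I_n) (q : R) (t : nat).
Hypotheses (fU : full U X) (eU : ~~ odd #|U|) (a0 : active U X = 0%N) (jX : j \notin X).
Hypotheses (qX : q <= theta X) (tq : (2 * t)%:R < q).

Let Z : R := #|U|%:R - (2 * t)%:R.
Let S : R := \sum_(x | x \notin X) deg x * (deg x - 1).

Let ZS : q - (2 * t)%:R <= Z - S.
Proof.
rewrite /Z (card_halves fU) a0 add0r; move: qX; rewrite thetaE -/S.
by set a := \sum_(_ | _) _; lra.
Qed.

Let S_ge0 : 0 <= S.
Proof. by apply: sumr_ge0 => x _; apply: deg_pred_ge0. Qed.

Let Z_gt0 : 0 < Z.
Proof. by have := ZS; have := S_ge0; have := tq; lra. Qed.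

Lemma Ex_path_terminal l : (l < t)%N ->
  Ex U (fun m => path_weight owner w m l.+1 j [set j]) <= deg j * (V / Z * (S / Z) ^+ l).
Proof.
move=> lt; rewrite (Ex_eq (g := fun m => path_weight owner w m l.+1 j (j |: X))); last first.
  by move=> m mU; rewrite (path_weight_isolated _ _ mU fU a0 jX) setUC.
have sub (f : 'I_n -> R) : (forall x, 0 <= f x) ->
    \sum_(y | y \notin j |: X) f y <= \sum_(y | y \notin X) f y.
  move=> f0; rewrite [leRHS](bigD1 j) //= (eq_bigl (fun y => (y \notin X) && (y != j))).
    by rewrite lerDr.
  by move=> y; rewrite !inE negb_or andbC.
apply: le_trans (Ex_path_weight w_ge0 Z_gt0 _ eU _ _ _ _) _.
- by move=> h; rewrite inE negb_or => /andP[_]; apply: fU.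
- exact: setU11.
- have : (2 * l)%:R + 1 <= (2 * t)%:R :> R.
    by rewrite -[X in _ + X <= _]/(1%:R) -natrD ler_nat; lia.
  by rewrite /Z; set a := #|U|%:R; lra.
- apply: le_trans (_ : _ <= V) _; last exact: lexx.
  by apply: outside_le => x; rewrite mulr_ge0 ?deg_ge0.
- by apply: sub => x; apply: deg_pred_ge0.
suff -> : #|[set h in U | owner h == j]| = dg owner j by [].
apply: eq_card => h; rewrite !inE; case: eqP => [e|_]; last by rewrite andbF.
by rewrite andbT fU // e.
Qed.


(** The sum of l x^(l - 1) is at most (1 - x)^-2, and Z - S is bounded from below by
    the invariant; the bound is therefore uniform in the deleted component X even
    though Z itself is not. *)
Lemma Ex_dist_weight_le :
  Ex U (dist_weight t ^~ j) <= deg j * (V * L / (q - (2 * t)%:R) ^+ 2).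
Proof.
apply: le_trans (Ex_le (fun m _ => dist_weight_le t m j)) _.
rewrite Ex_sum; set x := S / Z; have Z0 := Z_gt0; have zs := ZS; have tq' := tq.
have x0 : 0 <= x by rewrite divr_ge0 // ltW.
have x1 : x < 1 by rewrite ltr_pdivrMr // mul1r; lra.
apply: le_trans (_ : _ <= deg j * (V / Z) * \sum_(l < t) l.+1%:R * x ^+ l) _.
  rewrite mulr_sumr; apply: ler_sum => l _; rewrite ExZl [leRHS]mulrCA; apply: ler_wpM2l => //; rewrite -mulrA.
  exact: Ex_path_terminal.
rewrite -mulrA; apply: ler_wpM2l; first exact: deg_ge0.
apply: le_trans (ler_wpM2l _ (weighted_geometric_le t x0 x1)) _.
  by rewrite divr_ge0 // ltW.
have -> : V / Z / (1 - x) ^+ 2 = V * Z / (Z - S) ^+ 2.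
  by rewrite /x; field; rewrite !gt_eqF // ?andbT; lra.
have ZL : Z <= L.
  apply: le_trans (_ : _ <= #|U|%:R) _; first by rewrite /Z gerBl.
  by rewrite (card_halves fU) a0 add0r; apply: outside_le => y; apply: deg_ge0.
have qt : 0 < q - (2 * t)%:R by lra.
rewrite ler_pM ?invr_ge0 ?sqr_ge0 ?mulr_ge0 //; first by rewrite ltW.
  by rewrite ler_wpM2l.
rewrite lef_pV2 ?posrE ?exprn_gt0 //; last by lra.
by rewrite lerXn2r ?nnegrE //; lra.
Qed.

End Terminal.

Lemma outside0 (f : 'I_n -> R) : \sum_(x | x \notin (set0 : {set 'I_n})) f x = \sum_x f x.
Proof. by apply: eq_bigl => x; rewrite inE. Qed.

Section FromRoot.
Variables (i : 'I_n) (t : nat).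
Hypotheses (eT : ~~ odd #|T|) (tT : (2 * t)%:R < theta set0).

Let Z : R := L - (2 * t)%:R.
Let S : R := \sum_x deg x * (deg x - 1).

Let fT : full [set: T] set0. Proof. by move=> h _; rewrite inE. Qed.
Let aT : active [set: T] set0 = 0%N.
Proof. by apply: eq_card0 => h; rewrite !inE. Qed.

Let cT : #|[set: T]|%:R = L :> R.
Proof.
by rewrite (card_halves fT) aT add0r outside0.
Qed.

Let ZS : Z - S = theta set0 - (2 * t)%:R.
Proof.
by rewrite thetaE !outside0 -/L -/S /Z; ring.
Qed.

Let S_ge0 : 0 <= S.
Proof. by apply: sumr_ge0 => x _; apply: deg_pred_ge0. Qed.

Let Z_gt0 : 0 < Z.
Proof. by have := ZS; have := S_ge0; have := tT; lra. Qed.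

Lemma Ex_path_root l : (l < t)%N ->
  Ex [set: T] (fun m => path_weight owner w m l.+1 i [set i]) <= deg i * (V / Z * (S / Z) ^+ l).
Proof.
move=> lt; have := @Ex_path_terminal setT set0 i (theta set0) t fT.
have j0 : i \notin set0 by rewrite inE.
rewrite cT cardsT => /(_ eT aT j0 (lexx _) tT l lt).
by rewrite outside0.
Qed.

Lemma Ex_min_dist_weight_ge :
  t%:R * (Ex [set: T] (fun m => mass w (comp m i)) - w i) -
  deg i * (V * (t%:R / (theta set0 - (2 * t)%:R)) -
     V * Z * (1 - (S / Z) ^+ t) / (theta set0 - (2 * t)%:R) ^+ 2) <=
  Ex [set: T] (min_dist_weight t ^~ i).
Proof.
apply: le_trans (Ex_le (fun m _ => min_dist_weight_ge t m i)); rewrite Ex_sum.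
set x := S / Z; have Z0 := Z_gt0; have zs := ZS; have tT' := tT.
have e : V * (t%:R / (theta set0 - (2 * t)%:R)) -
     V * Z * (1 - x ^+ t) / (theta set0 - (2 * t)%:R) ^+ 2 =
   \sum_(l < t) \sum_(r < l) V / Z * x ^+ r.
  under [in RHS]eq_bigr => l _ do rewrite -mulr_sumr.
  rewrite -mulr_sumr; have := double_geometric x t; set D := \sum_(_ < _) _ => De.
  have x1 : 1 - x = (theta set0 - (2 * t)%:R) / Z by rewrite -zs mulrBl divff ?gt_eqF.
  have u0 : 0 < theta set0 - (2 * t)%:R by rewrite subr_gt0.
  rewrite x1 in De; move: (theta set0 - _) u0 (x ^+ t) De => u u0 y De.
  have -> : D = (t%:R * (u / Z) - (1 - y)) / (u / Z) ^+ 2.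
    by rewrite -De [X in X / _]mulrC mulfK // expf_eq0 /= mulf_neq0 ?invr_eq0 ?gt_eqF.
  by field; rewrite !gt_eqF.
rewrite e mulr_sumr; set c := _ - w i.
have -> : t%:R * c = \sum_(l < t) c by rewrite sumr_const card_ord mulr_natl.
rewrite -sumrB; apply: ler_sum => l _; rewrite ExD ExN Ex_sum ExD ExN Ex_cst ?cardsT //.
rewrite lerD2l lerN2 mulr_sumr; apply: ler_sum => r _; apply: Ex_path_root.
exact: ltn_trans (ltn_ord r) (ltn_ord l).
Qed.


End FromRoot.

(** As for the second moment of the susceptibility; in a common component both
    truncated sums of distances are at most t times the weight. *)
Lemma Ex_dist2_le q t (b3 : 'I_n -> R) : ~~ odd #|T| -> 0 < q -> q + 4 <= theta set0 ->
  (2 * t)%:R < q ->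
  (forall i, Ex [set: T] (fun m => mass w (comp m i) ^+ 3) <= b3 i) ->
  Ex [set: T] (fun m => (\sum_i w i * dist_weight t m i) ^+ 2) <=
    (V * (V * L / (q - (2 * t)%:R) ^+ 2)) ^+ 2 + t%:R ^+ 2 * \sum_i w i * b3 i.
Proof.
move=> eT q0 qT tq b3P; pose F i m := dist_weight t m i.
apply: (@le_trans _ _ (Ex [set: T] (fun m =>
    \sum_i \sum_j w i * w j * (F i m * (j \notin comp m i)%:R * F j m) +
    t%:R ^+ 2 * \sum_i w i * mass w (comp m i) ^+ 3))).
  apply: Ex_le => m mU; rewrite expr2 big_distrlr /= mulr_sumr -big_split /=.
  apply: ler_sum => i _.
  have H : \sum_j w i * w j * (F i m * (j \in comp m i)%:R * F j m) <=
      t%:R ^+ 2 * (w i * mass w (comp m i) ^+ 3).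
    rewrite (eq_bigr (fun j => if j \in comp m i then w i * w j * (F i m * F j m) else 0)).
      rewrite -big_mkcond /=.
      apply: le_trans (_ : _ <= \sum_(j in comp m i)
          w i * (t%:R * mass w (comp m i)) ^+ 2 * w j) _; last first.
        rewrite -mulr_sumr -/(mass w (comp m i)) le_eqVlt; apply/orP; left; apply/eqP; ring.
      apply: ler_sum => j jc; rewrite [leRHS]mulrAC; apply: ler_wpM2l; first by rewrite mulr_ge0.
      rewrite expr2.
      apply: ler_pM; rewrite ?dist_weight_ge0 //; first exact: dist_weight_le_mass.
      rewrite -(comp_eq mU jc); exact: dist_weight_le_mass.
    by move=> j _; case: ifP => jc; rewrite ?mulr1 // mulr0 mul0r mulr0.
  rewrite -/(F i m) -lerBlDl; apply: le_trans H; rewrite -sumrB; apply: ler_sum => j _.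
  rewrite -/(F j m) le_eqVlt; apply/orP; left; apply/eqP.
  by case: (j \in comp m i) => /=; ring.
rewrite ExD ExZl lerD //; last first.
  apply: ler_wpM2l; first exact: sqr_ge0.
  by rewrite Ex_sum; apply: ler_sum => i _; rewrite ExZl; apply: ler_wpM2l => //; apply: b3P.
have c0 : 0 <= V * L / (q - (2 * t)%:R) ^+ 2.
  by rewrite divr_ge0 ?sqr_ge0 // mulr_ge0 // sumr_ge0 // => x _; apply: deg_ge0.
have -> : V * (V * L / (q - (2 * t)%:R) ^+ 2) =
    \sum_i w i * (deg i * (V * L / (q - (2 * t)%:R) ^+ 2)).
  by rewrite {1}/V mulr_suml; apply: eq_bigr => i _; ring.
rewrite expr2; apply: (@Ex_two_roots _ _ _ _ q) => //.
- by move=> i m; apply: dist_weight_ge0.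
- by move=> i; apply: dist_weight_local.
- by move=> i; apply: dist_weight_local.
- move=> i; apply: (@Ex_dist_weight_le setT set0); rewrite ?cardsT ?inE //.
  + by apply: eq_card0 => h; rewrite !inE.
  + by move: qT q0; lra.
- by move=> i; rewrite mulr_ge0 // deg_ge0.
- move=> U X j fU eU a0 qX jX; apply: (@Ex_dist_weight_le U X) => //.
  by move: qX q0; lra.
Qed.

End Distance.

Section Far.
Import mathcomp.boot.fintype mathcomp.boot.finset.
Local Open Scope set_scope.
Local Open Scope ring_scope.

Variables (n : nat) (d : n.-tuple nat) (R : realType).
Local Notation deg := (deg (@owner n d) R).

(** A vertex at distance more than l extends a simple path of length l, so the
    path bound for the constant weight 1 applies. *)
Lemma Ex_far_le (i : 'I_n) s : ~~ odd #|half_edge d| ->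
  (2 * s.+1)%:R < theta (@owner n d) R set0 ->
  Ex [set: half_edge d] (fun m =>
     [exists k in comp (@owner n d) m i, (s.+1 < graph_dist m i k)%N]%:R) <=
  deg i * ((\sum_x deg x) / ((\sum_x deg x) - (2 * s.+1)%:R) *
    ((\sum_x deg x * (deg x - 1)) / ((\sum_x deg x) - (2 * s.+1)%:R)) ^+ s).
Proof.
move=> eT sT; pose w1 (x : 'I_n) : R := 1.
have w0 x : 0 <= w1 x by [].
have := Ex_path_root w0 i eT sT (ltnSn s).
rewrite [X in _ <= _ * (X / _ * _) -> _](eq_bigr deg) => [|x _]; last by rewrite mulr1.
apply: le_trans; apply: Ex_le => m _.
apply: le_trans (path_weight_ge (@owner n d) w0 m s.+1 i [set i]).
case: exists_inP => [[k kc lk]|_]; last by apply: sumr_ge0 => x _; rewrite mulr_ge0.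
have [k' pk' _] := dist_avoiding kc (ltnW lk).
rewrite (bigD1 k') //= pk' mulr1 lerDl; apply: sumr_ge0 => x _; by rewrite mulr_ge0.
Qed.

End Far.

(** * Sums over components *)

Section Link.
Import mathcomp.boot.fintype mathcomp.boot.finset.
Local Open Scope set_scope.
Local Open Scope ring_scope.

Variables (n : nat) (d : n.-tuple nat) (R : realType).
Implicit Types (m : {ffun half_edge d -> half_edge d}).

Lemma pairings_matchings : pairings d = matchings [set: half_edge d].
Proof.
apply/setP=> m; rewrite [LHS]inE; apply/forallP/matchingsP => [H|[H _] h].
  by split=> h; rewrite !inE // => _; case/andP: (H h) => ? /eqP; split; rewrite ?inE.
by have [_ -> ->] := H h (in_setT _); rewrite eqxx.
Qed.

Definition Expect (f : {ffun half_edge d -> half_edge d} -> R) : R :=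
  Ex [set: half_edge d] f.

Lemma CM_probE (A : pred {ffun half_edge d -> half_edge d}) :
  CM_prob R A = Expect (fun m => (A m)%:R).
Proof.
rewrite /CM_prob /Expect /Ex pairings_matchings; congr (_ / _).
rewrite -sum1_card natr_sum big_mkcond [RHS]big_mkcond /=; apply: eq_bigr => m _.
by rewrite inE; case: (m \in _); case: (A m).
Qed.

Lemma dg_owner i : dg (@owner n d) i = tnth d i.
Proof.
pose f (x : 'I_(tnth d i)) : half_edge d := Tagged (fun i => 'I_(tnth d i)) x.
have f_inj : injective f by move=> x y /eqP; rewrite eq_Tagged /= => /eqP.
rewrite -[RHS]card_ord -cardsT -(card_imset _ f_inj) /dg; apply: eq_card => -[k x].
rewrite inE /owner /=; apply/eqP/imsetP => [ki|[y _ /(congr1 tag)]] //.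
by subst k; exists x; rewrite ?inE.
Qed.

Lemma component_comp m i : component m i = comp (@owner n d) m i.
Proof. by []. Qed.

Section Weights.
Variables (m : {ffun half_edge d -> half_edge d}) (w : 'I_n -> R).
Hypothesis mP : m \in matchings [set: half_edge d].

(** Every vertex lies in exactly one component labelled by its least element. *)
Lemma sum_min_component (f : 'I_n -> R) :
  \sum_i \sum_(k in min_component m i) f k = \sum_k f k.
Proof.
rewrite (eq_bigr (fun i => \sum_k if k \in min_component m i then f k else 0)); last first.
  by move=> i _; rewrite big_mkcond.
rewrite exchange_big /=; apply: eq_bigr => k _.
have kk : k \in comp (@owner n d) m k by apply: mem_comp.
case: (arg_minnP (fun i : 'I_n => val i) kk) => r rk rmin.
have cr := comp_eq mP rk.
have Hr : min_component m r = comp (@owner n d) m k.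
  rewrite /min_component component_comp cr; case: ifP => // /negP[].
  by apply/forall_inP => x /rmin.
rewrite (bigD1 r) //= Hr kk big1 ?addr0 // => i ir.
case: ifP => //; rewrite /min_component; case: ifP => [/forall_inP imin|_]; last by rewrite in_set0.
rewrite component_comp => ki.
have ci := comp_eq mP ki.
have le1 : (i <= r)%N by apply: imin; rewrite component_comp -ci; apply: rk.
have le2 : (r <= i)%N by apply: (rmin i); have := mem_comp (@owner n d) m i; rewrite -ci.
by move: ir; rewrite -val_eqE /= eqn_leq le1 le2.
Qed.

Lemma sum_comp_weight (g : {set 'I_n} -> R) :
  \sum_i comp_weight m w i * g (min_component m i) =
  \sum_k w k * g (comp (@owner n d) m k).
Proof.
rewrite -(sum_min_component (fun k => w k * g (comp _ m k))); apply: eq_bigr => i _.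
rewrite mulr_suml; apply: eq_bigr => k kc; congr (_ * g _).
move: kc; rewrite /min_component; case: ifP => _; last by rewrite in_set0.
by rewrite component_comp => kc; rewrite (comp_eq mP kc).
Qed.

Lemma s_starE r : s_star m w r.+1 =
  n%:R^-1 * \sum_k w k * mass w (comp (@owner n d) m k) ^+ r.
Proof.
rewrite /s_star -(sum_comp_weight (fun X => mass w X ^+ r)); congr (_ * _).
by apply: eq_bigr => i _; rewrite exprS.
Qed.

Lemma spr_starE : spr_star m w =
  n%:R^-1 * \sum_k w k * #|comp (@owner n d) m k|%:R.
Proof. by rewrite /spr_star -(sum_comp_weight (fun X => #|X|%:R)). Qed.

End Weights.
End Link.

(** * Convergence in probability *)

Section InProbability.
Local Open Scope classical_set_scope.
Local Open Scope ring_scope.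
Variables (R : realType) (d : forall n, n.-tuple nat).
Hypothesis even_d : forall n, ~~ odd #|[set: half_edge (d n)]%SET|.

Local Notation "{ 'obs' }" := (forall n, {ffun half_edge (d n) -> half_edge (d n)} -> R).
Local Notation E X := (fun n => Expect (X n)).
Local Notation Pr A := (fun n => Expect (fun m => (A n m)%:R : R)).

Implicit Types (X Y : forall n, {ffun half_edge (d n) -> half_edge (d n)} -> R).

Lemma cvg0_le (u v : R^nat) : (\forall n \near \oo, 0 <= u n <= v n) ->
  v @ \oo --> 0 -> u @ \oo --> 0.
Proof. by move=> uv; apply: (squeeze_cvgr uv (cvg_cst _)). Qed.

Lemma cvg0D (u v : R^nat) : u @ \oo --> 0 -> v @ \oo --> 0 ->
  (fun n => u n + v n) @ \oo --> (0 : R).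
Proof. by move=> u0 v0; rewrite -[0]addr0; apply: cvgD. Qed.

Lemma CM_cvgP X (l : R) : CM_cvg_in_prob X l <->
  (forall eps, 0 < eps -> Pr (fun n m => eps < `|X n m - l|) @ \oo --> (0 : R)).
Proof.
have e eps : (fun n => CM_prob R (fun m => eps < `|X n m - l|)) =
    Pr (fun n m => eps < `|X n m - l|) by apply/funext => n; apply: CM_probE.
by split=> H eps e0; have := H eps e0; rewrite /CM_cvg_in_prob e.
Qed.

Lemma Expect_prob_ge0 n (A : pred {ffun half_edge (d n) -> half_edge (d n)}) :
  0 <= Expect (fun m => (A m)%:R : R).
Proof. by apply: Ex_ge0 => m _; rewrite ler0n. Qed.

Lemma Expect_union n (A B C : pred {ffun half_edge (d n) -> half_edge (d n)}) :
  (forall m, m \in matchings [set: half_edge (d n)]%SET -> A m -> B m || C m) ->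
  Expect (fun m => (A m)%:R : R) <= Expect (fun m => (B m)%:R) + Expect (fun m => (C m)%:R).
Proof.
move=> H; rewrite /Expect -ExD; apply: Ex_le => m mU.
case: (A m) (H m mU) => [/(_ isT)|_]; last by rewrite addr_ge0 ?ler0n.
by case: (B m); case: (C m) => //= _; rewrite ?addr0 ?add0r ?lerDl.
Qed.

(** E (X - l)^2 <= E X^2 - 2 l E X + l^2, so only a lower bound on the mean is
    needed besides the upper bound on the second moment. *)
Lemma cvg_second_moment X (l : R) (lo up : R^nat) : 0 <= l ->
  (\forall n \near \oo, lo n <= Expect (X n)) ->
  (\forall n \near \oo, Expect (fun m => X n m ^+ 2) <= up n) ->
  lo @ \oo --> l -> up @ \oo --> l ^+ 2 -> CM_cvg_in_prob X l.
Proof.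
move=> l0 Hlo Hup lol upl; apply/CM_cvgP => eps e0.
have vl : (fun n => (up n - 2 * l * lo n + l ^+ 2) / eps ^+ 2) @ \oo --> (0 : R).
  have -> : 0 = (l ^+ 2 - 2 * l * l + l ^+ 2) / eps ^+ 2 :> R.
    by rewrite [X in X / _](_ : _ = 0) ?mul0r //; ring.
  apply: cvgMl; apply: cvgD; last exact: cvg_cst.
  by apply: cvgB => //; apply: cvgMr.
apply: cvg0_le vl; near=> n; rewrite Expect_prob_ge0 /=.
rewrite ler_pdivlMr ?exprn_gt0 // /Expect -ExZr.
apply: le_trans (_ : _ <= Ex [set: half_edge (d n)]%SET
    (fun m => X n m ^+ 2 + (- (2 * l)) * X n m + l ^+ 2)) _.
  apply: Ex_le => m _; case: ltP => [h|_] /=; last first.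
    by rewrite mul0r; have := sqr_ge0 (X n m - l); rewrite sqrrB; lra.
  rewrite mul1r; have -> : X n m ^+ 2 + - (2 * l) * X n m + l ^+ 2 = `|X n m - l| ^+ 2.
    by rewrite real_normK ?num_real //; ring.
  by rewrite lerXn2r ?nnegrE // ltW.
rewrite ExD ExD ExZl Ex_cst ?even_d //.
have h1 : Ex [set: half_edge (d n)]%SET (fun m => X n m ^+ 2) <= up n by near: n.
have h2 : 2 * l * lo n <= 2 * l * Ex [set: half_edge (d n)]%SET (X n).
  by rewrite ler_wpM2l ?mulr_ge0 //; near: n.
lra.
Unshelve. all: by end_near. Qed.

Definition lower_in_prob X (l : R) :=
  forall eps, 0 < eps -> Pr (fun n m => X n m < l - eps) @ \oo --> (0 : R).

Lemma cvg_lower_in_prob X (l : R) : CM_cvg_in_prob X l -> lower_in_prob X l.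
Proof.
move=> /CM_cvgP H eps e0; apply: cvg0_le (H eps e0); near=> n.
rewrite Expect_prob_ge0 /=; apply: Ex_le => m _; rewrite ler_nat.
case: ltP => //= h; rewrite lt0b ltr_normr; apply/orP; right; lra.
Unshelve. all: by end_near. Qed.

Lemma lower_in_probD X Y (a b : R) : lower_in_prob X a -> lower_in_prob Y b ->
  lower_in_prob (fun n m => X n m + Y n m) (a + b).
Proof.
move=> HX HY eps e0; have e2 : 0 < eps / 2 by rewrite divr_gt0.
apply: cvg0_le (cvg0D (HX _ e2) (HY _ e2)); near=> n.
rewrite Expect_prob_ge0 /=; apply: Expect_union => m _ h.
by case: ltP => //= h1; rewrite ltNge; apply/negP => h2; move: h h1 h2; lra.
Unshelve. all: by end_near. Qed.

Lemma lower_in_prob_le X Y (l : R) :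
  (\forall n \near \oo, forall m, m \in matchings [set: half_edge (d n)]%SET -> X n m <= Y n m) ->
  lower_in_prob X l -> lower_in_prob Y l.
Proof.
move=> XY H eps e0; apply: cvg0_le (H _ e0); near=> n.
rewrite Expect_prob_ge0 /=; apply: Ex_le => m mU; rewrite ler_nat.
have : X n m <= Y n m by move: m mU; near: n.
by case: (ltP (Y n m)) => //= h1 h2; rewrite (le_lt_trans h2 h1).
Unshelve. all: by end_near. Qed.

Lemma lower_in_prob_sup X (a : R^nat) (l : R) : a @ \oo --> l ->
  (forall N, lower_in_prob X (a N)) -> lower_in_prob X l.
Proof.
move=> al HX eps e0; have e2 : 0 < eps / 2 by rewrite divr_gt0.
have [N _ /(_ N (leqnn N)) HN] : \forall n \near \oo, l - eps / 2 < a n.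
  by apply: (cvgr_gt l al); rewrite ltrBlDr ltrDl.
apply: cvg0_le (HX N _ e2); near=> n.
rewrite Expect_prob_ge0 /=; apply: Ex_le => m _; rewrite ler_nat.
by case: (ltP (X n m) (l - eps)) => //= h; rewrite lt0b; move: HN h => /=; lra.
Unshelve. all: by end_near. Qed.

Lemma lower_in_prob_cst (l : R) : lower_in_prob (fun _ _ => l) l.
Proof.
move=> eps e0; apply: (@cvg0_le _ (fun=> 0)); [|exact: cvg_cst]; near=> n; rewrite Expect_prob_ge0 /=.
rewrite /Expect -[leRHS](Ex_cst _ (even_d n)); apply: Ex_le => m _.
by rewrite ltrBrDr gtrDl ltNge (ltW e0) lexx.
Unshelve. all: by end_near. Qed.

Lemma lower_in_prob_cube X (l : R) : 0 <= l -> (forall n m, 0 <= X n m) ->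
  lower_in_prob X l -> lower_in_prob (fun n m => X n m ^+ 3) (l ^+ 3).
Proof.
move=> l0 X0 H eps e0; pose de := eps / (3 * l ^+ 2 + 1).
have p0 : 0 < 3 * l ^+ 2 + 1 by rewrite ltr_wpDl // mulr_ge0 ?sqr_ge0.
have de0 : 0 < de by rewrite divr_gt0.
apply: cvg0_le (H _ de0); near=> n; rewrite Expect_prob_ge0 /=.
apply: Ex_le => m _; rewrite ler_nat; case: (ltP (X n m)) => [|h]; first by rewrite leq_b1.
rewrite leqn0 eqb0 -leNgt; move: (X n m) (X0 n m) h => x x0 h.
have ed : eps = de * (3 * l ^+ 2 + 1) by rewrite divfK // gt_eqF.
case: (leP l de) => lde.
  apply: le_trans (_ : _ <= 0) _; last exact: exprn_ge0.
  rewrite ed subr_le0; apply: le_trans (_ : _ <= de * (3 * l ^+ 2)) _; last by rewrite ler_wpM2l ?lerDl // ltW.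
  rewrite exprS; apply: ler_pM; rewrite ?sqr_ge0 //.
  by rewrite ler_peMl ?sqr_ge0 // ler1n.
apply: le_trans (_ : _ <= (l - de) ^+ 3) _; last by rewrite lerXn2r ?nnegrE // subr_ge0 ltW.
rewrite ed; have : 0 <= de ^+ 2 * (3 * l - de) by rewrite mulr_ge0 ?sqr_ge0 //; lra.
lra.
Unshelve. all: by end_near. Qed.

(** A nonnegative variable that is rarely below l and has mean close to l cannot
    exceed l by much with a positive probability. *)
Lemma cvg_mean_lower X (l : R) (up : R^nat) : (forall n m, 0 <= X n m) ->
  (\forall n \near \oo, Expect (X n) <= up n) -> up @ \oo --> l ->
  lower_in_prob X l -> CM_cvg_in_prob X l.
Proof.
move=> X0 Hup upl lowl; apply/CM_cvgP => eps e0.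
suff hi : Pr (fun n m => l + eps < X n m) @ \oo --> (0 : R).
  apply: cvg0_le (cvg0D (lowl _ e0) hi); near=> n.
  rewrite Expect_prob_ge0 /=; apply: Expect_union => m _.
  rewrite ltr_normr => /orP[h|h]; apply/orP; [right|left]; lra.
apply/cvgrPdist_le => e1 e10; pose de := eps * e1 / 2.
have de0 : 0 < de by rewrite divr_gt0 // mulr_gt0.
pose pA n := Expect (fun m => (X n m < l - de)%R%:R : R) : R.
have bnd : (fun n => (up n - (l - de) * (1 - pA n)) / eps) @ \oo --> (l - (l - de) * (1 - 0)) / eps.
  apply: cvgMl; apply: cvgB => //; apply: cvgMr; apply: cvgB; [exact: cvg_cst|exact: lowl].
have lt1 : (l - (l - de) * (1 - 0)) / eps < e1.
  by rewrite ltr_pdivrMr // /de; have := mulr_gt0 e0 e10; lra.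
near=> n; rewrite sub0r normrN ger0_norm ?Expect_prob_ge0 //.
apply: le_trans (_ : _ <= (up n - (l - de) * (1 - pA n)) / eps) _; last first.
  by apply: ltW; near: n; apply: (cvgr_lt _ bnd).
rewrite ler_pdivlMr // lerBrDr.
apply: le_trans (_ : _ <= Expect (X n)) _; last by near: n.
have -> : (l - de) * (1 - pA n) =
    Expect (fun m => (l - de) * (1 - (X n m < l - de)%R%:R)).
  by rewrite /Expect ExZl ExD ExN Ex_cst.
rewrite /Expect -ExZr -ExD.
apply: Ex_le => m _; have x0 := X0 n m; move: (X n m) x0 => x x0.
move: (de) de0 e0 => D D0 ep0.
case: (ltP x) => h1; case: (ltP (l + eps)) => h2 /=; lra.
Unshelve. all: by end_near. Qed.

Lemma cvg_in_prob_near X Y (l : R) : CM_cvg_in_prob X l ->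
  Pr (fun n m => X n m != Y n m) @ \oo --> (0 : R) -> CM_cvg_in_prob Y l.
Proof.
move=> /CM_cvgP HX HXY; apply/CM_cvgP => eps e0.
apply: cvg0_le (cvg0D (HX _ e0) HXY); near=> n.
rewrite Expect_prob_ge0 /=; apply: Expect_union => m _.
by case: (eqVneq (X n m) (Y n m)) => [->|_]; rewrite ?orbT ?orbF.
Unshelve. all: by end_near. Qed.

Lemma cvg_in_prob_ext X Y (l : R) : CM_cvg_in_prob X l ->
  (\forall n \near \oo, forall m, m \in matchings [set: half_edge (d n)]%SET -> X n m = Y n m) ->
  CM_cvg_in_prob Y l.
Proof.
move=> HX XY; apply: cvg_in_prob_near HX _; apply: (@cvg0_le _ (fun=> 0)); [|exact: cvg_cst]; near=> n.
rewrite Expect_prob_ge0 /=.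
rewrite /Expect -[leRHS](Ex_cst _ (even_d n)); apply: Ex_le => m mU.
have -> : X n m = Y n m by move: m mU; near: n.
by rewrite eqxx.
Unshelve. all: by end_near. Qed.

Lemma cvg_in_probD X Y (a b : R) : CM_cvg_in_prob X a -> CM_cvg_in_prob Y b ->
  CM_cvg_in_prob (fun n m => X n m + Y n m) (a + b).
Proof.
move=> /CM_cvgP HX /CM_cvgP HY; apply/CM_cvgP => eps e0.
have e2 : 0 < eps / 2 by rewrite divr_gt0.
apply: cvg0_le (cvg0D (HX _ e2) (HY _ e2)); near=> n.
rewrite Expect_prob_ge0 /=; apply: Expect_union => m _ h.
case: ltP => //= h1; rewrite ltNge; apply/negP => h2.
have : `|X n m + Y n m - (a + b)| <= `|X n m - a| + `|Y n m - b|.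
  by rewrite opprD addrACA ler_normD.
lra.
Unshelve. all: by end_near. Qed.

Lemma cvg_in_probZ X (a c : R) : CM_cvg_in_prob X a ->
  CM_cvg_in_prob (fun n m => c * X n m) (c * a).
Proof.
move=> /CM_cvgP HX; apply/CM_cvgP => eps e0.
have c0 : 0 < `|c| + 1 by rewrite ltr_wpDl.
have e2 : 0 < eps / (`|c| + 1) by rewrite divr_gt0.
apply: cvg0_le (HX _ e2); near=> n; rewrite Expect_prob_ge0 /=.
apply: Ex_le => m _; rewrite ler_nat; case: (ltP eps) => //= h; rewrite lt0b.
rewrite ltr_pdivrMr //; apply: lt_le_trans h _.
by rewrite -mulrBr normrM mulrC ler_wpM2l // lerDl.
Unshelve. all: by end_near. Qed.

End InProbability.

Arguments cvg_in_probZ {R d X a} c.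

(** * Orders of magnitude of sequences *)

Section Orders.
Local Open Scope classical_set_scope.
Local Open Scope ring_scope.
Variable R : realType.
Implicit Types (u v : R^nat) (e f l k : R).

Local Notation pw n e := (n%:R `^ e : R).

(** u = O(n^e) *)
Definition order_le u e := exists C : R, 0 <= C /\ \forall n \near \oo, `|u n| <= C * pw n e.

(** u is equivalent to l n^e, or o(n^e) if l = 0. *)
Definition tends u e l := (fun n => pw n (- e) * u n) @ \oo --> l.

Lemma cvg_near u v (l : R) : (\forall n \near \oo, u n = v n) ->
  u @ \oo --> l -> v @ \oo --> l.
Proof.
move=> uv ul; apply: cvg_trans ul; apply: near_eq_cvg.
by apply: filterS uv => n ->.
Qed.

Lemma near_pos : \forall n \near \oo, (0 < n)%N.
Proof. by near=> n; near: n; exists 1%N. Unshelve. all: by end_near. Qed.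

Lemma pw_gt0 n e : (0 < n)%N -> 0 < pw n e.
Proof. by move=> n0; rewrite powR_gt0 // ltr0n. Qed.

Lemma pwD n e f : (0 < n)%N -> pw n (e + f) = pw n e * pw n f.
Proof. by move=> n0; rewrite powRD // pnatr_eq0 -lt0n n0 implybT. Qed.

Lemma pwNK n e : (0 < n)%N -> pw n (- e) * pw n e = 1.
Proof. by move=> n0; rewrite -pwD // addNr powRr0. Qed.

Lemma pw_le n e f : (0 < n)%N -> e <= f -> pw n e <= pw n f.
Proof. by move=> n0 ef; rewrite ler_powR // ler1n. Qed.

Lemma pw_large e (M : R) : 0 < e -> \forall n \near \oo, M <= pw n e.
Proof.
move=> e0; pose M' := Num.max M 1; have M0 : 0 < M' by rewrite lt_max ltr01 orbT.
near=> n; apply: le_trans (_ : _ <= M') _; first by rewrite le_max lexx.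
have -> : M' = (M' `^ e^-1) `^ e by rewrite -powRrM mulVf ?gt_eqF // powRr1 // ltW.
apply: ge0_ler_powR; rewrite ?nnegrE ?powR_ge0 ?ler0n //; first exact: ltW.
near: n; exact: nbhs_infty_ger.
Unshelve. all: by end_near. Qed.

Lemma pw_cvg0 e : e < 0 -> (fun n => pw n e) @ \oo --> (0 : R).
Proof.
move=> e0; apply/cvgrPdist_le => eps eps0; near=> n.
have n0 : (0 < n)%N by near: n; exact: near_pos.
rewrite sub0r normrN ger0_norm ?powR_ge0 // -[e]opprK powRN.
rewrite -[eps]invrK lef_pV2 ?posrE ?invr_gt0 ?pw_gt0 //.
near: n; apply: pw_large; lra.
Unshelve. all: by end_near. Qed.

Lemma order_le_add u v e : order_le u e -> order_le v e -> order_le (fun n => u n + v n) e.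
Proof.
move=> [C [C0 Cu]] [D [D0 Dv]]; exists (C + D); split; first exact: addr_ge0.
near=> n; rewrite mulrDl; apply: le_trans (ler_normD _ _) _; apply: lerD; near: n; done.
Unshelve. all: by end_near. Qed.

Lemma order_le_mul u v e f : order_le u e -> order_le v f ->
  order_le (fun n => u n * v n) (e + f).
Proof.
move=> [C [C0 Cu]] [D [D0 Dv]]; exists (C * D); split; first exact: mulr_ge0.
near=> n; have n0 : (0 < n)%N by near: n; exact: near_pos.
rewrite pwD // mulrACA normrM; apply: ler_pM => //; near: n; done.
Unshelve. all: by end_near. Qed.

Lemma order_le_weaken u e f : e <= f -> order_le u e -> order_le u f.
Proof.
move=> ef [C [C0 Cu]]; exists C; split => //; near=> n.
have n0 : (0 < n)%N by near: n; exact: near_pos.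
apply: le_trans (_ : _ <= C * pw n e) _; first by near: n.
by rewrite ler_wpM2l // pw_le.
Unshelve. all: by end_near. Qed.

Lemma order_le_cst (c : R) : order_le (fun=> c) 0.
Proof.
exists `|c|; split; first exact: normr_ge0.
by near=> n; rewrite powRr0 mulr1.
Unshelve. all: by end_near. Qed.

Lemma order_le_dom u v e : (\forall n \near \oo, `|u n| <= `|v n|) ->
  order_le v e -> order_le u e.
Proof.
move=> uv [C [C0 Cv]]; exists C; split => //; near=> n.
by apply: le_trans (_ : _ <= `|v n|) _; near: n.
Unshelve. all: by end_near. Qed.

Lemma order_le_ext u v e : u =1 v -> order_le v e -> order_le u e.
Proof. by move=> uv; apply: order_le_dom; near=> n; rewrite uv. Unshelve. all: by end_near. Qed.

Lemma order_le_pos u v e : (\forall n \near \oo, 0 <= u n <= v n) ->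
  order_le v e -> order_le u e.
Proof.
move=> uv; apply: order_le_dom; apply: filterS uv => n /andP[u0 uvn].
by rewrite !ger0_norm // (le_trans u0).
Qed.

Lemma order_le_mulc u e (c : R) : order_le u e -> order_le (fun n => c * u n) e.
Proof. by move=> H; rewrite -[e]add0r; apply: order_le_mul => //; apply: order_le_cst. Qed.

Lemma order_le_pw e : order_le (fun n => pw n e) e.
Proof.
exists 1; split => //; near=> n; by rewrite mul1r ger0_norm // powR_ge0.
Unshelve. all: by end_near. Qed.

Lemma tends_cst (c : R) : tends (fun=> c) 0 c.
Proof.
rewrite /tends; apply: (@cvg_near (fun=> c)); last exact: cvg_cst.
near=> n; by rewrite oppr0 powRr0 mul1r.
Unshelve. all: by end_near. Qed.

Arguments tends_cst c : clear implicits.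

Lemma tends_near u v e l : (\forall n \near \oo, u n = v n) -> tends u e l -> tends v e l.
Proof.
move=> uv; apply: cvg_near; near=> n; congr (_ * _).
by near: n.
Unshelve. all: by end_near. Qed.

Lemma tends_exp u e f l : e = f -> tends u e l -> tends u f l.
Proof. by move=> ->. Qed.

Lemma tendsD u v e l k : tends u e l -> tends v e k -> tends (fun n => u n + v n) e (l + k).
Proof.
rewrite /tends => ul vk; under eq_fun do rewrite mulrDr; exact: cvgD.
Qed.

Lemma tendsM u v e f l k : tends u e l -> tends v f k ->
  tends (fun n => u n * v n) (e + f) (l * k).
Proof.
rewrite /tends => ul vk; apply: (cvg_near _ (cvgM ul vk)); near=> n.
have n0 : (0 < n)%N by near: n; exact: near_pos.
by rewrite /= opprD pwD //; rewrite [LHS]mulrACA.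
Unshelve. all: by end_near. Qed.

Lemma tendsZ u e l (c : R) : tends u e l -> tends (fun n => c * u n) e (c * l).
Proof. by move=> ul; apply: (tends_exp _ (tendsM (tends_cst c) ul)); rewrite add0r. Qed.

Arguments tendsZ {u e l} c.

Lemma tendsN u e l : tends u e l -> tends (fun n => - u n) e (- l).
Proof.
move=> /(tendsZ (-1)); rewrite mulN1r; apply: tends_near.
by near=> n; rewrite mulN1r.
Unshelve. all: by end_near. Qed.

Lemma tendsB u v e l k : tends u e l -> tends v e k -> tends (fun n => u n - v n) e (l - k).
Proof. by move=> ul vk; apply: tendsD => //; apply: tendsN. Qed.

Lemma tendsX u e l (p : nat) : tends u e l -> tends (fun n => u n ^+ p) (p%:R * e) (l ^+ p).
Proof.
move=> ul; elim: p => [|p IH].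
  by rewrite mul0r; apply: (tends_near _ (tends_cst _)); near=> n.
rewrite exprS; apply: (tends_exp (e := e + p%:R * e)); first by rewrite -addn1 natrD; ring.
by apply: (tends_near _ (tendsM ul IH)); near=> n; rewrite exprS.
Unshelve. all: by end_near. Qed.

Arguments tendsX {u e l} p.

Lemma tendsV u e l : l != 0 -> tends u e l -> tends (fun n => (u n)^-1) (- e) l^-1.
Proof.
rewrite /tends => l0 ul; apply: (cvg_near _ (cvgV l0 ul)); near=> n.
by rewrite opprK /= invfM powRN invrK.
Unshelve. all: by end_near. Qed.

Lemma tends_order u e l : tends u e l -> order_le u e.
Proof.
move=> ul; exists (`|l| + 1); split; first by rewrite addr_ge0.
have l1 : `|l| < `|l| + 1 by rewrite ltrDl.
near=> n; have n0 : (0 < n)%N by near: n; exact: near_pos.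
have : `|pw n (- e) * u n| <= `|l| + 1 by near: n; exact: (cvgr_norm_le l ul _ l1).
rewrite normrM ger0_norm ?powR_ge0 // => H.
by have := ler_wpM2r (powR_ge0 n%:R e) H; rewrite mulrAC pwNK // mul1r.
Unshelve. all: by end_near. Qed.

Lemma order_le_tends0 u e f : order_le u e -> e < f -> tends u f 0.
Proof.
move=> [C [C0 Cu]] ef; apply/cvgr0Pnorm_le => eps eps0.
have ef0 : e - f < 0 by lra.
have : (fun n => C * pw n (e - f)) @ \oo --> (0 : R).
  by rewrite -[X in _ --> X](mulr0 C); apply: cvgMr; apply: pw_cvg0.
move/cvgr0Pnorm_le/(_ _ eps0) => H.
near=> n; have n0 : (0 < n)%N by near: n; exact: near_pos.
have Cn : `|u n| <= C * pw n e by near: n.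
apply: le_trans (_ : _ <= C * pw n (e - f)) _; last first.
  by apply: le_trans (ler_norm _) _; near: n.
rewrite normrM ger0_norm ?powR_ge0 // addrC pwD // mulrCA ler_wpM2l ?powR_ge0 //.
Unshelve. all: by end_near. Qed.

Lemma tends_drop u v e f l : tends u f l -> order_le v e -> e < f ->
  tends (fun n => u n + v n) f l.
Proof. by move=> ul vO ef; rewrite -[l]addr0; apply: tendsD => //; apply: order_le_tends0 ef. Qed.

Lemma tends_dropB u v e f l : tends u f l -> order_le v e -> e < f ->
  tends (fun n => u n - v n) f l.
Proof. by move=> ul vO ef; rewrite -[l]subr0; apply: tendsB => //; apply: order_le_tends0 ef. Qed.

Lemma tends_near_gt u e l (c : R) : c < l -> tends u e l ->
  \forall n \near \oo, c * pw n e < u n.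
Proof.
move=> cl ul; near=> n; have n0 : (0 < n)%N by near: n; exact: near_pos.
have : c < pw n (- e) * u n by near: n; exact: (cvgr_gt l ul _ cl).
by rewrite powRN mulrC ltr_pdivlMr // pw_gt0.
Unshelve. all: by end_near. Qed.

Lemma tends_pos u e l : 0 < l -> tends u e l -> \forall n \near \oo, 0 < u n.
Proof. by move=> l0 /(tends_near_gt l0); apply: filterS => n; rewrite mul0r. Qed.

Lemma tends_ge0 u e l : (\forall n \near \oo, 0 <= u n) -> tends u e l -> 0 <= l.
Proof.
move=> u0 ul; rewrite leNgt; apply/negP => l0.
have H : \forall n \near \oo, pw n (- e) * u n < 0 by exact: (cvgr_lt l ul _ l0).
have [n [un lt]] : exists n, 0 <= u n /\ pw n (- e) * u n < 0.
  have [n _ Hn] := filterI u0 H; exists n; exact: (Hn n (leqnn n)).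
by move: lt; rewrite ltNge mulr_ge0 // powR_ge0.
Qed.

Lemma order_le_inv u e l : l != 0 -> tends u e l -> order_le (fun n => (u n)^-1) (- e).
Proof. by move=> l0 ul; apply: tends_order (tendsV l0 ul). Qed.

End Orders.

Arguments tends_cst {R} c.
Arguments tendsZ {R u e l} c.
Arguments tendsX {R u e l} p.

(** * Asymptotics of the functionals *)

Section Scaled.
Local Open Scope classical_set_scope.
Local Open Scope ring_scope.
Variables (R : realType) (d : forall n, n.-tuple nat).
Hypothesis even_d : forall n, ~~ odd #|[set: half_edge (d n)]%SET|.

Lemma second_moment_scaled (Y : forall n, {ffun half_edge (d n) -> half_edge (d n)} -> R)
    (e l : R) (lo up : R^nat) : 0 <= l ->
  (\forall n \near \oo, lo n <= Expect (Y n)) ->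
  (\forall n \near \oo, Expect (fun m => Y n m ^+ 2) <= up n) ->
  tends lo e l -> tends up (2 * e) (l ^+ 2) ->
  CM_cvg_in_prob (fun n m => n%:R `^ (- e) * Y n m) l.
Proof.
move=> l0 Hlo Hup lol upl; apply: (cvg_second_moment even_d l0 _ _ lol upl).
- by apply: filterS Hlo => n H; rewrite /Expect ExZl ler_wpM2l // powR_ge0.
- near=> n; have n0 : (0 < n)%N by near: n; exact: near_pos.
  rewrite (_ : - (2 * e) = - e + - e); last by ring.
  rewrite pwD // /Expect (Ex_eq (g := fun m => (n%:R `^ (- e) * n%:R `^ (- e)) * Y n m ^+ 2)).
    by rewrite ExZl ler_wpM2l ?mulr_ge0 ?powR_ge0 //; near: n.
  by move=> m _; rewrite exprMn expr2.
Unshelve. all: by end_near. Qed.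

End Scaled.

Section Sequences.
Local Open Scope classical_set_scope.
Local Open Scope ring_scope.
Variables (R : realType) (d : forall n, n.-tuple nat).
(* alpha, delta, the limiting mean degree, lambda0 and the sum of the c_i^3 *)
Variables (al de mu_d la c3 : R).
Hypotheses (al3 : 1 < 3 * al) (al2 : 2 * al < 1) (de0 : 0 < de) (de1 : de < 1 - 2 * al).
Hypotheses (mu_d0 : 0 < mu_d) (la0 : 0 < la).
Hypothesis even_d : forall n, ~~ odd #|half_edge (d n)|.

Definition dgr n (i : 'I_n) : R := deg (@owner n (d n)) R i.
Definition ell n : R := \sum_(i < n) dgr i.
(** This is (1 - nu) times the sum of the degrees. *)
Definition gap n : R := theta (@owner n (d n)) R finset.set0.
Definition cube n : R := \sum_(i < n) dgr i ^+ 3.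
Variable dm : R^nat.
Hypotheses (dmP : forall n (i : 'I_n), dgr i <= dm n) (dmO : order_le dm al).
Hypotheses (ellT : tends ell 1 mu_d) (gapT : tends gap (1 - de) (mu_d * la)).
Hypothesis cubeT : tends cube (3 * al) c3.

(** The assumptions on a weight; they are stable under w -> w + 1, which is what
    polarization uses. *)
Record regular_weight (w : forall n, 'I_n -> R) (mu : R) := RegularWeight {
  rw_ge0 : forall n (i : 'I_n), 0 <= w n i;
  rw_max : R^nat;
  rw_maxP : forall n (i : 'I_n), w n i <= rw_max n;
  rw_maxO : order_le rw_max al;
  rw_mean : tends (fun n => \sum_(i < n) dgr i * w n i) 1 mu;
  rw_w2 : order_le (fun n => \sum_(i < n) w n i ^+ 2) 1;
  rw_w3 : order_le (fun n => \sum_(i < n) w n i ^+ 3) (3 * al);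
  rw_d2w : order_le (fun n => \sum_(i < n) dgr i ^+ 2 * w n i) (3 * al);
  rw_dw2 : order_le (fun n => \sum_(i < n) dgr i * w n i ^+ 2) (3 * al) }.

(* the two roots of a second moment cost 2 each, see [theta_inv_start] *)
Let q n := gap n - 4.

Let gap_l0 : mu_d * la != 0. Proof. by rewrite mulf_neq0 // gt_eqF. Qed.

Lemma qT : tends q (1 - de) (mu_d * la).
Proof.
apply: (tends_drop gapT (order_le_cst (- 4))); have := al3; have := de1; lra.
Qed.

Lemma q_gt0 : \forall n \near \oo, 0 < q n.
Proof. by apply: tends_pos qT; rewrite mulr_gt0. Qed.

Lemma gap_gt0 : \forall n \near \oo, 0 < gap n.
Proof. by apply: tends_pos gapT; rewrite mulr_gt0. Qed.

Let iqO : order_le (fun n => (q n)^-1) (de - 1).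
Proof. by apply: order_le_weaken (order_le_inv gap_l0 qT); lra. Qed.

Lemma dgr_ge0 n (i : 'I_n) : 0 <= dgr i. Proof. exact: deg_ge0. Qed.

Let cubeO := tends_order cubeT.

(* Distances are cut off at t of order n^(de + ga). A positive ga makes longer
   paths very unlikely; with this value, half of the available room 1 - 2 al - de,
   the factors t / n^de lost in the estimates stay harmless. *)
Let ga := (1 - 2 * al - de) / 2.
Let s_ n : nat := Num.truncn (n%:R `^ (de + ga) : R).
Let t n : nat := (s_ n).+1.
Let tr n : R := (t n)%:R.
Let Z n := ell n - (2 * t n)%:R.
Let gapt n := gap n - (2 * t n)%:R.
Let S n : R := \sum_(i < n) dgr i * (dgr i - 1).
Let x n := S n / Z n.

Let ga0 : 0 < ga. Proof. by rewrite divr_gt0 // subr_gt0. Qed.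
Let gaE : 2 * ga = 1 - 2 * al - de. Proof. by rewrite /ga mulrC divfK. Qed.

Let s_itv n : (s_ n)%:R <= n%:R `^ (de + ga) < tr n.
Proof. by apply: truncn_itv; apply: powR_ge0. Qed.

Let trO : order_le tr (de + ga).
Proof.
apply: (@order_le_dom _ _ (fun n => n%:R `^ (de + ga) + 1)).
  near=> n; rewrite !ger0_norm ?ler0n ?addr_ge0 ?powR_ge0 //.
  by rewrite /tr /t -addn1 natrD lerD2r; case/andP: (s_itv n).
apply: order_le_add; first exact: order_le_pw.
by apply: order_le_weaken (order_le_cst 1); have := ga0; have := de0; lra.
Unshelve. all: by end_near. Qed.

Let t2O : order_le (fun n => (2 * t n)%:R) (de + ga).
Proof.
apply: (@order_le_dom _ _ (fun n => 2 * tr n)); last exact: order_le_mulc.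
by near=> n; rewrite /tr natrM.
Unshelve. all: by end_near. Qed.

Let siO : order_le (fun n => (s_ n)%:R^-1 : R) (- (de + ga)).
Proof.
exists 2; split => //; near=> n; have n0 : (0 < n)%N by near: n; exact: near_pos.
have big : 2 <= n%:R `^ (de + ga) :> R.
  by near: n; apply: pw_large; have := ga0; have := de0; lra.
have := s_itv n; rewrite /tr /t -addn1 natrD => /andP[_ H].
have s0 : 0 < (s_ n)%:R :> R by lra.
rewrite ger0_norm ?invr_ge0 ?ler0n // powRN.
rewrite -[leLHS]mul1r ler_pdivrMr // mulrAC ler_pdivlMr ?pw_gt0 //; lra.
Unshelve. all: by end_near. Qed.

Let gaptT : tends gapt (1 - de) (mu_d * la).
Proof.
by apply: tends_dropB gapT t2O _; have := gaE; have := al3; have := de1; lra.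
Qed.

Let ZT : tends Z 1 mu_d.
Proof.
by apply: tends_dropB ellT t2O _; have := gaE; have := al3; have := de1; have := de0; lra.
Qed.

Let qtT : tends (fun n => q n - (2 * t n)%:R) (1 - de) (mu_d * la).
Proof.
by apply: tends_dropB qT t2O _; have := gaE; have := al3; have := de1; lra.
Qed.

Let lim0 : 0 < mu_d * la. Proof. by rewrite mulr_gt0. Qed.

Let SE n : S n = ell n - gap n.
Proof.
by rewrite /S /gap thetaE !outside0 -/(ell n) opprB addrC subrK.
Qed.

Let S_ge0 n : 0 <= S n.
Proof. by apply: sumr_ge0 => i _; apply: deg_pred_ge0. Qed.

Let xE n : 0 < Z n -> x n = 1 - gapt n / Z n.
Proof.
move=> Z0; have -> : gapt n = Z n - S n by rewrite SE /Z /gapt; ring.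
by rewrite /x; field; rewrite gt_eqF.
Qed.

Let x_itv n : 0 < Z n -> 0 < gapt n -> 0 <= x n <= 1.
Proof.
move=> Z0 g0; apply/andP; split; first by rewrite divr_ge0 // ltW.
by rewrite xE // gerBl divr_ge0 // ltW.
Qed.

Let ZX_pos : \forall n \near \oo, 0 < Z n /\ 0 < gapt n.
Proof. by apply: filterI; [exact: tends_pos mu_d0 ZT | exact: tends_pos lim0 gaptT]. Qed.

(* 1 - x has order n^-de and s_ has order n^(de + ga), so x ^ s_ is at most
   exp (- y) with y of order n^ga, and exp (- y) <= ((k + 1) / y)^(k + 1). *)
Let decay (k : nat) : order_le (fun n => x n ^+ s_ n) (k.+1%:R * - ga).
Proof.
pose y n := gapt n / Z n * (s_ n)%:R.
have yO : order_le (fun n => (y n)^-1) (- ga).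
  apply: (@order_le_dom _ _ (fun n => (gapt n)^-1 * (Z n * (s_ n)%:R^-1))).
    by near=> n; rewrite /y !invfM invrK mulrA.
  apply: (@order_le_weaken _ _ (- (1 - de) + (1 + - (de + ga)))); first by lra.
  apply: (order_le_mul (order_le_inv _ gaptT)); first by rewrite gt_eqF.
  exact: (order_le_mul (tends_order ZT) siO).
have ykO : order_le (fun n => (y n)^-1 ^+ k.+1) (k.+1%:R * - ga).
  elim: (k) => [|j IH]; first by rewrite mul1r; exact: yO.
  apply: (@order_le_weaken _ _ (- ga + j.+1%:R * - ga)).
    by rewrite -(addn1 j.+1) natrD mulrDl mul1r addrC.
  apply: (@order_le_dom _ _ (fun n => (y n)^-1 * (y n)^-1 ^+ j.+1)); last exact: order_le_mul.
  by near=> n; rewrite [in leLHS]exprS.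
apply: (order_le_dom _ (order_le_mulc (k.+1%:R ^+ k.+1) ykO)).
near=> n; have [Z0 g0] : 0 < Z n /\ 0 < gapt n by near: n; exact: ZX_pos.
have [x0 x1] := andP (x_itv Z0 g0).
have s0 : (0 < s_ n)%N.
  have big : 2 <= n%:R `^ (de + ga) :> R.
    by near: n; apply: pw_large; have := ga0; have := de0; lra.
  have := s_itv n; rewrite /tr /t -addn1 natrD -(ltr0n R) => /andP[_ H]; lra.
have y0 : 0 < y n by rewrite mulr_gt0 ?divr_gt0 // ltr0n.
have k0 : 0 < k.+1%:R :> R by rewrite ltr0n.
have yi : 0 <= (y n)^-1 ^+ k.+1 by rewrite exprn_ge0 // invr_ge0 ltW.
have yk : 0 <= y n / k.+1%:R by rewrite divr_ge0 // ltW.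
have kk : 0 <= k.+1%:R ^+ k.+1 :> R by rewrite exprn_ge0.
have xs : 0 <= x n ^+ s_ n by rewrite exprn_ge0.
rewrite (ger0_norm xs) (ger0_norm (mulr_ge0 kk yi)).
have -> : k.+1%:R ^+ k.+1 * (y n)^-1 ^+ k.+1 = (((y n) / k.+1%:R) ^+ k.+1)^-1.
  by rewrite expr_div_n invf_div exprVn.
apply: (@le_trans _ _ (expR (y n))^-1).
  rewrite -expRN /y -mulNr; apply: (@le_trans _ _ (expR (- (gapt n / Z n)) ^+ s_ n)).
    by rewrite lerXn2r ?nnegrE ?expR_ge0 // xE // expR_ge1Dx.
  by rewrite -expRM_natr.
rewrite lef_pV2 ?posrE ?expR_gt0 ?exprn_gt0 ?divr_gt0 //.
have -> : expR (y n) = expR (y n / k.+1%:R) ^+ k.+1.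
  by rewrite -expRM_natr divfK // gt_eqF.
rewrite lerXn2r ?nnegrE ?expR_ge0 //.
by apply: le_trans (expR_ge1Dx _); rewrite lerDr.
Unshelve. all: by end_near. Qed.

Let fast (M : R) : order_le (fun n => x n ^+ s_ n) (- M).
Proof.
pose k := Num.truncn `|M / ga|.
apply: order_le_weaken (decay k).
have /andP[_ H] : k%:R <= `|M / ga| < k.+1%:R by apply: truncn_itv.
have H2 : M / ga <= k.+1%:R by apply: le_trans (ler_norm _) (ltW H).
by rewrite mulrN lerN2 -ler_pdivrMr.
Qed.

Definition far n (m : {ffun half_edge (d n) -> half_edge (d n)}) : bool :=
  [exists i : 'I_n, exists k in comp (@owner n (d n)) m i, (t n < graph_dist m i k)%N].

Let far_bound n := ell n * (ell n / Z n * x n ^+ s_ n).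

Lemma Ex_far : \forall n \near \oo, Expect (fun m => (@far n m)%:R : R) <= far_bound n.
Proof.
near=> n; have [Z0 g0] : 0 < Z n /\ 0 < gapt n by near: n; exact: ZX_pos.
apply: (@le_trans _ _ (\sum_(i < n) Expect (fun m : {ffun half_edge (d n) -> half_edge (d n)} =>
   [exists k in comp (@owner n (d n)) m i, (t n < graph_dist m i k)%N]%:R : R))).
  rewrite /Expect -Ex_sum; apply: Ex_le => m _.
  rewrite -natr_sum ler_nat; case: (boolP (far m)) => // /existsP[i fi].
  by rewrite (bigD1 i) //= fi.
rewrite /far_bound {1}/ell mulr_suml; apply: ler_sum => i _.
by apply: Ex_far_le => //; rewrite -subr_gt0.
Unshelve. all: by end_near. Qed.

Lemma far_bound_order (M : R) : order_le far_bound (- M).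
Proof.
apply: (@order_le_weaken _ _ (1 + (1 + - 1 + - (M + 1)))); first by lra.
have eO := tends_order ellT.
apply: (order_le_mul eO); apply: order_le_mul (fast _).
apply: (order_le_mul eO); apply: order_le_inv ZT; by rewrite gt_eqF.
Qed.

Lemma far_cvg0 : (fun n => Expect (fun m => (@far n m)%:R : R)) @ \oo --> (0 : R).
Proof.
have := order_le_tends0 (far_bound_order 1) (_ : - 1 < 0); rewrite /tends oppr0 => H.
apply: cvg0_le (H _); last by lra.
near=> n; rewrite powRr0 mul1r Expect_prob_ge0 /=; near: n; exact: Ex_far.
Unshelve. all: by end_near. Qed.

Section Weight.
Variables (w : forall n, 'I_n -> R) (mu : R) (W : regular_weight w mu).

Let V n : R := \sum_(i < n) dgr i * w i.
Let wm := rw_max W.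
Let VT : tends V 1 mu := rw_mean W.
Let VO : order_le V 1 := tends_order VT.
Let w0 n (i : 'I_n) : 0 <= w i := rw_ge0 W i.
Let wmP n (i : 'I_n) : w i <= wm n := rw_maxP W i.
Let wmO : order_le wm al := rw_maxO W.
Let w3O := rw_w3 W.
Let d2wO := rw_d2w W.
Let dw2O := rw_dw2 W.

Let V_ge0 n : 0 <= V n.
Proof. by apply: sumr_ge0 => i _; rewrite mulr_ge0 ?dgr_ge0. Qed.

Lemma mean_ge0 : 0 <= mu.
Proof. by apply: tends_ge0 VT; near=> n; apply: V_ge0. Unshelve. all: by end_near. Qed.

Let kh := mu / (mu_d * la).

Let kh_ge0 : 0 <= kh.
Proof. by rewrite divr_ge0 ?mean_ge0 // mulr_ge0 // ltW. Qed.

Let kap n := V n / q n.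
Let kap' n := V n / gap n.

Lemma kapT : tends kap de kh.
Proof. by apply: (tends_exp _ (tendsM VT (tendsV gap_l0 qT))); ring. Qed.

Lemma kap'T : tends kap' de kh.
Proof. by apply: (tends_exp _ (tendsM VT (tendsV gap_l0 gapT))); ring. Qed.

Let kapO := tends_order kapT.
Let kap'O := tends_order kap'T.

Let M2 n : R := \sum_(i < n) dgr i * (w i + kap n * dgr i) ^+ 2.
Let W2 n : R := \sum_(i < n) w i * (w i + kap n * dgr i) ^+ 2.
Let M3 n : R := \sum_(i < n) dgr i * (w i + kap n * dgr i) ^+ 3.
Let W3 n : R := \sum_(i < n) w i * (w i + kap n * dgr i) ^+ 3.
Let M11 n : R := \sum_(i < n) dgr i ^+ 2 * (w i + kap n * dgr i).
Let K n := M2 n / q n.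
Let K3 n := (3 * K n * M11 n + M3 n) / q n.
Let T3 n := W3 n + 3 * K n * (\sum_(i < n) dgr i * w i ^+ 2 + kap n * \sum_(i < n) dgr i ^+ 2 * w i)
   + K3 n * V n.

Let M2E n : M2 n = \sum_(i < n) dgr i * w i ^+ 2 +
  (2 * (kap n * \sum_(i < n) dgr i ^+ 2 * w i) + kap n ^+ 2 * cube n).
Proof.
rewrite /M2 /cube !mulr_sumr -!big_split /=; apply: eq_bigr => i _; ring.
Qed.

Let W2E n : W2 n = \sum_(i < n) w i ^+ 3 +
  (2 * (kap n * \sum_(i < n) dgr i * w i ^+ 2) + kap n * (kap n * \sum_(i < n) dgr i ^+ 2 * w i)).
Proof.
rewrite /W2 !mulr_sumr -!big_split /=; apply: eq_bigr => i _; ring.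
Qed.

Let M11E n : M11 n = \sum_(i < n) dgr i ^+ 2 * w i + kap n * cube n.
Proof.
rewrite /M11 /cube !mulr_sumr -!big_split /=; apply: eq_bigr => i _; ring.
Qed.

Let kap_ge0 n : 0 < q n -> 0 <= kap n.
Proof. by move=> q0; rewrite divr_ge0 // ltW. Qed.

Lemma M2T : tends M2 (3 * al + 2 * de) (kh ^+ 2 * c3).
Proof.
have H : tends (fun n => kap n ^+ 2 * cube n) (3 * al + 2 * de) (kh ^+ 2 * c3).
  by apply: (tends_exp _ (tendsM (tendsX 2 kapT) cubeT)); ring.
apply: (tends_near _ (tends_drop H _ _)); last 2 first.
- apply: (@order_le_add _ _ _ (3 * al + de)); last by apply: order_le_weaken (order_le_mulc 2 (order_le_mul kapO d2wO)); lra.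
  by apply: order_le_weaken dw2O; have := de0; lra.
- by have := de0; lra.
by near=> n; rewrite M2E; ring.
Unshelve. all: by end_near. Qed.

Let M2O := tends_order M2T.

Let W2O : order_le W2 (3 * al + 2 * de).
Proof.
apply: (order_le_ext W2E); apply: order_le_add.
  by apply: order_le_weaken w3O; have := de0; lra.
apply: order_le_add.
  apply: order_le_weaken (order_le_mulc 2 (order_le_mul kapO dw2O)); have := de0; lra.
apply: order_le_weaken (order_le_mul kapO (order_le_mul kapO d2wO)); lra.
Qed.

Let KO : order_le K (3 * al + 3 * de - 1).
Proof. by apply: order_le_weaken (order_le_mul M2O iqO); lra. Qed.

Let M11O : order_le M11 (3 * al + de).
Proof.
apply: (order_le_ext M11E); apply: order_le_add.
  by apply: order_le_weaken d2wO; have := de0; lra.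
by apply: order_le_weaken (order_le_mul kapO cubeO); lra.
Qed.

Let topO : order_le (fun n => wm n + kap n * dm n) (al + de).
Proof.
apply: order_le_add; first by apply: order_le_weaken wmO; have := de0; lra.
by apply: order_le_weaken (order_le_mul kapO dmO); lra.
Qed.

Let cube_le n (f : 'I_n -> R) : 0 < q n -> (forall i, 0 <= f i) ->
  \sum_(i < n) f i * (w i + kap n * dgr i) ^+ 3 <=
  (wm n + kap n * dm n) * \sum_(i < n) f i * (w i + kap n * dgr i) ^+ 2.
Proof.
move=> qn f0; rewrite mulr_sumr; apply: ler_sum => i _.
rewrite exprS mulrCA; apply: ler_wpM2r; first by rewrite mulr_ge0 ?sqr_ge0.
by rewrite lerD // ler_wpM2l // kap_ge0.
Qed.

Let sum_ge0 n (f : 'I_n -> R) (p : nat) : 0 < q n -> (forall i, 0 <= f i) ->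
  0 <= \sum_(i < n) f i * (w i + kap n * dgr i) ^+ p.
Proof.
move=> qn f0; apply: sumr_ge0 => i _.
by rewrite mulr_ge0 // exprn_ge0 // addr_ge0 // mulr_ge0 ?kap_ge0 ?dgr_ge0.
Qed.

Let M3O : order_le M3 (4 * al + 3 * de).
Proof.
apply: (order_le_pos (v := fun n => (wm n + kap n * dm n) * M2 n)).
  near=> n; have qn : 0 < q n by near: n; exact: q_gt0.
  by rewrite sum_ge0 ?cube_le //; move=> i; apply: dgr_ge0.
by apply: order_le_weaken (order_le_mul topO M2O); lra.
Unshelve. all: by end_near. Qed.

Let W3O : order_le W3 (4 * al + 3 * de).
Proof.
apply: (order_le_pos (v := fun n => (wm n + kap n * dm n) * W2 n)).
  near=> n; have qn : 0 < q n by near: n; exact: q_gt0.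
  by rewrite sum_ge0 ?cube_le //; move=> i; apply: w0.
by apply: order_le_weaken (order_le_mul topO W2O); lra.
Unshelve. all: by end_near. Qed.

Let K3O : order_le K3 (4 * al + 4 * de - 1).
Proof.
apply: (@order_le_weaken _ _ (4 * al + 3 * de + (de - 1))); first by lra.
apply: order_le_mul iqO; apply: order_le_add M3O.
apply: order_le_weaken (order_le_mul (order_le_mulc 3 KO) M11O).
by have := de1; have := al2; lra.
Qed.

Let T3O : order_le T3 (4 * al + 4 * de).
Proof.
apply: order_le_add; last by apply: order_le_weaken (order_le_mul K3O VO); lra.
apply: order_le_add; first by apply: order_le_weaken W3O; have := de0; lra.
apply: (@order_le_weaken _ _ ((3 * al + 3 * de - 1) + (3 * al + de))).
  by have := al2; lra.
apply: order_le_mul; first exact: order_le_mulc.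
apply: order_le_add; first by apply: order_le_weaken dw2O; have := de0; lra.
by apply: order_le_weaken (order_le_mul kapO d2wO); lra.
Qed.


(* A, B and C are the least coefficients allowed in [Ex_mass_ge]; Err is the total
   error over all roots. *)
Let rho n (i : 'I_n) : R := dgr i * w i + kap' n * dgr i ^+ 2.
Let P1 n : R := \sum_(i < n) dgr i * rho i.
Let P2 n : R := \sum_(i < n) dgr i ^+ 2 * rho i.
Let A n := (q n)^-1.
Let C n := (A n * P1 n + 2 * kap' n) / (2 * q n).
Let B n := (A n * P2 n + C n * cube n) / q n.
Let Err n : R := \sum_(i < n) w i * (dgr i * (A n * rho i + B n + C n * dgr i)).

Let kap'_ge0 n : 0 < gap n -> 0 <= kap' n.
Proof. by move=> q0; rewrite divr_ge0 // ltW. Qed.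

Let rho_ge0 n (i : 'I_n) : 0 < gap n -> 0 <= rho i.
Proof. by move=> g0; apply: addr_ge0; apply: mulr_ge0; rewrite ?sqr_ge0 ?dgr_ge0 ?kap'_ge0. Qed.

Let P1_ge0 n : 0 < gap n -> 0 <= P1 n.
Proof. by move=> g0; apply: sumr_ge0 => i _; rewrite mulr_ge0 ?dgr_ge0 ?rho_ge0. Qed.

Let P1O : order_le P1 (3 * al + de).
Proof.
apply: (order_le_ext (v := fun n => \sum_(i < n) dgr i ^+ 2 * w i + kap' n * cube n)).
  by move=> n; rewrite /P1 /cube mulr_sumr -big_split /=; apply: eq_bigr => i _; rewrite /rho; ring.
apply: order_le_add; first by apply: order_le_weaken d2wO; have := de0; lra.
by apply: order_le_weaken (order_le_mul kap'O cubeO); lra.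
Qed.

Let P2O : order_le P2 (4 * al + de).
Proof.
apply: (order_le_pos (v := fun n => dm n * P1 n)).
  near=> n; have gn : 0 < gap n by near: n; exact: gap_gt0.
  apply/andP; split; first by apply: sumr_ge0 => i _; rewrite mulr_ge0 ?sqr_ge0 ?rho_ge0.
  rewrite /P1 mulr_sumr; apply: ler_sum => i _; rewrite expr2 -mulrA.
  by apply: ler_wpM2r => //; rewrite mulr_ge0 ?dgr_ge0 ?rho_ge0.
by apply: order_le_weaken (order_le_mul dmO P1O); lra.
Unshelve. all: by end_near. Qed.

Let CO : order_le C (3 * al + 3 * de - 2).
Proof.
apply: (order_le_ext (v := fun n => 2^-1 * ((A n * P1 n + 2 * kap' n) * (q n)^-1))).
  by move=> n; rewrite /C invfM; ring.
apply: order_le_mulc; apply: (@order_le_weaken _ _ (3 * al + 2 * de - 1 + (de - 1))); first by lra.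
apply: order_le_mul iqO; apply: order_le_add.
  by apply: order_le_weaken (order_le_mul iqO P1O); lra.
by apply: order_le_weaken (order_le_mulc 2 kap'O); have := al3; have := de0; lra.
Qed.

Let BO : order_le B (4 * al + 3 * de - 2).
Proof.
apply: (@order_le_weaken _ _ (4 * al + 2 * de - 1 + (de - 1))); first by lra.
apply: order_le_mul iqO; apply: order_le_add.
  by apply: order_le_weaken (order_le_mul iqO P2O); lra.
by apply: order_le_weaken (order_le_mul CO cubeO); have := al2; have := de1; lra.
Qed.

Let ErrE n : Err n = A n * (\sum_(i < n) w i * (dgr i * rho i)) + B n * V n +
  C n * \sum_(i < n) dgr i ^+ 2 * w i.
Proof.
rewrite /Err /V !mulr_sumr -!big_split /=; apply: eq_bigr => i _; ring.
Qed.

Let ErrO : order_le Err (4 * al + 3 * de - 1).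
Proof.
apply: (order_le_ext ErrE); apply: order_le_add.
  apply: order_le_add; last by apply: order_le_weaken (order_le_mul BO VO); lra.
  apply: (@order_le_weaken _ _ ((de - 1) + (al + (3 * al + de)))); first by have := de0; lra.
  apply: order_le_mul iqO _; apply: (order_le_pos (v := fun n => wm n * P1 n)).
    near=> n; have gn : 0 < gap n by near: n; exact: gap_gt0.
    have t0 (i : 'I_n) : 0 <= dgr i * rho i by rewrite mulr_ge0 ?dgr_ge0 ?rho_ge0.
    apply/andP; split; first by apply: sumr_ge0 => i _; rewrite mulr_ge0.
    by rewrite /P1 mulr_sumr; apply: ler_sum => i _; apply: ler_wpM2r.
  exact: order_le_mul.
by apply: order_le_weaken (order_le_mul CO d2wO); have := al2; lra.
Unshelve. all: by end_near. Qed.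

Let cw n m (i : 'I_n) : R := mass (w (n := n)) (comp (@owner n (d n)) m i).

Let gapE n : gap n = q n + 4. Proof. by rewrite /q subrK. Qed.

Let kapP n : 0 < q n -> \sum_(i < n) dgr i * w i <= kap n * q n.
Proof. by move=> qn; rewrite divfK // gt_eqF. Qed.

Let KP n : 0 < q n -> \sum_(i < n) dgr i * (w i + kap n * dgr i) ^+ 2 <= K n * q n.
Proof. by move=> qn; rewrite divfK // gt_eqF. Qed.

Let K3P n : 0 < q n ->
  3 * K n * (\sum_(i < n) dgr i ^+ 2 * (w i + kap n * dgr i)) +
  \sum_(i < n) dgr i * (w i + kap n * dgr i) ^+ 3 <= K3 n * q n.
Proof. by move=> qn; rewrite divfK // gt_eqF. Qed.

Let Ex_cw_ge n (i : 'I_n) : 0 < q n ->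
  w i + kap' n * dgr i - dgr i * (A n * rho i + B n + C n * dgr i) <=
  Expect (fun m => cw m i).
Proof.
move=> qn; have gn : 0 < gap n by rewrite gapE addr_gt0.
have A0 : 0 <= A n by rewrite invr_ge0 ltW.
have C0 : 0 <= C n.
  apply: divr_ge0; last by rewrite mulr_ge0 // ltW.
  by apply: addr_ge0; apply: mulr_ge0; rewrite ?P1_ge0 ?kap'_ge0.
have cub0 : 0 <= cube n by apply: sumr_ge0 => j _; rewrite exprn_ge0 ?dgr_ge0.
have B0 : 0 <= B n.
  apply: divr_ge0; last exact: ltW.
  apply: addr_ge0; apply: mulr_ge0 => //.
  by apply: sumr_ge0 => j _; rewrite mulr_ge0 ?sqr_ge0 ?rho_ge0.
apply: (@Ex_comp_ge _ _ (@owner n (d n)) R i (q n) (even_d n) qn _ _ _ (@w0 n) (kap'_ge0 gn)) => //.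
- by rewrite -/(gap n) gapE lerD2l ler_nat.
- by rewrite -/(gap n) divfK // gt_eqF.
- by rewrite mulVf // gt_eqF.
- rewrite -/(P1 n) /C le_eqVlt; apply/orP; left; apply/eqP; field; by rewrite gt_eqF.
- by rewrite -/(P2 n) -/(cube n) divfK // gt_eqF.
Qed.

Let qgap n : 0 < q n -> q n + 2 <= gap n.
Proof. by move=> _; rewrite gapE lerD2l ler_nat. Qed.

Let Ex_cw2_le n (i : 'I_n) : 0 < q n ->
  Expect (fun m => cw m i ^+ 2) <= (w i + kap n * dgr i) ^+ 2 + K n * dgr i.
Proof.
move=> qn; apply: (Ex_comp2_le i (even_d n) qn (qgap qn) (@w0 n) (kap_ge0 qn)).
  exact: kapP.
exact: KP.
Qed.

Let b3 n (i : 'I_n) : R := (w i + kap n * dgr i) ^+ 3 +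
   3 * K n * dgr i * (w i + kap n * dgr i) + K3 n * dgr i.

Let Ex_cw3_le n (i : 'I_n) : 0 < q n -> Expect (fun m => cw m i ^+ 3) <= b3 i.
Proof.
move=> qn; apply: (Ex_comp3_le i (even_d n) qn (qgap qn) (@w0 n) (kap_ge0 qn)).
- exact: kapP.
- exact: KP.
- exact: K3P.
Qed.

Let T3E n : \sum_(i < n) w i * b3 i = T3 n.
Proof.
rewrite /T3 /W3 /V !mulr_sumr -!big_split /= mulr_sumr -!big_split /=.
by apply: eq_bigr => i _; rewrite /b3; ring.
Qed.

Definition weighted_susceptibility n m : R := \sum_(i < n) w i * cw m i.

Let Ex_susceptibility_ge n : 0 < q n ->
  kap' n * V n - Err n <= Expect (@weighted_susceptibility n).
Proof.
move=> qn; rewrite /Expect Ex_sum.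
apply: (@le_trans _ _ (\sum_(i < n) w i * (w i + kap' n * dgr i -
     dgr i * (A n * rho i + B n + C n * dgr i)))).
  rewrite /V /Err mulr_sumr -sumrB; apply: ler_sum => i _.
  have := sqr_ge0 (w i); move: (w i) => u u0; lra.
apply: ler_sum => i _; rewrite ExZl; apply: ler_wpM2l; first exact: w0.
exact: Ex_cw_ge.
Qed.

Lemma susceptibility_cvg :
  CM_cvg_in_prob (fun n m => n%:R `^ (- (1 + de)) * @weighted_susceptibility n m) (kh * mu).
Proof.
have ev n : ~~ odd #|[set: half_edge (d n)]%SET| by rewrite cardsT.
apply: (second_moment_scaled ev _ (lo := fun n => kap' n * V n - Err n)
   (up := fun n => (kap n * V n + \sum_(i < n) w i ^+ 2) ^+ 2 + T3 n)).
- by rewrite mulr_ge0 ?kh_ge0 ?mean_ge0.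
- near=> n; apply: Ex_susceptibility_ge; near: n; exact: q_gt0.
- near=> n; have qn : 0 < q n by near: n; exact: q_gt0.
  have H := Ex_susceptibility2_le (even_d n) qn _ (@w0 n) (kap_ge0 qn) (kapP qn) (fun i => Ex_cw3_le i qn).
  apply: le_trans (H _) _; first by rewrite -/(gap n) gapE.
  rewrite T3E le_eqVlt; apply/orP; left; apply/eqP; congr (_ ^+ 2 + _).
  by rewrite /V mulr_sumr -big_split /=; apply: eq_bigr => i _; rewrite -/(dgr i); ring.
- apply: (tends_dropB (tends_exp _ (tendsM kap'T VT)) ErrO); first by ring.
  by have := al2; have := de1; lra.
- apply: tends_drop T3O _; last by have := al2; have := de1; lra.
  apply: (tends_exp _ (tendsX 2 (tends_drop (tends_exp (erefl _) (tendsM kapT VT)) (rw_w2 W) _))); first by ring.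
  by have := de0; lra.
Unshelve. all: by end_near. Qed.

Let Dj n (j : nat) : R := (nth 0%N (d n) j)%:R.

Let nthDj n (i : 'I_n) : dgr i = Dj n i.
Proof. by rewrite /dgr /deg dg_owner /Dj (tnth_nth 0%N). Qed.

Definition comp_mass_nat (j : nat) n m : R := oapp (@cw n m) 0 (insub j).

Lemma comp_mass_cvg j (cj : R) : 0 <= cj -> tends (fun n => Dj n j) al cj ->
  CM_cvg_in_prob (fun n m => n%:R `^ (- (al + de)) * comp_mass_nat j m) (kh * cj).
Proof.
move=> cj0 DjT; have ev n : ~~ odd #|[set: half_edge (d n)]%SET| by rewrite cardsT.
have DjO := tends_order DjT.
have jn : \forall n \near \oo, (j < n)%N by exists j.+1.
apply: (second_moment_scaled ev _
   (lo := fun n => kap' n * Dj n j - Dj n j * (A n * (Dj n j * wm n + kap' n * Dj n j ^+ 2) + B n + C n * Dj n j))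
   (up := fun n => (kap n * Dj n j + wm n) ^+ 2 + K n * Dj n j)).
- by rewrite mulr_ge0 ?kh_ge0.
- near=> n; have jn' : (j < n)%N by near: n.
  have qn : 0 < q n by near: n; exact: q_gt0.
  rewrite /comp_mass_nat insubT /=; apply: le_trans (Ex_cw_ge _ qn).
  set i := Sub j _; rewrite -(nthDj i).
  have A0 : 0 <= A n by rewrite invr_ge0 ltW.
  have H1 : A n * rho i <= A n * (dgr i * wm n + kap' n * dgr i ^+ 2).
    by apply: ler_wpM2l => //; rewrite lerD2r; apply: ler_wpM2l; rewrite ?dgr_ge0 ?wmP.
  have H2 : dgr i * (A n * rho i + B n + C n * dgr i) <=
      dgr i * (A n * (dgr i * wm n + kap' n * dgr i ^+ 2) + B n + C n * dgr i).
    by apply: ler_wpM2l; rewrite ?dgr_ge0 // !lerD2r.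
  by rewrite lerB // lerDr.
- near=> n; have jn' : (j < n)%N by near: n.
  have qn : 0 < q n by near: n; exact: q_gt0.
  rewrite /comp_mass_nat insubT /=; apply: le_trans (Ex_cw2_le _ qn) _.
  set i := Sub j _; rewrite -(nthDj i) lerD2r addrC lerXn2r ?nnegrE //.
  + by rewrite addr_ge0 // mulr_ge0 ?dgr_ge0 ?kap_ge0.
  + apply: addr_ge0; last exact: le_trans (w0 i) (wmP i).
    by apply: mulr_ge0; rewrite ?dgr_ge0 ?kap_ge0.
  + by rewrite lerD2l.
- apply: (tends_dropB (tends_exp _ (tendsM kap'T DjT)) (e := 3 * al + 2 * de - 1)); first by ring.
    apply: (@order_le_weaken _ _ (al + (2 * al + 2 * de - 1))); first by lra.
    apply: (order_le_mul DjO); apply: order_le_add; first apply: order_le_add.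
    + apply: (@order_le_weaken _ _ (de - 1 + (2 * al + de))); first by lra.
      apply: order_le_mul iqO _; apply: order_le_add.
        by apply: order_le_weaken (order_le_mul DjO wmO); have := de0; lra.
      by apply: order_le_weaken (order_le_mul kap'O (tends_order (tendsX 2 DjT))); lra.
    + by apply: order_le_weaken BO; have := al2; have := de1; lra.
    + by apply: order_le_weaken (order_le_mul CO DjO); have := al2; have := de1; lra.
  by have := al2; have := al3; have := de1; have := de0; lra.
- apply: (tends_drop (tends_exp _ (tendsX 2 (tends_drop (tends_exp (erefl _) (tendsM kapT DjT)) wmO _))) (order_le_mul KO DjO)); first by ring.
    by have := de0; lra.
  by have := al2; have := de1; lra.
Unshelve. all: by end_near. Qed.

Definition weighted_cubes n m : R := \sum_(i < n) w i * cw m i ^+ 2.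

Lemma Ex_weighted_cubes : exists2 up : R^nat,
  \forall n \near \oo, Expect (@weighted_cubes n) <= up n &
  tends up (3 * al + 3 * de) (kh * (kh ^+ 2 * c3)).
Proof.
exists (fun n => kap n * M2 n + W2 n).
  near=> n; have qn : 0 < q n by near: n; exact: q_gt0.
  rewrite /Expect Ex_sum; apply: le_trans (_ : _ <= \sum_(i < n) w i * ((w i + kap n * dgr i) ^+ 2 + K n * dgr i)) _.
    apply: ler_sum => i _; rewrite ExZl; apply: ler_wpM2l; first exact: w0.
    exact: Ex_cw2_le.
  rewrite le_eqVlt; apply/orP; left; apply/eqP.
  have -> : kap n * M2 n = K n * V n by rewrite /kap /K; ring.
  by rewrite /W2 /V mulr_sumr -big_split /=; apply: eq_bigr => i _; ring.
apply: (tends_drop (tends_exp _ (tendsM kapT M2T)) W2O); last by have := de0; lra.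
by ring.
Unshelve. all: by end_near. Qed.

Let dwt n m (i : 'I_n) : R := dist_weight (d := d n) (w (n := n)) (t n) m i.
Let mwt n m (i : 'I_n) : R := min_dist_weight (d := d n) (w (n := n)) (t n) m i.
Let Dt n m : R := \sum_(i < n) w i * dwt m i.
Let Dm n m : R := \sum_(i < n) w i * mwt m i.

Definition weighted_distance n (m : {ffun half_edge (d n) -> half_edge (d n)}) : R :=
  \sum_(i < n) w i * \sum_(k in comp (@owner n (d n)) m i) w k * (graph_dist m i k)%:R.

Let not_far n (m : {ffun half_edge (d n) -> half_edge (d n)}) (i k : 'I_n) : ~~ far m ->
  k \in comp (@owner n (d n)) m i -> (graph_dist m i k <= t n)%N.
Proof.
by move=> /existsPn/(_ i)/existsPn/(_ k); rewrite negb_and -leqNgt => /orP[/negP//|//].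
Qed.

Let Dt_eq n (m : {ffun half_edge (d n) -> half_edge (d n)}) : ~~ far m ->
  Dt m = weighted_distance m.
Proof.
move=> nf; apply: eq_bigr => i _; congr (_ * _); apply: eq_bigr => k kc.
by rewrite not_far.
Qed.

Let sw n : R := \sum_(i < n) w i.

Let swO : order_le sw (1 + al).
Proof.
apply: (order_le_pos (v := fun n => n%:R `^ 1 * wm n)).
  near=> n; rewrite sumr_ge0 //= powRr1 // mulr_natl -[X in _ *+ X]card_ord -sumr_const.
  by apply: ler_sum => i _; apply: wmP.
by apply: order_le_mul => //; apply: order_le_pw.
Unshelve. all: by end_near. Qed.

Let Dm_le n (m : {ffun half_edge (d n) -> half_edge (d n)}) :
  Dm m <= Dt m + tr n * sw n ^+ 2 * (far m)%:R.
Proof.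
case: (boolP (far m)) => [_|nf]; last first.
  rewrite mulr0 addr0 Dt_eq //; apply: ler_sum => i _; apply: ler_wpM2l; first exact: w0.
  by apply: ler_sum => k _; apply: ler_wpM2l; rewrite ?w0 // ler_nat geq_minl.
rewrite mulr1; apply: (@le_trans _ _ (tr n * sw n ^+ 2)); last first.
  by rewrite lerDr; apply: sumr_ge0 => i _; apply: mulr_ge0; rewrite ?w0 ?dist_weight_ge0.
have -> : tr n * sw n ^+ 2 = \sum_(i < n) w i * (tr n * sw n).
  by rewrite -mulr_suml -/(sw n) expr2; ring.
apply: ler_sum => i _; apply: ler_wpM2l; first exact: w0.
have -> : tr n * sw n = \sum_(k < n) w k * tr n by rewrite -mulr_suml mulrC.
rewrite /mwt /min_dist_weight big_mkcond /=; apply: ler_sum => k _.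
case: ifP => _; last by rewrite mulr_ge0 ?w0.
by apply: ler_wpM2l; rewrite ?w0 // ler_nat geq_minr.
Qed.

Let bridge_algebra (v e z y u g : R) : g != 0 -> g + 2 * u != 0 ->
  v * (v * z / g ^+ 2) - (u * e + v * v * z / g ^+ 2 * y + v * v * u * (2 * u) / (g * (g + 2 * u))) =
  u * (v / (g + 2 * u)) * v - u * e - (v * (u / g) - v * z * (1 - y) / g ^+ 2) * v.
Proof. by move=> g0 h0; field; rewrite g0 h0. Qed.

Let Ex_Dm_ge n : 0 < q n -> 0 < Z n -> 0 < gapt n ->
  V n * (V n * Z n / gapt n ^+ 2) - (tr n * Err n + V n * V n * Z n / gapt n ^+ 2 * x n ^+ t n +
    V n * V n * tr n * (2 * tr n) / (gapt n * gap n)) <= Expect (@Dm n).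
Proof.
move=> qn Z0 g0; have gn : 0 < gap n by rewrite gapE addr_gt0.
pose G := V n * (tr n / gapt n) - V n * Z n * (1 - x n ^+ t n) / gapt n ^+ 2.
apply: (@le_trans _ _ (\sum_(i < n) w i * (tr n * (kap' n * dgr i -
    dgr i * (A n * rho i + B n + C n * dgr i)) - dgr i * G))).
  have -> : \sum_(i < n) w i * (tr n * (kap' n * dgr i -
      dgr i * (A n * rho i + B n + C n * dgr i)) - dgr i * G) =
      tr n * kap' n * V n - tr n * Err n - G * V n.
    by rewrite /V /Err !mulr_sumr -!sumrB; apply: eq_bigr => i _; ring.
  rewrite le_eqVlt; apply/orP; left; apply/eqP; rewrite /G /kap'.
  have -> : gap n = gapt n + 2 * tr n by rewrite /gapt natrM -/(tr n) subrK.
  have gn' : gapt n + 2 * tr n != 0.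
    by rewrite gt_eqF // addr_gt0 // mulr_gt0 // /tr /t ltr0n.
  by apply: bridge_algebra; [rewrite gt_eqF | exact: gn'].
rewrite /Expect Ex_sum; apply: ler_sum => i _; rewrite ExZl; apply: ler_wpM2l; first exact: w0.
have tg : (2 * t n)%:R < theta (@owner n (d n)) R finset.set0 by rewrite -subr_gt0.
apply: le_trans (Ex_min_dist_weight_ge (@w0 n) i (even_d n) tg).
rewrite -/(tr n) -/(gap n) -/(gapt n) -/(V n) -/(ell n) -/(Z n) -/(S n) -/(x n) -/G -/(dgr i).
rewrite lerD2r ler_wpM2l // lerBrDr; apply: le_trans (Ex_cw_ge i qn).
by rewrite le_eqVlt; apply/orP; left; apply/eqP; ring.
Qed.

Let lD := mu * (mu * mu_d * ((mu_d * la) ^+ 2)^-1).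

Let lim2 : (mu_d * la) ^+ 2 != 0. Proof. by rewrite expf_eq0 /=. Qed.

Let Dt_cvg : CM_cvg_in_prob (fun n m => n%:R `^ (- (1 + 2 * de)) * @Dt n m) lD.
Proof.
have ev n : ~~ odd #|[set: half_edge (d n)]%SET| by rewrite cardsT.
have e1 := al2; have e2 := al3; have e3 := de0; have e4 := de1; have e5 := gaE.
pose rest n := tr n * Err n + V n * V n * Z n / gapt n ^+ 2 * x n ^+ t n +
    V n * V n * tr n * (2 * tr n) / (gapt n * gap n).
apply: (second_moment_scaled ev _
   (lo := fun n => V n * (V n * Z n / gapt n ^+ 2) - rest n - tr n * sw n ^+ 2 * far_bound n)
   (up := fun n => (V n * (V n * ell n / (q n - (2 * t n)%:R) ^+ 2)) ^+ 2 + tr n ^+ 2 * T3 n)).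
- by rewrite !mulr_ge0 ?mean_ge0 ?invr_ge0 ?sqr_ge0 // ltW.
- near=> n; have qn : 0 < q n by near: n; exact: q_gt0.
  have [Z0 g0] : 0 < Z n /\ 0 < gapt n by near: n; exact: ZX_pos.
  have farn : Expect (fun m => (@far n m)%:R : R) <= far_bound n by near: n; exact: Ex_far.
  rewrite lerBlDr; apply: le_trans (Ex_Dm_ge qn Z0 g0) _.
  apply: (@le_trans _ _ (Expect (fun m => Dt m + tr n * sw n ^+ 2 * (@far n m)%:R))).
    by apply: Ex_le => m _; apply: Dm_le.
  rewrite /Expect ExD ExZl lerD2l; apply: ler_wpM2l => //.
  by rewrite mulr_ge0 ?sqr_ge0.
- near=> n; have qn : 0 < q n by near: n; exact: q_gt0.
  have qtn : 0 < q n - (2 * t n)%:R by near: n; exact: tends_pos qtT.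
  apply: le_trans (Ex_dist2_le (@w0 n) (even_d n) qn _ _ (fun i => Ex_cw3_le i qn)) _.
  + by rewrite -/(gap n) gapE.
  + by rewrite -subr_gt0; exact: qtn.
  + by rewrite T3E -/(V n) -/(ell n) -/(tr n).
- have H : tends (fun n => V n * (V n * Z n * (gapt n ^+ 2)^-1)) (1 + 2 * de) lD.
    apply: (tends_exp _ (tendsM VT (tendsM (tendsM VT ZT) (tendsV lim2 (tendsX 2 gaptT))))).
    by ring.
  apply: (tends_dropB (e := 0)); last by lra.
    apply: (tends_dropB H (e := 1 + 2 * de - ga)); last by rewrite gtrBl.
    apply: order_le_add; first apply: order_le_add.
    + by apply: order_le_weaken (order_le_mul trO ErrO); lra.
    + apply: (@order_le_weaken _ _ (1 + 1 + 1 + - (2 * (1 - de)) + - 10)); first by lra.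
      apply: order_le_mul.
        apply: (order_le_mul (order_le_mul (order_le_mul VO VO) (tends_order ZT))).
        exact: (order_le_inv lim2 (tendsX 2 gaptT)).
      apply: (order_le_pos (v := fun n => x n ^+ s_ n)); last exact: fast.
      near=> n; have [Z0 g0] : 0 < Z n /\ 0 < gapt n by near: n; exact: ZX_pos.
      have [x0 x1] := andP (x_itv Z0 g0).
      by rewrite exprn_ge0 //= /t exprS ler_piMl // exprn_ge0.
    + apply: (@order_le_weaken _ _ (1 + 1 + (de + ga) + (de + ga) + - ((1 - de) + (1 - de)))).
        by lra.
      apply: order_le_mul.
        exact: (order_le_mul (order_le_mul (order_le_mul VO VO) trO) (order_le_mulc 2 trO)).
      apply: (order_le_inv _ (tendsM gaptT gapT)); by rewrite mulf_neq0.
  apply: (@order_le_weaken _ _ ((de + ga) + (1 + al + (1 + al)) + - 10)); first by lra.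
  apply: order_le_mul (far_bound_order _); apply: (order_le_mul trO).
  exact: (order_le_mul swO swO).
- apply: (tends_drop (tends_exp _ (tendsX 2 (tends_exp (erefl _) (tendsM VT (tendsM (tendsM VT ellT) (tendsV lim2 (tendsX 2 qtT))))))) (order_le_mul (order_le_mul trO trO) T3O)).
    by ring.
  by lra.
Unshelve. all: by end_near. Qed.

Lemma distance_cvg :
  CM_cvg_in_prob (fun n m => n%:R `^ (- (1 + 2 * de)) * @weighted_distance n m) lD.
Proof.
apply: (cvg_in_prob_near Dt_cvg); apply: cvg0_le far_cvg0; near=> n.
rewrite Expect_prob_ge0 /=; apply: Ex_le => m _; rewrite ler_nat.
by case: (boolP (far m)) => [_|nf]; rewrite ?leq_b1 // Dt_eq // eqxx.
Unshelve. all: by end_near. Qed.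

(** The component of j carries the label j unless j is connected to one of the j
    smaller vertices, which has vanishing probability. *)
Lemma comp_weight_nat_cvg j (cj : R) : 0 <= cj -> tends (fun n => Dj n j) al cj ->
  CM_cvg_in_prob (d := d) (fun n m => n%:R `^ (- (al + de)) * comp_weight_nat m (w (n := n)) j) (kh * cj).
Proof.
move=> cj0 DjT; apply: (cvg_in_prob_near (comp_mass_cvg cj0 DjT)).
have bO : order_le (fun n => j%:R * (dm n * dm n * (q n)^-1)) (al + al + (de - 1)).
  by apply: order_le_mulc; apply: order_le_mul iqO; apply: order_le_mul.
have b0 : tends (fun n => j%:R * (dm n * dm n * (q n)^-1)) 0 0.
  by apply: order_le_tends0 bO _; have := de1; lra.
apply: cvg0_le b0; near=> n; have jn : (j < n)%N by near: n; exists j.+1.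
have qn : 0 < q n by near: n; exact: q_gt0.
rewrite Expect_prob_ge0 oppr0 powRr0 mul1r /=.
pose i : 'I_n := Sub j jn.
apply: (@le_trans _ _ (\sum_(k < n | (k < j)%N)
   Expect (fun m => (k \in comp (@owner n (d n)) m i)%:R : R))).
  rewrite /Expect -Ex_sum; apply: Ex_le => m mU; rewrite -natr_sum ler_nat.
  rewrite /comp_mass_nat /comp_weight_nat insubT /= -/i.
  case: (boolP [exists k in comp (@owner n (d n)) m i, (k < j)%N]) => [/exists_inP[k kc kj]|H].
    by rewrite (bigD1 k) //= kc; case: (_ != _).
  have -> : comp_weight m (w (n := n)) i = cw m i.
    rewrite /comp_weight /min_component /cw /mass component_comp ifT //.
    apply/forall_inP => k kc; rewrite leqNgt; apply: contraNN H => kj; apply/exists_inP.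
    by exists k; [exact: kc | exact: kj].
  by rewrite eqxx.
apply: (@le_trans _ _ (\sum_(k < n | (k < j)%N) dm n * dm n * (q n)^-1)).
  apply: ler_sum => k kj.
  apply: le_trans (Ex_connected_le (even_d n) qn _ _) _.
  - by rewrite -/(gap n) gapE.
  - by rewrite -val_eqE /= neq_ltn kj orbT.
  apply: ler_wpM2r; first by rewrite invr_ge0 ltW.
  apply: ler_pM; first [exact: dgr_ge0 | exact: dmP].
rewrite -(big_ord_widen n (fun=> dm n * dm n * (q n)^-1)) ?(ltnW jn) //.
by rewrite sumr_const card_ord mulr_natl.
Unshelve. all: by end_near. Qed.

Lemma comp_weight_ge0 n (m : {ffun half_edge (d n) -> half_edge (d n)}) (i : 'I_n) :
  0 <= comp_weight m (w (n := n)) i.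
Proof. by apply: sumr_ge0 => k _; apply: w0. Qed.

(** The mean is bounded by the limit. In probability, the components of the first N
    vertices contribute the N-th partial sum of the limit, for every N. *)
Lemma cubes_cvg (cs : R^nat) : (forall j, 0 <= cs j) ->
  (forall j, tends (fun n => Dj n j) al (cs j)) ->
  (fun N => \sum_(0 <= j < N) cs j ^+ 3) @ \oo --> c3 ->
  CM_cvg_in_prob (d := d) (fun n m => n%:R `^ (- (3 * al + 3 * de)) *
     \sum_(i < n) comp_weight m (w (n := n)) i ^+ 3) (kh * (kh ^+ 2 * c3)).
Proof.
move=> cs0 csT csc; have ev n : ~~ odd #|[set: half_edge (d n)]%SET| by rewrite cardsT.
have [up upP upT] := Ex_weighted_cubes.
apply: (cvg_mean_lower ev _ _ upT).
- by move=> n m; rewrite mulr_ge0 ?powR_ge0 ?sumr_ge0 // => i _; rewrite exprn_ge0 ?comp_weight_ge0.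
- near=> n; rewrite /Expect (@Ex_eq _ _ _ _ (fun m => n%:R `^ (- (3 * al + 3 * de)) * @weighted_cubes n m)).
    by rewrite ExZl ler_wpM2l ?powR_ge0 //; near: n.
  move=> m mU; congr (_ * _); rewrite /weighted_cubes.
  rewrite -(sum_comp_weight (w (n := n)) mU (fun X => mass (w (n := n)) X ^+ 2)).
  by apply: eq_bigr => i _; rewrite exprS.
pose Y j n (m : {ffun half_edge (d n) -> half_edge (d n)}) : R :=
  n%:R `^ (- (al + de)) * comp_weight_nat m (w (n := n)) j.
have Y0 j n m : 0 <= Y j n m.
  rewrite mulr_ge0 ?powR_ge0 // /comp_weight_nat; case: (insub j) => //= i.
  exact: comp_weight_ge0.
have YL N : lower_in_prob (fun n m => \sum_(0 <= j < N) Y j n m ^+ 3)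
    (\sum_(0 <= j < N) (kh * cs j) ^+ 3).
  elim: N => [|N IH].
    rewrite big_nil; apply: (lower_in_prob_le _ (lower_in_prob_cst ev 0)).
    by near=> n => m _; rewrite big_nil.
  rewrite big_nat_recr //=; apply: lower_in_prob_le; last first.
    apply: (lower_in_probD IH); apply: (lower_in_prob_cube _ (Y0 N)).
      by rewrite mulr_ge0.
    by apply: cvg_lower_in_prob; apply: comp_weight_nat_cvg.
  by near=> n => m _; rewrite big_nat_recr.
apply: (@lower_in_prob_sup _ _ _ (fun N => \sum_(0 <= j < N) (kh * cs j) ^+ 3)).
  have -> : (fun N => \sum_(0 <= j < N) (kh * cs j) ^+ 3) =
     (fun N => kh ^+ 3 * \sum_(0 <= j < N) cs j ^+ 3).
    by apply/funext => N; rewrite mulr_sumr; apply: eq_bigr => j _; rewrite exprMn.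
  have -> : kh * (kh ^+ 2 * c3) = kh ^+ 3 * c3 by ring.
  exact: cvgMr.
move=> N; apply: (lower_in_prob_le _ (YL N)); near=> n => m _.
have Nn : (N <= n)%N by near: n; exists N.
rewrite mulr_sumr big_mkord.
have e3 : n%:R `^ (- (3 * al + 3 * de)) = (n%:R `^ (- (al + de))) ^+ 3 :> R.
  by rewrite -powR_mulrn ?powR_ge0 // -powRrM; congr (_ `^ _); ring.
pose F j : R := Y j n m ^+ 3.
apply: (@le_trans _ _ (\sum_(j < n) F j)).
  rewrite (big_ord_widen _ F Nn) big_mkcond /=; apply: ler_sum => i _.
  by case: ifP => // _; rewrite exprn_ge0.
by apply: ler_sum => i _; rewrite /F /Y /comp_weight_nat valK /= exprMn e3.
Unshelve. all: by end_near. Qed.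

End Weight.

Let sqO : order_le (fun n => \sum_(i < n) dgr i ^+ 2) 1.
Proof.
apply: (@order_le_dom _ _ (fun n => 2 * ell n + - gap n)).
  near=> n; have <- : ell n + S n = 2 * ell n + - gap n by rewrite SE; ring.
  rewrite /S /ell -big_split /=; rewrite le_eqVlt; apply/orP; left; apply/eqP; congr `|_|; apply: eq_bigr => i _; ring.
apply: order_le_add; first exact: order_le_mulc (tends_order ellT).
by apply: order_le_weaken (tends_order (tendsN gapT)); have := de0; lra.
Unshelve. all: by end_near. Qed.

Let natO : order_le (fun n => n%:R : R) 1.
Proof.
apply: (order_le_dom _ (order_le_pw 1)); near=> n; by rewrite powRr1.
Unshelve. all: by end_near. Qed.

Let ellO := tends_order ellT.

Lemma regular_weight1 : regular_weight (fun n (_ : 'I_n) => 1) mu_d.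
Proof.
have a3 := al3.
have sum1 n : \sum_(i < n) (1 : R) = n%:R by rewrite sumr_const card_ord.
apply: (@RegularWeight _ _ _ (fun=> 1)) => //.
- by apply: order_le_weaken (order_le_cst 1); lra.
- by apply: tends_near ellT; near=> n; apply: eq_bigr => i _; rewrite mulr1.
- by apply: order_le_dom natO; near=> n; under eq_bigr do rewrite expr1n; rewrite sum1.
- apply: (order_le_weaken _ (order_le_dom _ natO)); first by lra.
  by near=> n; under eq_bigr do rewrite expr1n; rewrite sum1.
- apply: (order_le_weaken _ (order_le_dom _ sqO)); first by lra.
  by near=> n; under eq_bigr do rewrite mulr1.
- apply: (order_le_weaken _ (order_le_dom _ ellO)); first by lra.
  by near=> n; under eq_bigr do rewrite expr1n mulr1.
Unshelve. all: by end_near. Qed.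

Lemma regular_weightD1 w mu : regular_weight w mu ->
  regular_weight (fun n (i : 'I_n) => w n i + 1) (mu + mu_d).
Proof.
move=> W; have a3 := al3; have w0 := rw_ge0 W.
have sum1 n : \sum_(i < n) (1 : R) = n%:R by rewrite sumr_const card_ord.
have w1 n (i : 'I_n) : 0 <= w n i + 1 by rewrite addr_ge0.
have sq_le (y : R) : (y + 1) ^+ 2 <= 2 * y ^+ 2 + 2 by have := sqr_ge0 (y - 1); lra.
have cube_le (y : R) : 0 <= y -> (y + 1) ^+ 3 <= 4 * y ^+ 3 + 4.
  by move=> y0; have := mulr_ge0 (addr_ge0 y0 ler01) (sqr_ge0 (y - 1)); lra.
apply: (@RegularWeight _ _ _ (fun n => rw_max W n + 1)) => //.
- by move=> n i; rewrite lerD2r rw_maxP.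
- by apply: order_le_add (rw_maxO W) _; apply: order_le_weaken (order_le_cst 1); lra.
- apply: tends_near (tendsD (rw_mean W) ellT); near=> n.
  by rewrite /ell -big_split /=; apply: eq_bigr => i _; rewrite mulrDr mulr1.
- apply: (order_le_pos (v := fun n => 2 * (\sum_(i < n) w n i ^+ 2) + 2 * n%:R)).
    near=> n; rewrite sumr_ge0 /= => [|i _]; last by rewrite exprn_ge0.
    rewrite -(sum1 n) !mulr_sumr -big_split /=; apply: ler_sum => i _; rewrite mulr1; exact: sq_le.
  apply: order_le_add; apply: order_le_mulc; [exact: (rw_w2 W) | exact: natO].
- apply: (order_le_pos (v := fun n => 4 * (\sum_(i < n) w n i ^+ 3) + 4 * n%:R)).
    near=> n; rewrite sumr_ge0 /= => [|i _]; last by rewrite exprn_ge0.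
    rewrite -(sum1 n) !mulr_sumr -big_split /=; apply: ler_sum => i _; rewrite mulr1; exact: cube_le.
  apply: order_le_add; apply: order_le_mulc; first exact: (rw_w3 W).
  by apply: order_le_weaken natO; lra.
- apply: (@order_le_dom _ _ (fun n => \sum_(i < n) dgr i ^+ 2 * w n i + \sum_(i < n) dgr i ^+ 2)).
    near=> n; rewrite -big_split /=; rewrite le_eqVlt; apply/orP; left; apply/eqP; congr `|_|; apply: eq_bigr => i _; ring.
  by apply: order_le_add (rw_d2w W) _; apply: order_le_weaken sqO; lra.
- apply: (order_le_pos (v := fun n => 2 * (\sum_(i < n) dgr i * w n i ^+ 2) + 2 * ell n)).
    near=> n; rewrite sumr_ge0 /= => [|i _]; last by rewrite mulr_ge0 ?dgr_ge0 ?exprn_ge0.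
    rewrite /ell !mulr_sumr -big_split /=; apply: ler_sum => i _.
    have := ler_wpM2l (dgr_ge0 i) (sq_le (w n i)); move: (w n i) (dgr i) => y D; lra.
  apply: order_le_add; apply: order_le_mulc; first exact: (rw_dw2 W).
  by apply: order_le_weaken ellO; lra.
Unshelve. all: by end_near. Qed.

Let sum_mass_comp n (m : {ffun half_edge (d n) -> half_edge (d n)}) (w : 'I_n -> R) :
  m \in matchings [set: half_edge (d n)]%SET ->
  \sum_(i < n) mass w (comp (@owner n (d n)) m i) =
  \sum_(i < n) w i * #|comp (@owner n (d n)) m i|%:R.
Proof.
move=> mU; under eq_bigr => i _ do rewrite /mass big_mkcond /=.
rewrite exchange_big /=; apply: eq_bigr => k _.
rewrite -sum1_card natr_sum mulr_sumr [RHS]big_mkcond /=; apply: eq_bigr => i _.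
by rewrite mulr1 (comp_sym _ _ _ mU).
Qed.

Let mass_cst1 n (X : {set 'I_n}) : mass (fun=> 1 : R) X = #|X|%:R.
Proof. by rewrite /mass -sum1_card natr_sum. Qed.

(** Polarization: twice the sum of the w_i #|C(i)| is the susceptibility of w + 1
    minus those of w and 1. *)
Lemma weighted_size_cvg w mu : regular_weight w mu ->
  CM_cvg_in_prob (d := d) (fun n m => n%:R `^ (- (1 + de)) *
    \sum_(i < n) w n i * #|comp (@owner n (d n)) m i|%:R) (mu / la).
Proof.
move=> W; have ev n : ~~ odd #|[set: half_edge (d n)]%SET| by rewrite cardsT.
have H := cvg_in_probD (cvg_in_probZ 2^-1 (susceptibility_cvg (regular_weightD1 W)))
  (cvg_in_probZ (- 2^-1) (cvg_in_probD (susceptibility_cvg W) (susceptibility_cvg regular_weight1))).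
have -> : mu / la = 2^-1 * ((mu + mu_d) / (mu_d * la) * (mu + mu_d)) +
    - 2^-1 * (mu / (mu_d * la) * mu + mu_d / (mu_d * la) * mu_d).
  by field; rewrite !gt_eqF.
apply: (cvg_in_prob_ext ev H); near=> n => m mU.
have -> : weighted_susceptibility (fun n (i : 'I_n) => w n i + 1) m =
   weighted_susceptibility w m + weighted_susceptibility (fun n (_ : 'I_n) => 1) m +
   2 * \sum_(i < n) w n i * #|comp (@owner n (d n)) m i|%:R.
  rewrite [2]mulr2n mulrDl mul1r -[in X in _ + (_ + X)](sum_mass_comp _ mU).
  rewrite /weighted_susceptibility -!big_split /=; apply: eq_bigr => i _.
  rewrite (mass_cst1 (comp _ _ _)); set X := comp _ _ _.
  have -> : mass (fun i => w n i + 1) X = mass (w n) X + #|X|%:R.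
    by rewrite -mass_cst1 /mass -big_split.
  ring.
by field.
Unshelve. all: by end_near. Qed.

End Sequences.

Local Open Scope classical_set_scope.
Local Open Scope ring_scope.

(** * Limits of the degree and weight sums *)

Section Hypotheses.
Variables (R : realType) (d : forall n, n.-tuple nat).

Lemma dgrE n (i : 'I_n) : dgr R d i = (tnth (d n) i)%:R.
Proof. by rewrite /dgr /deg dg_owner. Qed.

Lemma card_half_edge n : #|half_edge (d n)| = (\sum_(i < n) tnth (d n) i)%N.
Proof.
have f0 : full (@owner n (d n)) [set: half_edge (d n)]%SET finset.set0.
  by move=> h _; rewrite finset.in_setT.
have := card_full f0; rewrite finset.cardsT => ->.
rewrite [active _ _ _]eq_card0 ?add0n => [|h]; last by rewrite !inE.
by apply: eq_big => [x|x _]; rewrite ?inE // dg_owner.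
Qed.

Lemma gap_nu n : gap R d n = ell R d n * (1 - nu R (d n)).
Proof.
have e1 : ell R d n = \sum_(i < n) (tnth (d n) i)%:R by apply: eq_bigr => i _; rewrite dgrE.
have -> : gap R d n = ell R d n - \sum_(i < n) (tnth (d n) i)%:R * ((tnth (d n) i)%:R - 1).
  rewrite /gap thetaE !outside0 -/(ell R d n); congr (_ - _); apply: eq_bigr => i _.
  by rewrite -/(dgr R d i) dgrE.
rewrite /nu -e1; case: (eqVneq (ell R d n) 0) => e0; last by field.
rewrite e0 mul0r sub0r big1 ?oppr0 // => i _.
have /eqP := e0; rewrite e1 psumr_eq0 // => /allP/(_ i); rewrite mem_index_enum.
by move=> /(_ isT)/eqP ->; rewrite mul0r.
Qed.

Lemma dgr_le_first n (i : 'I_n) : sorted geq (d n) -> dgr R d i <= (nth 0%N (d n) 0)%:R.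
Proof.
move=> sd; rewrite dgrE ler_nat (tnth_nth 0%N).
have H := @sorted_leq_nth _ geq _ _ 0%N (d n) sd 0%N i.
apply: H => //; rewrite ?inE ?size_tuple //.
- by move=> y x z xy yz; apply: leq_trans yz xy.
- by move=> y; apply: leqnn.
- exact: leq_ltn_trans (leq0n i) (ltn_ord i).
Qed.

(** The limiting degree is at least 1, and mu_d is its mean. *)
Lemma mean_degree_gt0 dsp (Om : measurableType dsp) (P : probability Om R)
    (D : {RV P >-> R}) (mu_d : R) :
  (forall x, exists k : nat, (0 < k)%N /\ D x = k%:R) ->
  (fun n => (n%:R^-1 * \sum_(i < n) (tnth (d n) i)%:R)%:E) @ \oo --> ('E_P[D])%E ->
  (fun n => n%:R^-1 * \sum_(i < n) (tnth (d n) i)%:R) @ \oo --> mu_d -> 0 < mu_d.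
Proof.
move=> Dpos meanD mean.
have E1 : ('E_P[D] = mu_d%:E)%E.
  apply: (cvg_unique _ meanD); first exact: ereal_hausdorff.
  by apply: cvg_EFin mean; near=> n.
have D1 x : 1 <= D x by have [k [k0 ->]] := Dpos x; rewrite ler1n.
have : ('E_P[cst 1%R] <= 'E_P[D])%E.
  apply: expectation_le => //.
  - by move=> x; apply: le_trans (D1 x).
  - by apply: aeW => x; apply: D1.
rewrite expectation_cst E1 lee_fin; exact: lt_le_trans.
Unshelve. all: by end_near. Qed.

Lemma near_tail (u : nat -> nat -> R) :
  (fun K : nat => limn_esup (fun n => (u K n)%:E)) @ \oo --> (0 : \bar R)%E ->
  forall eps, 0 < eps -> \forall K \near \oo, \forall n \near \oo, u K n <= eps.
Proof.
move=> u0 eps e0.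
have H : \forall K \near \oo, (limn_esup (fun n => (u K n)%:E) < eps%:E)%E.
  move: u0 => /(_ [set y | (y < eps%:E)%E]); apply.
  by apply: open_nbhs_nbhs; split; [apply: open_ereal_lt_ereal|rewrite /= lte_fin].
apply: filterS H => K; rewrite /limn_esup limf_esupE => /ereal_inf_lt[y [V Voo <-] lt].
apply: filterS Voo => n Vn; rewrite -lee_fin; apply: ltW; apply: le_lt_trans lt.
by apply: ereal_sup_ubound; exists n.
Qed.

Lemma tends_sum (u : nat -> R^nat) (l : R^nat) e N : (forall j, tends (u j) e (l j)) ->
  tends (fun n => \sum_(0 <= j < N) u j n) e (\sum_(0 <= j < N) l j).
Proof.
move=> ul; elim: N => [|N IH].
  rewrite big_nil; apply: tends_near (_ : tends (fun=> 0) e 0); last first.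
    by rewrite /tends; under eq_fun do rewrite mulr0; exact: cvg_cst.
  by near=> n; rewrite big_nil.
rewrite big_nat_recr //=; apply: tends_near (tendsD IH (ul N)).
by near=> n; rewrite big_nat_recr.
Unshelve. all: by end_near. Qed.

(** Termwise convergence of the cubes becomes convergence of their sum because the
    tails are uniformly small. *)
Lemma cubes_tends (al : R) (c : R^nat) :
  (forall j, tends (fun n => (nth 0%N (d n) j)%:R) al (c j)) ->
  cvgn (series (fun i => c i ^+ 3)) ->
  (fun K : nat => limn_esup (fun n => (n%:R `^ (- (3 * al)) *
         \sum_(i < n | (K <= i)%N) (tnth (d n) i)%:R ^+ 3)%:E)) @ \oo --> (0 : \bar R)%E ->
  tends (cube R d) (3 * al) (limn (series (fun i => c i ^+ 3))).
Proof.
move=> dc cc tail; set c3 := limn _; apply/cvgrPdist_le => eps e0.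
have e3 : 0 < eps / 3 by rewrite divr_gt0.
have near1 : \forall N \near \oo, `|c3 - \sum_(0 <= j < N) c j ^+ 3| <= eps / 3.
  have ccv : series (fun i => c i ^+ 3) @ \oo --> c3 by exact: cc.
  by move/cvgrPdist_le: ccv => /(_ _ e3).
have near2 := near_tail tail e3.
have [N _ /(_ N (leqnn N)) /= [N1 N2]] := filterI near1 near2.
pose u (j n : nat) : R := (nth 0%N (d n) j)%:R ^+ 3.
have := @tends_sum u (fun j => c j ^+ 3) (3 * al) N (fun j => tendsX 3 (dc j)).
move=> /cvgrPdist_le/(_ _ e3) near3.
near=> n; have Nn : (N <= n)%N by near: n; exists N.
have H3 : `|\sum_(0 <= j < N) c j ^+ 3 - n%:R `^ (- (3 * al)) * \sum_(0 <= j < N) u j n| <= eps / 3.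
  by near: n; exact: near3.
have H2 : n%:R `^ (- (3 * al)) * \sum_(i < n | (N <= i)%N) (tnth (d n) i)%:R ^+ 3 <= eps / 3.
  by near: n; exact: N2.
have -> : cube R d n = \sum_(0 <= j < N) u j n + \sum_(i < n | (N <= i)%N) (tnth (d n) i)%:R ^+ 3.
  rewrite /cube (bigID (fun i : 'I_n => (i < N)%N)) /= big_mkord; congr (_ + _).
    rewrite (big_ord_widen n (fun j => u j n) Nn); apply: eq_bigr => i _.
    by rewrite dgrE /u (tnth_nth 0%N).
  by apply: eq_big => [i|i _]; rewrite ?dgrE // -leqNgt.
rewrite mulrDr; move: H3 H2 N1.
set a := \sum_(0 <= j < N) c j ^+ 3; set b := _ * \sum_(0 <= j < N) _; set r := _ * \sum_(_ < _ | _) _.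
have r0 : 0 <= r by rewrite mulr_ge0 ?powR_ge0 // sumr_ge0 // => i _; rewrite exprn_ge0.
rewrite !ler_norml => /andP[h1 h2] h3 /andP[h4 h5]; apply/andP; split; lra.
Unshelve. all: by end_near. Qed.

Lemma bigO_order_le (u v : R^nat) e : (u : nat -> R^o) =O_\oo (v : nat -> R^o) ->
  (\forall n \near \oo, v n = n%:R `^ e) -> order_le u e.
Proof.
move=> /eqOP uO ve.
have [k [k0 Hk]] : exists k : R, 0 < k /\ \forall n \near \oo, `|u n| <= k * `|v n|.
  have H : \forall k \near +oo, 0 < k /\ \forall n \near \oo, `|u n| <= k * `|v n|.
    by apply: filterI => //; apply: nbhs_pinfty_gt.
  by have [k] := filter_ex H; exists k.
exists k; split; first exact: ltW; near=> n.
have <- : `|v n| = n%:R `^ e.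
  have -> : v n = n%:R `^ e by near: n.
  by rewrite ger0_norm // powR_ge0.
by near: n.
Unshelve. all: by end_near. Qed.

Lemma nu_tends (de la : R) :
  ((fun n => nu R (d n)) : nat -> R^o) = ((fun n => 1 - la * n%:R `^ (- de)) : nat -> R^o)
       +o_\oo ((fun n => n%:R `^ (- de)) : nat -> R^o) ->
  tends (fun n => 1 - nu R (d n)) (- de) la.
Proof.
move=> /eqaddoP H; apply/cvgrPdist_le => eps e0; near=> n.
have n0 : (0 < n)%N by near: n; exact: near_pos.
have : `|nu R (d n) - (1 - la * n%:R `^ (- de))| <= eps * `|n%:R `^ (- de)|.
  by near: n; exact: (H _ e0).
rewrite [X in _ <= _ * X -> _]ger0_norm ?powR_ge0 // => h.
have e1 := pwNK de n0; have p0 := pw_gt0 de n0.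
rewrite opprK.
have -> : la - n%:R `^ de * (1 - nu R (d n)) =
  n%:R `^ de * (nu R (d n) - (1 - la * n%:R `^ (- de))).
  transitivity (la * (n%:R `^ (- de) * n%:R `^ de) - n%:R `^ de * (1 - nu R (d n))).
    by rewrite e1 mulr1.
  by ring.
rewrite normrM (ger0_norm (ltW p0)); apply: le_trans (ler_wpM2l (ltW p0) h) _.
by rewrite mulrCA [X in eps * X]mulrC e1 mulr1.
Unshelve. all: by end_near. Qed.

End Hypotheses.

Theorem theorem2p3 (R : realType) (tau : R) (htau : 3 < tau < 4)
  (d : forall n, n.-tuple nat) (w : forall n, 'I_n -> R)
  (hd_sorted : forall n, sorted geq (d n))
  (hd_even : forall n, ~~ odd (\sum_(i < n) tnth (d n) i)%N)
  (hw_ge0 : forall n (i : 'I_n), 0 <= w n i)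
  (* condition (i) *)
  (c : R^nat)
  (hc : (ell_down 3 `\` ell_down 2) c)
  (hdc : forall i : nat,
     (fun n => n%:R `^ (- alpha tau) * (nth 0%N (d n) i)%:R) @ \oo --> c i)
  (dsp : measure_display) (Om : measurableType dsp) (P : probability Om R)
  (D : {RV P >-> R})
  (hD_pos : forall x, exists k : nat, (0 < k)%N /\ D x = k%:R)
  (hD_law : degree_cvg_in_distribution d D)
  (hD_mean : (fun n => (n%:R^-1 * \sum_(i < n) (tnth (d n) i)%:R)%:E)
     @ \oo --> ('E_P[D])%E)
  (hD_moment2 : (fun n => (n%:R^-1 * \sum_(i < n) (tnth (d n) i)%:R ^+ 2)%:E)
     @ \oo --> ('E_P[fun x => (D x ^+ 2)%R])%E)
  (hd_tail : (fun K : nat => limn_esup (fun n =>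
      (n%:R `^ (- (3 * alpha tau)) *
         \sum_(i < n | (K <= i)%N) (tnth (d n) i)%:R ^+ 3)%:E))
     @ \oo --> (0 : \bar R)%E)
  (mu_d mu_w mu_dw : R)
  (hmu_d : (fun n => n%:R^-1 * \sum_(i < n) (tnth (d n) i)%:R) @ \oo --> mu_d)
  (hmu_w : (fun n => n%:R^-1 * \sum_(i < n) w n i) @ \oo --> mu_w)
  (hmu_dw : (fun n => n%:R^-1 * \sum_(i < n) (tnth (d n) i)%:R * w n i)
     @ \oo --> mu_dw)
  (* condition (ii) *)
  (hw_max : (fun n => \big[Num.max/0]_(i < n) w n i : R^o)
     =O_\oo (fun n => n%:R `^ alpha tau : R^o))
  (hw_moment2 : (fun n => \sum_(i < n) w n i ^+ 2 : R^o)
     =O_\oo (fun n => n%:R : R^o))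
  (hw_moment3 : (fun n =>
      Num.max (\sum_(i < n) w n i ^+ 3)
        (Num.max (\sum_(i < n) (tnth (d n) i)%:R ^+ 2 * w n i)
           (\sum_(i < n) (tnth (d n) i)%:R * w n i ^+ 2)) : R^o)
     =O_\oo (fun n => n%:R `^ (3 * alpha tau) : R^o))
  (* condition (iii) *)
  (delta lambda0 : R)
  (hdelta : 0 < delta < eta tau) (hlambda0 : 0 < lambda0)
  (hnu : (fun n => nu R (d n) : R^o) =
     (fun n => 1 - lambda0 * n%:R `^ (- delta) : R^o)
       +o_\oo (fun n => n%:R `^ (- delta) : R^o)) :
  [/\ CM_cvg_in_prob
        (fun n (m : {ffun half_edge (d n) -> half_edge (d n)}) =>
           n%:R `^ (- delta) * s_star m (w n) 2)
        (mu_dw ^+ 2 / (mu_d * lambda0)),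
      CM_cvg_in_prob
        (fun n (m : {ffun half_edge (d n) -> half_edge (d n)}) =>
           n%:R `^ (- delta) * spr_star m (w n))
        (mu_dw / lambda0),
      forall j : nat,
        CM_cvg_in_prob
          (fun n (m : {ffun half_edge (d n) -> half_edge (d n)}) =>
             n%:R `^ (- (alpha tau + delta)) * comp_weight_nat m (w n) j)
          (mu_dw / (mu_d * lambda0) * c j),
      CM_cvg_in_prob
        (fun n (m : {ffun half_edge (d n) -> half_edge (d n)}) =>
           n%:R `^ (- (3 * alpha tau) - 3 * delta + 1) * s_star m (w n) 3)
        ((mu_dw / (mu_d * lambda0)) ^+ 3 * limn (series (fun i => c i ^+ 3)))
    & CM_cvg_in_prob
        (fun n (m : {ffun half_edge (d n) -> half_edge (d n)}) =>
           n%:R `^ (- (2 * delta)) * D_star m (w n))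
        (mu_dw ^+ 2 / (mu_d * lambda0 ^+ 2))].
Proof.
set al := alpha tau; have tau1 : 0 < tau - 1 by case/andP: htau => h _; lra.
have alE : al * (tau - 1) = 1 by rewrite /al /alpha divfK // gt_eqF.
have al0 : 0 < al by rewrite /al /alpha divr_gt0.
have al3 : 1 < 3 * al by case/andP: htau => h1 h2; nra.
have al2 : 2 * al < 1 by case/andP: htau => h1 h2; nra.
have etaE : eta tau = 1 - 2 * al by rewrite /eta /al /alpha; field; rewrite gt_eqF.
have [de0 de1] : 0 < delta /\ delta < 1 - 2 * al by rewrite -etaE; apply/andP.
have mu_d0 := mean_degree_gt0 hD_pos hD_mean hmu_d.
have [[_ [c0 cc]] _] := hc.
have even_d n : ~~ odd #|half_edge (d n)| by rewrite card_half_edge.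
have n1 (u v : R^nat) l : (fun n => n%:R^-1 * u n) @ \oo --> l -> u =1 v -> tends v 1 l.
  move=> ul uv; apply: cvg_near ul; near=> n; rewrite uv powR_inv1 //.
have ellT : tends (ell R d) 1 mu_d.
  by apply: (n1 _ _ _ hmu_d) => n; apply: eq_bigr => i _; rewrite dgrE.
have gapT : tends (gap R d) (1 - delta) (mu_d * lambda0).
  apply: tends_near (tendsM ellT (nu_tends hnu)); near=> n; by rewrite gap_nu.
have dmP n (i : 'I_n) : dgr R d i <= (nth 0%N (d n) 0)%:R by apply: dgr_le_first.
have dmO : order_le (fun n => (nth 0%N (d n) 0)%:R : R) al := tends_order (hdc 0%N).
have cubeT := cubes_tends hdc cc hd_tail.
have moment3 (u : R^nat) : (forall n, 0 <= u n) ->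
    (forall n, u n <= Num.max (\sum_i w n i ^+ 3)
        (Num.max (\sum_(i < n) (tnth (d n) i)%:R ^+ 2 * w n i)
           (\sum_(i < n) (tnth (d n) i)%:R * w n i ^+ 2))) -> order_le u (3 * al).
  move=> u0 uP; apply: order_le_dom (bigO_order_le hw_moment3 _); last by near=> n.
  by near=> n; rewrite ger0_norm // (le_trans (uP n)) // ler_norm.
have W : regular_weight d al w mu_dw.
  apply: (@RegularWeight R d al w mu_dw hw_ge0 (fun n => \big[Num.max/0]_(i < n) w n i)).
  - by move=> n i; apply: le_bigmax.
  - by apply: (bigO_order_le hw_max); near=> n.
  - by apply: (n1 _ _ _ hmu_dw) => n; apply: eq_bigr => i _; rewrite dgrE.
  - by apply: (bigO_order_le hw_moment2); near=> n; rewrite powRr1.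
  - apply: moment3 => n; last by rewrite le_max lexx.
    by apply: sumr_ge0 => i _; rewrite exprn_ge0.
  - apply: moment3 => n; last first.
      rewrite !le_max [X in _ || (X || _)](_ : _ = true) ?orbT //.
      by under eq_bigr do rewrite dgrE; rewrite lexx.
    by apply: sumr_ge0 => i _; rewrite mulr_ge0 ?sqr_ge0.
  - apply: moment3 => n; last first.
      rewrite !le_max [X in _ || (_ || X)](_ : _ = true) ?orbT //.
      by under eq_bigr do rewrite dgrE; rewrite lexx.
    by apply: sumr_ge0 => i _; rewrite mulr_ge0 ?sqr_ge0 ?dgr_ge0.
have ev n : ~~ odd #|[set: half_edge (d n)]%SET| by rewrite finset.cardsT.
have md : mu_d != 0 by rewrite gt_eqF.
have ld : lambda0 != 0 by rewrite gt_eqF.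
have split_pow (a b : R) n : (0 < n)%N -> n%:R `^ (- (a + b)) = n%:R `^ (- a) * n%:R `^ (- b) :> R.
  by move=> n0; rewrite -pwD // opprD.
split.
- have := susceptibility_cvg al3 al2 de0 de1 mu_d0 hlambda0 even_d dmP dmO gapT cubeT W.
  have -> : mu_dw / (mu_d * lambda0) * mu_dw = mu_dw ^+ 2 / (mu_d * lambda0).
    by field; rewrite md ld.
  move=> H; apply: (cvg_in_prob_ext ev H); near=> n => m mU.
  have n0 : (0 < n)%N by near: n; exact: near_pos.
  rewrite s_starE // mulrA addrC split_pow // powR_inv1 //.
- have H := weighted_size_cvg al3 al2 de0 de1 mu_d0 hlambda0 even_d dmP dmO ellT gapT cubeT W.
  apply: (cvg_in_prob_ext ev H); near=> n => m mU.
  have n0 : (0 < n)%N by near: n; exact: near_pos.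
  by rewrite spr_starE // mulrA addrC split_pow // powR_inv1.
- move=> j.
  exact: (comp_weight_nat_cvg al3 al2 de0 de1 mu_d0 hlambda0 even_d dmP dmO gapT cubeT W (c0 j) (hdc j)).
- have csc : (fun N => \sum_(0 <= j < N) c j ^+ 3) @ \oo --> limn (series (fun i => c i ^+ 3)).
    exact: cc.
  have := cubes_cvg al3 al2 de0 de1 mu_d0 hlambda0 even_d dmP dmO gapT cubeT W c0 hdc csc.
  set c3 := limn _; set kh := mu_dw / _; have -> : kh * (kh ^+ 2 * c3) = kh ^+ 3 * c3 by ring.
  move=> H; apply: (cvg_in_prob_ext ev H); near=> n => m mU.
  have n0 : (0 < n)%N by near: n; exact: near_pos.
  have -> : - (3 * al) - 3 * delta + 1 = - (3 * al + 3 * delta) + 1 by ring.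
  rewrite pwD // powRr1 // /s_star -mulrA [X in _ = _ * X]mulrA divff ?mul1r //.
  by rewrite pnatr_eq0 -lt0n.
- have := distance_cvg al3 al2 de0 de1 mu_d0 hlambda0 even_d dmP dmO ellT gapT cubeT W.
  have -> : mu_dw * (mu_dw * mu_d * ((mu_d * lambda0) ^+ 2)^-1) = mu_dw ^+ 2 / (mu_d * lambda0 ^+ 2).
    by field; rewrite md ld.
  move=> H; apply: (cvg_in_prob_ext ev H); near=> n => m mU.
  have n0 : (0 < n)%N by near: n; exact: near_pos.
  rewrite /D_star mulrA addrC split_pow // powR_inv1 //; congr (_ * _).
  rewrite /weighted_distance; apply: eq_bigr => i _; rewrite mulr_sumr; apply: eq_big => [j|j _]; first by rewrite component_comp.
  by rewrite mulrA.
Unshelve. all: by end_near. Qed.
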